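(* Let $n\ge 1$ and let $N$ be a closed oriented $(2n-1)$-manifold. Suppose that $\eta$ is a contact form, $\nu$ a non-singular (i.e. nowhere vanishing) closed $1$-form, and $\tau$ a $2$-form on $N$ such that, for each $t\in[0,1]$, the $1$-form $\eta_t=(1-t)\nu+t\eta$ is an $\varepsilon\tau$-confoliation form with reference twisting $\tau$. Then, if $n>1$, we have $\nu\wedge(d\eta)^{n-1}=0$ and $\nu\wedge\tau^{n-1}>0$ everywhere on $N$. Further, the $1$-form $\eta_t$ is a contact form for every $t\in(0,1]$.
   Context: All manifolds and forms are smooth. On an oriented manifold, a top-degree form is written $>0$ if it is a positive volume form at every point. A $1$-form $\eta$ on an oriented $(2m+1)$-manifold is a (positive) contact form if $\eta\wedge(d\eta)^m>0$. Given a $1$-form $\alpha$ and a $2$-form $\tau$ on an oriented $(2m+1)$-manifold, the pair $(\alpha,\tau)$ is a twisted contact structure if $\alpha\wedge(d\alpha+\tau)^m>0$. The $1$-form $\alpha$ is called an $\varepsilon\tau$-confoliation form with reference twisting $\tau$ if $(\alpha,\varepsilon\tau)$ is a twisted contact structure for every $\varepsilon\in(0,1]$, i.e. $\alpha\wedge(d\alpha+\varepsilon\tau)^m>0$ for all $\varepsilon\in(0,1]$. (Here $m=n-1$.) *)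

(* Defs.v *)
From HB Require Import structures.
From mathcomp Require Import all_boot all_order all_fingroup all_algebra.
From mathcomp Require Import all_classical all_reals all_analysis.

Set Implicit Arguments.
Unset Strict Implicit.
Unset Printing Implicit Defensive.

Import Order.TTheory GRing.Theory Num.Theory.
Import numFieldNormedType.Exports.

Local Open Scope classical_set_scope.
Local Open Scope ring_scope.

(* C^k on a set U, which is always open below: for k > 0, f is (Frechet)
   differentiable at the points of U and its derivative is C^(k-1); the space
   being finite-dimensional, the latter is tested vector by vector. *)
Fixpoint Ck_on (R : realType) (V W : normedModType R) (k : nat)
    (U : set V) (f : V -> W) : Prop :=
  match k with
  | 0 => forall x, U x -> {for x, continuous f}
  | k'.+1 => (forall x, U x -> differentiable f x) /\
             (forall v : V, Ck_on k' U (fun x => 'd f x v))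
  end.

Definition smooth_on (R : realType) (V W : normedModType R)
    (U : set V) (f : V -> W) : Prop := forall k, Ck_on k U f.

(* The total functions [cmap] and [cinv] are only meaningful on [cdom] and on
   its image, respectively. *)
Record chart (R : realType) (d : nat) (M : topologicalType) := Chart {
  cdom : set M ;
  cmap : M -> 'rV[R]_d ;
  cinv : 'rV[R]_d -> M ;
  cdom_open : open cdom ;
  cimg_open : open (cmap @` cdom) ;
  cmapK : forall p, cdom p -> cinv (cmap p) = p ;
  cmap_continuous : {within cdom, continuous cmap} ;
  cinv_continuous : {within cmap @` cdom, continuous cinv} }.

(* The orientation is given by the atlas: it consists of oriented charts, so
   that all Jacobian determinants of coordinate changes are positive.  The
   atlas need not be maximal.  No boundary, not necessarily connected. *)
Record oriented_manifold (R : realType) (d : nat) := OrientedManifold {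
  carrier :> topologicalType ;
  carrier_hausdorff : hausdorff_space carrier ;
  carrier_second_countable : @second_countable carrier ;
  chart_index : Type ;
  atlas : chart_index -> chart R d carrier ;
  atlas_cover : forall p, exists i, cdom (atlas i) p ;
  atlas_smooth : forall i j,
    smooth_on (cmap (atlas i) @` (cdom (atlas i) `&` cdom (atlas j)))
              (cmap (atlas j) \o cinv (atlas i)) ;
  atlas_oriented : forall i j p, cdom (atlas i) p -> cdom (atlas j) p ->
    0 < \det ('J (cmap (atlas j) \o cinv (atlas i)) (cmap (atlas i) p)) }.

Section Forms.
Context {R : realType}.

(* A k-tuple of vectors of R^d is the k x d matrix whose rows are these
   vectors. *)
Definition multilinear_rows (d k : nat) (f : 'M[R]_(k, d) -> R) : Prop :=
  forall (A B C : 'M[R]_(k, d)) (i0 : 'I_k) (b c : R),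
    row i0 A = b *: row i0 B + c *: row i0 C ->
    row' i0 B = row' i0 A -> row' i0 C = row' i0 A ->
    f A = b * f B + c * f C.

Definition alternating_rows (d k : nat) (f : 'M[R]_(k, d) -> R) : Prop :=
  forall (A : 'M[R]_(k, d)) (i1 i2 : 'I_k),
    i1 != i2 -> row i1 A = row i2 A -> f A = 0.

(* [w i x v] is the value, in the coordinates of the chart i and at the point
   of coordinates x, of a k-form on the tangent vectors v; it is meaningful
   only for x in the image of the chart.  The definition below imposes no
   condition: the actual forms are the families satisfying [is_form]. *)
Definition local_form (d : nat) (N : oriented_manifold R d) (k : nat) :=
  chart_index N -> 'rV[R]_d -> 'M[R]_(k, d) -> R.

Section Operations.
Context {d : nat} {N : oriented_manifold R d}.

(* The last condition is the invariance under coordinate changes: a tangent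
   vector at p of coordinates u in the chart i has coordinates
   u *m 'J (phi_j \o phi_i^-1) in the chart j. *)
Definition is_form (k : nat) (w : local_form N k) : Prop :=
  [/\ forall i p, cdom (atlas i) p ->
        multilinear_rows (w i (cmap (atlas i) p)) /\
        alternating_rows (w i (cmap (atlas i) p)),
      forall i (v : 'M[R]_(k, d)),
        smooth_on (cmap (atlas i) @` cdom (atlas i)) (fun x => w i x v)
    & forall i j p, cdom (atlas i) p -> cdom (atlas j) p ->
        forall v : 'M[R]_(k, d),
          w i (cmap (atlas i) p) v =
          w j (cmap (atlas j) p)
            (v *m 'J (cmap (atlas j) \o cinv (atlas i)) (cmap (atlas i) p))].

Definition form_add (k : nat) (w1 w2 : local_form N k) : local_form N k :=
  fun i x v => w1 i x v + w2 i x v.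

Definition form_scale (k : nat) (c : R) (w : local_form N k) : local_form N k :=
  fun i x v => c * w i x v.

Definition wedge (k l : nat) (w1 : local_form N k) (w2 : local_form N l) :
    local_form N (k + l) :=
  fun i x v => ((k`! * l`!)%N%:R)^-1 *
    \sum_(s : 'S_(k + l)) (-1) ^+ s *
      (w1 i x (usubmx (row_perm s v)) * w2 i x (dsubmx (row_perm s v))).

Fixpoint wedge_pow (w : local_form N 2) (m : nat) : local_form N m.*2 :=
  match m with
  | 0 => fun _ _ _ => 1
  | m'.+1 => wedge w (@wedge_pow w m')
  end.

(* dw(v_0, ..., v_k) = \sum_i (-1)^i D_(v_i) (w(v_0, ..., v_k without v_i)),
   for constant vectors v_0, ..., v_k in a chart. *)
Definition ext_d (k : nat) (w : local_form N k) : local_form N k.+1 :=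
  fun i x v => \sum_(a < k.+1) (-1) ^+ a *
    'D_(row a v) (fun y => w i y (row' a v)) x.

Definition vanishing_form (k : nat) (w : local_form N k) : Prop :=
  forall i p, cdom (atlas i) p -> forall v, w i (cmap (atlas i) p) v = 0.

Definition closed_form (k : nat) (w : local_form N k) : Prop :=
  vanishing_form (ext_d w).

Definition nonsingular_form (k : nat) (w : local_form N k) : Prop :=
  forall i p, cdom (atlas i) p -> exists v, w i (cmap (atlas i) p) v != 0.

(* Positivity on the positively oriented frames of the tangent spaces. *)
Definition positive_form (w : local_form N d) : Prop :=
  forall i p, cdom (atlas i) p ->
    forall v : 'M[R]_d, 0 < \det v -> 0 < w i (cmap (atlas i) p) v.

End Operations.

Arguments wedge_pow {d N} w m.

Section Contact.
Context {m : nat} {N : oriented_manifold R m.*2.+1}.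

Definition contact_form (eta : local_form N 1) : Prop :=
  is_form eta /\ positive_form (wedge eta (wedge_pow (ext_d eta) m)).

Definition twisted_contact_structure
    (alpha : local_form N 1) (tau : local_form N 2) : Prop :=
  [/\ is_form alpha, is_form tau &
      positive_form
        (wedge alpha (wedge_pow (form_add (ext_d alpha) tau) m))].

Definition confoliation_form
    (alpha : local_form N 1) (tau : local_form N 2) : Prop :=
  forall eps : R, 0 < eps <= 1 ->
    twisted_contact_structure alpha (form_scale eps tau).

End Contact.

Definition form_path (d : nat) (N : oriented_manifold R d) (k : nat)
    (w0 w1 : local_form N k) (t : R) : local_form N k :=
  form_add (form_scale (1 - t) w0) (form_scale t w1).

End Forms.

Arguments wedge_pow {R d N} w m.

(* Main.v *)
(** Write n = m + 1.  Since nu is closed, d eta_t = t d eta; letting epsilon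
tend to 0 and then t tend to 0 in the confoliation inequality gives
nu /\ (d eta)^m >= 0.  This form is exact up to sign, being d of
nu /\ eta /\ (d eta)^(m-1); hence it vanishes by Stokes' theorem on the closed
manifold N.  Then eta_t /\ (d eta_t)^m = t^(m+1) eta /\ (d eta)^m > 0, and
the confoliation inequality at t = 0 reads epsilon^m nu /\ tau^m > 0.

Stokes' theorem is needed only for a nonnegative divergence, and integrals are
replaced by lattice sums, compared up to o(1).  The lattice sum of a partial
derivative of a compactly supported C^1 function tends to 0.  If Phi_s is a
homotopy of C^2 maps, then the s-derivative of (f o Phi_s) det D Phi_s is a
divergence in x by Piola's identity, so that the lattice sums at s = 0 and
s = 1 agree in the limit: this deforms a coordinate change, near a point, into
its affine part, and a linear map, factor by factor in its LUP decomposition,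
into a signed permutation of the coordinates.  Two successive partitions of
unity reduce the global statement to these local ones. *)

From HB Require Import structures.
Require Import Defs.
From mathcomp Require Import all_boot all_order all_fingroup all_algebra.
From mathcomp Require Import all_classical all_reals all_analysis.
From mathcomp Require Import ring lra zify.

Set Implicit Arguments.
Unset Strict Implicit.
Unset Printing Implicit Defensive.

Import Order.TTheory GRing.Theory Num.Theory.
Import numFieldNormedType.Exports.

Local Open Scope classical_set_scope.
Local Open Scope ring_scope.

(** * Functions of class C^k *)

(** No lattice sum is shown to converge to an integral: only differences tending to 0 are used, and
    nonnegativity turns a vanishing limit into pointwise vanishing. The obstacle is that the
    lattices of two charts are unrelated. If X is the vector density of the primitive and the
    [rho p] form a partition of unity subordinate to charts, then [rho p] div X + d([rho p])(X) is
    the divergence of a field compactly supported in one chart, so its lattice sums tend to 0. The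
    terms d([rho p])(X) add up to 0 pointwise, but each is summed in its own chart. The second
    partition [theta q] cuts them into pieces small enough for the local change of variables, which
    brings all the pieces around q into one chart, where they cancel exactly. The change of
    variables is only local because the homotopy to the affine part is controlled only where the
    remainder is small. In the primitive, the direction of differentiation occupies the slot just
    after nu; this compensates the sign in d(nu /\ eta /\ (d eta)^(m-1)) = - nu /\ (d eta)^m. *)

Lemma near_eq_diff (R : numFieldType) (V W : normedModType R)
    (f g : V -> W) (x : V) :
  (\near x, f x = g x) -> differentiable f x ->
  differentiable g x /\ forall v, 'd g x v = 'd f x v.
Proof.
move=> fg df; have fgx : f x = g x by exact: (nbhs_singleton fg).
have dg : g \o shift x = cst (g x) + 'd f x +o_ 0 id.
  apply/eqaddoP => _/posnumP[e].
  have /eqaddoP/(_ e%:num (gt0 e)) H := diff_locally df.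
  have fg0 : \forall h \near (0 : V), f (h + x) = g (h + x).
    have /= := fg; rewrite (near_shift 0 x) => {}fg.
    by near=> h; near: h; apply: filterS fg => h; rewrite /= subr0.
  apply: filterS2 fg0 H => h fgh.
  by rewrite /= !fctE /= -fgh -fgx.
have cdf := diff_continuous df.
have E := diff_unique cdf dg.
split=> [|v]; last by rewrite E.
by apply/diff_locallyP; rewrite E.
Unshelve. all: by end_near. Qed.

Section Ck.
Context {R : realType} {V : normedModType R}.
Implicit Types (U : set V) (W : normedModType R).

Lemma Ck_on_ext k W U (f g : V -> W) : open U -> {in U, f =1 g} ->
  Ck_on k U f -> Ck_on k U g.
Proof.
move=> oU; elim: k f g => [|k IH] f g fg /=.
  move=> cf x Ux; rewrite /prop_for /continuous_at -(fg x) ?inE//.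
  apply: cvg_trans (cf x Ux); apply: near_eq_cvg.
  by apply: filterS (open_nbhs_nbhs (conj oU Ux)) => y Uy; rewrite fg ?inE.
have nfg x : U x -> \near x, f x = g x.
  by move=> Ux; apply: filterS (open_nbhs_nbhs (conj oU Ux)) => y Uy; rewrite fg ?inE.
move=> [df cdf]; split=> [x Ux|v]; first by case: (near_eq_diff (nfg x Ux) (df x Ux)).
apply: IH (cdf v) => x; rewrite inE => Ux.
by have [_ /(_ v)/esym] := near_eq_diff (nfg x Ux) (df x Ux).
Qed.

Lemma Ck_on_sub k W U U' (f : V -> W) : U' `<=` U -> Ck_on k U f -> Ck_on k U' f.
Proof.
move=> sU; elim: k f => [|k IH] f /=; first by move=> cf x /sU; exact: cf.
by move=> [df cdf]; split=> [x /sU|v]; [exact: df|exact: IH].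
Qed.

Lemma Ck_on_setU k W U U' (f : V -> W) :
  Ck_on k U f -> Ck_on k U' f -> Ck_on k (U `|` U') f.
Proof.
elim: k f => [|k IH] f /=; first by move=> cf cf' x [/cf|/cf'].
by move=> [df cf] [df' cf']; split=> [x [/df|/df']//|v]; exact: IH.
Qed.

Lemma Ck_onW k W U (f : V -> W) : Ck_on k.+1 U f -> Ck_on k U f.
Proof.
elim: k f => [|k IH] f.
  by case=> df _ x /df; exact: differentiable_continuous.
by move=> [df cf]; split=> // v; apply: IH.
Qed.

Lemma Ck_on_le k l W U (f : V -> W) : (k <= l)%N -> Ck_on l U f -> Ck_on k U f.
Proof. by move=> /subnK <-; elim: (l - k)%N => // n IH /Ck_onW; exact: IH. Qed.

Lemma Ck_on_cst k W U (w : W) : Ck_on k U (fun _ : V => w).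
Proof.
elim: k w => [|k IH] w /=; first by move=> x _; exact: cvg_cst.
split=> [x _|v]; first exact: differentiable_cst.
under eq_fun do rewrite -[fun _ => w]/(cst w) diff_cst.
exact: IH.
Qed.

Lemma Ck_on_linear k W U (f : {linear V -> W}) : continuous f -> Ck_on k U f.
Proof.
move=> cf; case: k => [x _|k]; first exact: cf.
split=> [x _|v]; first exact: linear_differentiable.
by under eq_fun do rewrite diff_lin//; exact: Ck_on_cst.
Qed.

Lemma Ck_onD k W U (f g : V -> W) : open U -> Ck_on k U f -> Ck_on k U g ->
  Ck_on k U (fun x => f x + g x).
Proof.
move=> oU; elim: k f g => [|k IH] f g /=.
  by move=> cf cg x Ux; apply: continuousD; [exact: cf|exact: cg].
move=> [df cf] [dg cg]; split=> [x Ux|v].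
  by apply: differentiableD; [exact: df|exact: dg].
apply: (Ck_on_ext oU _ (IH _ _ (cf v) (cg v))) => x; rewrite inE => Ux.
by rewrite (@diffD _ _ _ f g)//; [exact: df|exact: dg].
Qed.

Lemma Ck_onZ k W U (c : R) (f : V -> W) : open U -> Ck_on k U f ->
  Ck_on k U (fun x => c *: f x).
Proof.
move=> oU; elim: k f => [|k IH] f /=.
  by move=> cf x Ux; apply: continuousZr; exact: cf.
move=> [df cf]; split=> [x Ux|v].
  by apply: differentiableZ; exact: df.
apply: (Ck_on_ext oU _ (IH _ (cf v))) => x; rewrite inE => Ux.
by rewrite (@diffZ _ _ _ f)//; exact: df.
Qed.

Lemma Ck_onM k U (f g : V -> R) : open U -> Ck_on k U f -> Ck_on k U g ->
  Ck_on k U (fun x => f x * g x).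
Proof.
move=> oU; elim: k f g => [|k IH] f g.
  by move=> cf cg x Ux; apply: continuousM; [exact: cf|exact: cg].
move=> Cf Cg; have [df cf] := Cf; have [dg cg] := Cg; split=> [x Ux|v].
  by apply: differentiableM; [exact: df|exact: dg].
have := Ck_onD oU (IH _ _ (Ck_onW Cf) (cg v)) (IH _ _ (Ck_onW Cg) (cf v)).
apply: Ck_on_ext => // x; rewrite inE => Ux.
by rewrite (@diffM _ _ f g)//; [exact: df|exact: dg].
Qed.

Lemma Ck_on_sum k W U (I : Type) (r : seq I) (P : pred I) (f : I -> V -> W) :
  open U -> (forall i, P i -> Ck_on k U (f i)) ->
  Ck_on k U (fun x => \sum_(i <- r | P i) f i x).
Proof.
move=> oU Cf; elim: r => [|i r IH].
  by under eq_fun do rewrite big_nil; exact: Ck_on_cst.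
under eq_fun do rewrite big_cons.
by case Pi: (P i) => //; apply: Ck_onD => //; exact: Cf.
Qed.

Lemma Ck_on_prod k U (I : Type) (r : seq I) (P : pred I) (f : I -> V -> R) :
  open U -> (forall i, P i -> Ck_on k U (f i)) ->
  Ck_on k U (fun x => \prod_(i <- r | P i) f i x).
Proof.
move=> oU Cf; elim: r => [|i r IH].
  by under eq_fun do rewrite big_nil; exact: Ck_on_cst.
under eq_fun do rewrite big_cons.
by case Pi: (P i) => //; apply: Ck_onM => //; exact: Cf.
Qed.

Lemma Ck_onV k U (f : V -> R) : open U -> (forall x, U x -> f x != 0) ->
  Ck_on k U f -> Ck_on k U (fun x => (f x)^-1).
Proof.
move=> oU f0; elim: k => [|k IH].
  by move=> cf x Ux; apply: cvgV; [exact: f0|exact: cf].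
move=> Cf; have [df cf] := Cf; have CV := IH (Ck_onW Cf); split=> [x Ux|v].
  by apply: differentiableV; [exact: df|exact: f0].
have := Ck_onZ (-1) oU (Ck_onM oU (Ck_onM oU CV CV) (cf v)).
apply: Ck_on_ext => // x; rewrite inE => Ux.
rewrite (@diffV _ _ f)//; [|exact: df|exact: f0].
by rewrite /= scaleN1r -mulNr -expr2 exprVn.
Qed.

End Ck.

Section Components.
Context {R : realType} {V : normedModType R} {n : nat}.
Implicit Types (U : set V) (W : normedModType R).

Lemma coord_continuous (a : 'I_n) : continuous (fun x : 'rV[R]_n => x 0 a).
Proof. by move=> x; apply/differentiable_continuous/differentiable_coord. Qed.

Lemma rV_decomp (Phi : V -> 'rV[R]_n) :
  Phi = \sum_(a < n) (fun x => Phi x 0 a *: (delta_mx 0 a : 'rV[R]_n)).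
Proof. by apply/funext => x; rewrite fct_sumE [LHS]row_sum_delta. Qed.

Lemma continuous_components (Phi : V -> 'rV[R]_n) (x : V) :
  (forall a, {for x, continuous (fun x => Phi x 0 a)}) ->
  {for x, continuous Phi}.
Proof.
move=> cPhi; rewrite (rV_decomp Phi).
elim/big_ind : _ => [|f g cf cg|a _]; first exact: cvg_cst.
  exact: continuousD.
exact: continuousZl.
Qed.

Lemma differentiable_components (Phi : V -> 'rV[R]_n) (x : V) :
  (forall a, differentiable (fun x => Phi x 0 a) x) -> differentiable Phi x.
Proof.
move=> dPhi; rewrite (rV_decomp Phi); apply: differentiable_sum => a.
exact: differentiableZl.
Qed.

Lemma diff_component (Phi : V -> 'rV[R]_n) (x v : V) (a : 'I_n) :
  differentiable Phi x -> ('d Phi x v) 0 a = 'd (fun x => Phi x 0 a) x v.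
Proof.
move=> dPhi.
have dc : differentiable (fun y : 'rV[R]_n => y 0 a) (Phi x).
  exact: differentiable_coord.
have /= -> := congr1 (fun h => h v) (diff_comp dPhi dc).
have cc := @coord_continuous a.
have lc : linear (fun y : 'rV[R]_n => y 0 a) by move=> k y z; rewrite !mxE.
pose cl := GRing.isLinear.Build _ _ _ _ _ lc.
pose cL : {linear 'rV[R]_n -> R} := HB.pack (fun y : 'rV[R]_n => y 0 a) cl.
by have -> := congr1 (fun h => h ('d Phi x v)) (@diff_lin _ _ _ cL (Phi x) cc).
Qed.

Lemma Ck_on_component k U (Phi : V -> 'rV[R]_n) (a : 'I_n) : open U ->
  Ck_on k U Phi -> Ck_on k U (fun x => Phi x 0 a).
Proof.
move=> oU; elim: k Phi => [|k IH] Phi.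
  move=> cPhi x Ux.
  exact: (continuous_comp (cPhi x Ux) (@coord_continuous a (Phi x))).
move=> [dPhi cPhi]; split=> [x Ux|v].
  exact: (differentiable_comp (dPhi x Ux) (differentiable_coord _ 0 a)).
apply: (Ck_on_ext oU _ (IH _ (cPhi v))) => x; rewrite inE => Ux.
by rewrite -diff_component//; exact: dPhi.
Qed.

Lemma linear_rV_sum W (f : {linear 'rV[R]_n -> W}) v :
  f v = \sum_(a < n) v 0 a *: f (delta_mx 0 a).
Proof.
by rewrite {1}[v]row_sum_delta linear_sum; apply: eq_bigr => a _; rewrite linearZ.
Qed.

End Components.

Section Comp.
Context {R : realType} {V : normedModType R}.

Lemma diff_comp_apply (V0 V' W : normedModType R) (f : V0 -> V') (g : V' -> W)
    (x v : V0) : differentiable f x -> differentiable g (f x) ->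
  'd (g \o f) x v = 'd g (f x) ('d f x v).
Proof. by move=> df dg; exact: (congr1 (fun h => h v) (diff_comp df dg)). Qed.

(** By the chain rule the derivative is a sum of products of derivatives of components of [Phi] with
    partial derivatives of [f] composed with [Phi]; the induction hypothesis applies to the
    latter. *)
Lemma Ck_on_comp k n (U : set V) (U' : set 'rV[R]_n) (f : 'rV[R]_n -> R)
    (Phi : V -> 'rV[R]_n) : open U -> open U' ->
  (forall x, U x -> U' (Phi x)) -> Ck_on k U' f ->
  (forall a, Ck_on k U (fun x => Phi x 0 a)) -> Ck_on k U (f \o Phi).
Proof.
move=> oU oU' UU'; elim: k f => [|k IH] f.
  move=> cf cPhi x Ux; apply: continuous_comp; last exact/cf/UU'.
  by apply: continuous_components => a; exact: cPhi.
move=> [df cf] cPhi.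
have dPhi x : U x -> differentiable Phi x.
  by move=> Ux; apply: differentiable_components => a; apply: (cPhi a).1.
split=> [x Ux|v].
  by apply: differentiable_comp; [exact: dPhi|exact/df/UU'].
have CD a : Ck_on k U (fun x => 'd (fun x => Phi x 0 a) x v *
    ((fun y => 'd f y (delta_mx 0 a)) \o Phi) x).
  apply: Ck_onM => //; first exact: (cPhi a).2.
  by apply: IH => [|b]; [exact: cf|exact/Ck_onW/cPhi].
have := Ck_on_sum (index_enum 'I_n) (P := predT) oU (fun a _ => CD a).
apply: Ck_on_ext => // x; rewrite inE => Ux.
have E1 := diff_comp_apply v (dPhi x Ux) (df _ (UU' x Ux)).
have E2 := linear_rV_sum ('d f (Phi x)) ('d Phi x v).
apply/esym/(etrans E1)/(etrans E2); apply: eq_bigr => a _.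
by rewrite (diff_component _ _ (dPhi x Ux)).
Qed.

Lemma Ck_on_derive k (U : set V) (f : V -> R) (v : V) : open U ->
  Ck_on k.+1 U f -> Ck_on k U (fun x => 'D_v f x).
Proof.
move=> oU [df cf]; apply: (Ck_on_ext oU _ (cf v)) => x; rewrite inE => Ux.
by rewrite deriveE//; exact: df.
Qed.

Lemma Ck_on_comp1 k (U : set V) (g : R -> R) (f : V -> R) : open U ->
  Ck_on k [set: R] g -> Ck_on k U f -> Ck_on k U (g \o f).
Proof.
move=> oU; elim: k g => [|k IH] g.
  by move=> cg cf x Ux; apply: continuous_comp; [exact: cf|exact: cg].
move=> [dg cg] Cf; have [df cf] := Cf; split=> [x Ux|v].
  by apply: differentiable_comp; [exact: df|exact: dg].
have := Ck_onM oU (cf v) (IH _ (cg 1) (Ck_onW Cf)).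
apply: Ck_on_ext => // x; rewrite inE => Ux.
apply/esym/(etrans (diff_comp_apply v (df x Ux) (dg (f x) I))).
have Z : 'd g (f x) ('d f x v *: (1 : R)) = 'd f x v *: 'd g (f x) 1.
  by rewrite linearZ.
by apply: etrans Z; rewrite [_ *: _]mulr1.
Qed.

Lemma derive_comp_rV n (f : 'rV[R]_n -> R) (Phi : V -> 'rV[R]_n) (x v : V) :
  differentiable f (Phi x) -> differentiable Phi x ->
  'D_v (f \o Phi) x =
  \sum_(a < n) 'D_v (fun y => Phi y 0 a) x * 'D_(delta_mx 0 a) f (Phi x).
Proof.
move=> df dPhi; rewrite deriveE; last exact: differentiable_comp.
rewrite diff_comp_apply//.
apply: (etrans (linear_rV_sum ('d f (Phi x)) ('d Phi x v))); apply: eq_bigr => a _.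
rewrite diff_component// !deriveE//.
exact: (differentiable_comp dPhi (differentiable_coord _ 0 a)).
Qed.

Lemma MVT_direction (f : V -> R) (x v : V) (h : R) : 0 < h ->
  (forall t, 0 <= t <= h -> differentiable f (x + t *: v)) ->
  exists2 t, 0 < t < h & f (x + h *: v) - f x = h * 'D_v f (x + t *: v).
Proof.
move=> h0 df; pose g t := f (x + t *: v).
have dl t : is_diff t (fun t : R => x + t *: v) (fun s : R => s *: v).
  by apply: is_diff_eq; rewrite add0r.
have dg t : 0 <= t <= h -> is_derive t 1 g ('D_v f (x + t *: v)).
  move=> ht; have dft := df t ht.
  have dgt : differentiable g t.
    by apply: differentiable_comp => //; exact: @ex_diff _ _ _ _ _ _ _ (dl t).
  apply: DeriveDef; first exact: diff_derivable.
  have dlt := @ex_diff _ _ _ _ _ _ _ (dl t).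
  rewrite deriveE// (@diff_comp_apply _ _ _ (fun t : R => x + t *: v) f)//.
  by rewrite deriveE// (@diff_val _ _ _ _ _ _ _ (dl t)) scale1r.
have [||t] := @MVT _ g (fun t => 'D_v f (x + t *: v)) 0 h h0.
- by move=> t; rewrite in_itv /= => /andP[? ?]; apply: dg; rewrite !ltW.
- apply: derivable_within_continuous => t; rewrite in_itv /= => ht.
  by apply: (@ex_derive _ _ _ _ _ _ _ (dg t ht)).
rewrite in_itv /= => t0 E; exists t => //.
by move: E; rewrite /g scale0r addr0 subr0 mulrC.
Qed.

End Comp.

(** * Symmetry of second derivatives *)

Section Schwarz.
Context {R : realType} {V : normedModType R}.

Let seconddiff (f : V -> R) (x u v : V) (h : R) : R :=
  f (x + h *: u + h *: v) - f (x + h *: u) - (f (x + h *: v) - f x).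

(** The mean value theorem is applied twice: along [u] to the increment of [f] by [h *: v], then
    along [v] to the derivative of [f] in the direction [u]. *)
Lemma second_difference (U : set V) (f : V -> R) (x u v : V) (e : R) :
  open U -> Ck_on 2 U f -> U x -> 0 < e ->
  \forall h \near 0^'+, exists2 p, ball x e p &
    seconddiff f x u v h = h * h * 'D_v (fun y => 'D_u f y) p.
Proof.
move=> oU Cf Ux e0.
have : nbhs x (U `&` ball x e).
  by apply: filterI; [exact: open_nbhs_nbhs|exact: nbhsx_ballx].
rewrite -nbhs_ballE => -[r /= r0 rU].
have N0 : 0 < `|u| + `|v| + 1 by rewrite ltr_wpDl// addr_ge0.
near=> h.
have h0 : 0 < h by near: h; exact: nbhs_right_gt.
(* This keeps the parallelogram spanned at [x] by [h *: u] and [h *: v] inside the ball of radius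
   [r]; the summand 1 makes the divisor positive even when [u] and [v] vanish. *)
have hr : h * (`|u| + `|v| + 1) < r.
  rewrite -ltr_pdivlMr//; near: h; apply: nbhs_right_lt; exact: divr_gt0.
have inU s t : 0 <= s <= h -> 0 <= t <= h ->
    (U `&` ball x e) (x + s *: u + t *: v).
  move=> /andP[s0 sh] /andP[t0 th]; apply: rU; rewrite -ball_normE /ball_ /=.
  rewrite -addrA opprD addrA subrr sub0r normrN.
  apply: le_lt_trans hr; apply: le_trans (ler_normD _ _) _.
  rewrite !normrZ !ger0_norm// !mulrDr mulr1 -addrA lerD ?ler_wpM2r//.
  by rewrite ler_wpDr ?ler_wpM2r// ltW.
have hh : 0 <= h <= h by apply/andP; split; [exact: ltW|exact: lexx].
have z0 : (0 : R) <= 0 <= h by apply/andP; split; [exact: lexx|exact: ltW].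
have [df _] := Cf.
pose g y := f (y + h *: v) - f y.
have dsh y : is_diff y (fun y : V => y + h *: v) id.
  by apply: is_diff_eq; rewrite addr0.
have dfh y : U (y + h *: v) -> differentiable (fun y => f (y + h *: v)) y.
  move=> Uy; apply: (@differentiable_comp _ _ _ _ (fun y => y + h *: v) f).
    exact: @ex_diff _ _ _ _ _ _ _ (dsh y).
  exact: df.
have dg t : 0 <= t <= h -> differentiable g (x + t *: u).
  move=> ht; apply: differentiableB; first by apply: dfh; case: (inU t h ht hh).
  by apply: df; case: (inU t 0 ht z0); rewrite scale0r addr0.
have [t /andP[t0 th] Et] := MVT_direction h0 dg.
have ht : 0 <= t <= h by rewrite !ltW.
have Eg : 'D_u g (x + t *: u) =
    'D_u f (x + t *: u + h *: v) - 'D_u f (x + t *: u).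
  have U1 : U (x + t *: u + h *: v) by case: (inU t h ht hh).
  have U2 : U (x + t *: u) by case: (inU t 0 ht z0); rewrite scale0r addr0.
  rewrite deriveE; last exact: dg.
  rewrite (@diffB _ _ _ (fun y => f (y + h *: v)) f)//; [|exact: dfh|exact: df].
  rewrite !deriveE; [|exact: df|exact: df]; congr (_ - _).
  have dshx := @ex_diff _ _ _ _ _ _ _ (dsh (x + t *: u)).
  rewrite (@diff_comp_apply _ _ _ _ (fun y => y + h *: v) f)//; last exact: df.
  by rewrite (@diff_val _ _ _ _ _ _ _ (dsh _)).
have [dDf _] := Ck_on_derive u oU Cf.
have [|s /andP[s0 sh] Es] := @MVT_direction _ _ (fun y => 'D_u f y) (x + t *: u) v h h0.
  by move=> s hs; apply: dDf; case: (inU t s ht hs).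
have hs : 0 <= s <= h by rewrite !ltW.
exists (x + t *: u + s *: v); first by case: (inU t s ht hs).
rewrite /seconddiff -[LHS]/(g (x + h *: u) - g x) Et Eg Es.
by rewrite mulrA.
Unshelve. all: by end_near. Qed.

(** The second difference is symmetric in [u] and [v], so the two mixed derivatives agree at some
    points [p] and [q] arbitrarily close to [x]; continuity does the rest. *)
Lemma Schwarz (U : set V) (f : V -> R) (x u v : V) :
  open U -> Ck_on 2 U f -> U x ->
  'D_v (fun y => 'D_u f y) x = 'D_u (fun y => 'D_v f y) x.
Proof.
move=> oU Cf Ux; apply/eqP; rewrite -subr_eq0 -normr_le0.
apply/ler_addgt0Pl => e e0; rewrite addr0.
have cD w w' : {for x, continuous (fun z => 'D_w (fun y => 'D_w' f y) z)}.
  exact: (Ck_on_derive w oU (Ck_on_derive w' oU Cf) x Ux).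
have e20 : 0 < e / 2 by rewrite divr_gt0.
have near_cD w w' : exists2 r, 0 < r & forall p, ball x r p ->
    `|'D_w (fun y => 'D_w' f y) x - 'D_w (fun y => 'D_w' f y) p| < e / 2.
  have /cvgrPdist_lt /(_ _ e20) := cD w w'.
  by rewrite -nbhs_ballE => -[r /= r0 rp]; exists r.
have [r r0 Hr] := near_cD v u; have [r' r0' Hr'] := near_cD u v.
have [h [h0 [p xp Ep] [q xq Eq]]] : exists h, [/\ 0 < h,
    exists2 p, ball x r p &
      seconddiff f x u v h = h * h * 'D_v (fun y => 'D_u f y) p &
    exists2 p, ball x r' p &
      seconddiff f x v u h = h * h * 'D_u (fun y => 'D_v f y) p].
  have H1 := second_difference u v oU Cf Ux r0.
  have H2 := second_difference v u oU Cf Ux r0'.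
  have H0 : \forall h \near 0^'+, (0 : R) < h by exact: nbhs_right_gt.
  have [h [h0 [h1 h2]]] := filter_ex (filterI H0 (filterI H1 H2)).
  by exists h; split; [exact: h0|exact: h1|exact: h2].
have hh0 : h * h != 0 by rewrite mulf_neq0 ?gt_eqF.
have Epq : 'D_v (fun y => 'D_u f y) p = 'D_u (fun y => 'D_v f y) q.
  apply: (mulfI hh0); apply: (etrans (esym Ep)); apply: etrans Eq.
  by rewrite /seconddiff (addrAC x (h *: v)); ring.
have triangle (a b c : R) : `|a - c| < e / 2 -> `|b - c| < e / 2 -> `|a - b| <= e.
  move=> /ltW Ha /ltW Hb; have -> : a - b = (a - c) - (b - c) by ring.
  by apply: le_trans (ler_normB _ _) _; rewrite [leRHS]splitr lerD.
have {Hr xp} := Hr _ xp; rewrite Epq => H1; have H2 := Hr' _ xq.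
exact: triangle H1 H2.
Qed.

End Schwarz.

(** Only [x] is confined to [K]: the point [x + y] may leave it, as happens with lattice shifts. *)
Lemma uniform_continuity_compact (R : realType) (V : normedModType R)
    (K : set V) (f : V -> R) (e : R) : compact K ->
  (forall x, K x -> {for x, continuous f}) -> 0 < e ->
  exists2 r, 0 < r & forall x y, K x -> `|y| < r -> `|f (x + y) - f x| < e.
Proof.
move=> /compact_near_coveringP cK cf e0.
have : \forall y \near (0 : V), K `<=` (fun x => `|f (x + y) - f x| < e).
  apply: cK.
  move=> x Kx.
  have e20 : 0 < e / 2 by rewrite divr_gt0.
  have /cvgrPdist_lt /(_ _ e20) := cf x Kx.
  rewrite -nbhs_ballE => -[r /= r0 rf].
  have r20 : 0 < r / 2 by rewrite divr_gt0.
  exists (ball x (r / 2), ball (0 : V) (r / 2)) => /=.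
    by split; exact: nbhsx_ballx.
  move=> [z y] /= [xz yr].
  have H1 := rf z (le_ball _ xz); have H2 : `|f x - f (z + y)| < e / 2.
    apply: rf; rewrite [r]splitr; apply: ball_triangle xz _.
    move: yr; rewrite -!ball_normE /ball_ /= sub0r normrN.
    by rewrite opprD addrA subrr sub0r normrN.
  have -> : f (z + y) - f z = (f x - f z) - (f x - f (z + y)) by ring.
  apply: le_lt_trans (ler_normB _ _) _; rewrite [ltRHS]splitr ltrD//.
  by apply: H1; rewrite ler_pdivrMr// ler_peMr ?ltW// ltr1n.
move=> /nbhs_ballP[r /= r0 H]; exists r => // x y Kx yr; apply: H => //.
by rewrite -ball_normE /ball_ /= sub0r normrN.
Qed.

(** * Lattice sums *)

Section LatticeSum.
Context {R : realType} {d : nat}.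
Implicit Types (f g : 'rV[R]_d -> R) (x : 'rV[R]_d).

(* The lattice (1/(n+1)) Z^d in the box [-(n+1), n+1[^d.  The group structure
   of its index set turns shifts and reflections into bijections, at the cost
   of wrap-around points, where compactly supported functions vanish. *)
Definition grid_index (n : nat) : finZmodType := 'I_((2 * n.+1 ^ 2).-1.+1).

Definition grid_point (n : nat) (k : 'rV[grid_index n]_d) : 'rV[R]_d :=
  \row_a ((nat_of_ord (k 0 a))%:R / n.+1%:R - n.+1%:R).

Definition lattice_sum (n : nat) f : R :=
  n.+1%:R^-1 ^+ d * \sum_(k : 'rV[grid_index n]_d) f (grid_point k).

Definition supported_in (K : R) f := forall x, K <= `|x| -> f x = 0.

Lemma lattice_sumD n f g :
  lattice_sum n (fun x => f x + g x) = lattice_sum n f + lattice_sum n g.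
Proof. by rewrite /lattice_sum big_split mulrDr. Qed.

Lemma lattice_sumZ n c f : lattice_sum n (fun x => c * f x) = c * lattice_sum n f.
Proof. by rewrite /lattice_sum -mulr_sumr mulrCA. Qed.

Lemma lattice_sumB n f g :
  lattice_sum n (fun x => f x - g x) = lattice_sum n f - lattice_sum n g.
Proof. by rewrite /lattice_sum sumrB mulrBr. Qed.

Lemma lattice_sum_sum n (I : Type) (r : seq I) (P : pred I) (F : I -> 'rV[R]_d -> R) :
  lattice_sum n (fun x => \sum_(i <- r | P i) F i x) =
  \sum_(i <- r | P i) lattice_sum n (F i).
Proof. by rewrite /lattice_sum exchange_big mulr_sumr. Qed.

Lemma ler_lattice_sum n f g : (forall x, f x <= g x) ->
  lattice_sum n f <= lattice_sum n g.
Proof.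
move=> fg; rewrite ler_wpM2l// ?exprn_ge0// ?invr_ge0//.
by apply: ler_sum => k _; exact: fg.
Qed.

Lemma ler_norm_lattice_sum n f :
  `|lattice_sum n f| <= lattice_sum n (fun x => `|f x|).
Proof.
rewrite /lattice_sum normrM ger0_norm ?exprn_ge0 ?invr_ge0//.
by rewrite ler_wpM2l ?exprn_ge0 ?invr_ge0// ler_norm_sum.
Qed.

Lemma lattice_sum_ge0 n f : (forall x, 0 <= f x) -> 0 <= lattice_sum n f.
Proof. by move=> f0; rewrite mulr_ge0 ?exprn_ge0 ?invr_ge0// sumr_ge0. Qed.

Lemma sum_rV_prod (T : finType) (F : 'I_d -> T -> R) :
  \sum_(k : 'rV[T]_d) \prod_a F a (k 0 a) = \prod_a \sum_j F a j.
Proof.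
rewrite bigA_distr_bigA (reindex (fun h : {ffun 'I_d -> T} => \row_a h a)).
  by apply: eq_bigr => h _; apply: eq_bigr => a _; rewrite mxE.
exists (fun k : 'rV[T]_d => [ffun a => k 0 a]) => [h|k] _.
  by apply/ffunP => a; rewrite ffunE mxE.
by apply/rowP => a; rewrite mxE ffunE.
Qed.

(** The indicator of an open cube, a ball of the sup norm, written as a product so that its lattice
    sum factors into one-dimensional counts. *)
Definition box (c : 'rV[R]_d) (r : R) x : R :=
  \prod_(a < d) (`|x 0 a - c 0 a| < r)%R%:R.

Lemma lattice_sum_box n c r : lattice_sum n (box c r) =
  \prod_(a < d) (n.+1%:R^-1 * \sum_(j : grid_index n)
    (`|(nat_of_ord j)%:R / n.+1%:R - n.+1%:R - c 0 a| < r)%R%:R).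
Proof.
rewrite /lattice_sum /box big_split /= prodr_const card_ord.
rewrite -(sum_rV_prod (fun a (j : grid_index n) =>
  (`|(nat_of_ord j)%:R / n.+1%:R - n.+1%:R - c 0 a| < r)%R%:R)).
by congr (_ * _); apply: eq_bigr => k _; apply: eq_bigr => a _; rewrite mxE.
Qed.

Lemma sum_pred_card p (P : pred 'I_p) : \sum_(j < p) (P j)%:R = #|P|%:R :> R.
Proof.
rewrite -sum1_card natr_sum [RHS]big_mkcond; apply: eq_bigr => j _.
by rewrite unfold_in; case: (P j).
Qed.

Lemma count_le p (P : pred 'I_p) (B : R) : 0 <= B ->
  (forall i j, P i -> P j -> j%:R - i%:R <= B) ->
  \sum_(j < p) (P j)%:R <= B + 1.
Proof.
move=> B0 PB; rewrite sum_pred_card.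
have [->|] := eqVneq #|P| 0%N; first by rewrite addr_ge0.
rewrite -lt0n => /card_gt0P[i Pi].
case: (arg_minnP (fun i : 'I_p => val i) Pi) => i0 Pi0 min_i0.
case: (arg_maxnP (fun i : 'I_p => val i) Pi) => i1 Pi1 max_i1.
apply: (@le_trans _ _ (i1 - i0).+1%:R); last first.
  by rewrite -natr1 lerD2r natrB ?PB//; exact: max_i1.
rewrite ler_nat cardE -(size_map (fun i : 'I_p => i - i0)%N).
rewrite -(size_iota 0 (i1 - i0).+1); apply: uniq_leq_size.
  rewrite map_inj_in_uniq ?enum_uniq// => j k; rewrite !mem_enum => Pj Pk E.
  by apply/val_inj => /=; rewrite -(subnK (min_i0 j Pj)) E (subnK (min_i0 k Pk)).
move=> _ /mapP[j + ->]; rewrite mem_enum => Pj.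
by rewrite mem_iota add0n ltnS leq0n leq_sub2r//; exact: max_i1.
Qed.

Lemma count_ge p (P : pred 'I_p) (j0 q : nat) (B : R) : B <= q%:R ->
  (forall i, (i < q)%N -> exists2 j, P j & val j = (j0 + i)%N) ->
  B <= \sum_(j < p) (P j)%:R.
Proof.
move=> Bq HP; apply: (le_trans Bq).
rewrite sum_pred_card ler_nat cardE.
rewrite -(size_map (fun i : 'I_p => val i)) -(size_iota j0 q).
apply: uniq_leq_size; first exact: iota_uniq.
move=> i; rewrite mem_iota => /andP[ji iq].
have [|j Pj jE] := HP (i - j0)%N; first by rewrite ltn_subLR.
by apply/mapP; exists j; rewrite ?mem_enum// jE subnKC.
Qed.

(** An open interval of length [2 * r] contains at most [2 * r * n.+1 + 1] points of mesh
    [1 / n.+1]. The resulting bound is uniform in [n]. *)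
Lemma lattice_sum_box_le n c (r : R) : 0 <= r ->
  lattice_sum n (box c r) <= (2 * r + 1) ^+ d.
Proof.
move=> r0; rewrite lattice_sum_box.
have -> : (2 * r + 1) ^+ d = \prod_(a < d) (2 * r + 1).
  by rewrite prodr_const card_ord.
apply: ler_prod => a _.
have N0 : 0 < n.+1%:R :> R by [].
rewrite mulr_ge0 ?invr_ge0 ?sumr_ge0//= mulrC ler_pdivrMr//.
apply: (@le_trans _ _ (2 * r * n.+1%:R + 1)); last first.
  by rewrite [leRHS]mulrDl lerD2l mul1r ler1n.
apply: count_le => [|i j]; first by rewrite !mulr_ge0.
rewrite !ltr_norml => /andP[ia _] /andP[_ ja].
have H (u v t w : R) : - r < u - t - w -> v - t - w < r -> v - u <= 2 * r by lra.
by rewrite -ler_pdivrMr// mulrBl; exact: H ia ja.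
Qed.

Lemma lattice_sum_box_ge c (r : R) : 0 < r ->
  \forall n \near \oo, (r / 2) ^+ d <= lattice_sum n (box c r).
Proof.
move=> r0; pose B := \sum_(a < d) `|c 0 a|.
near=> n.
have N0 : 0 < n.+1%:R :> R by [].
have Nr : 2 <= r * n.+1%:R.
  rewrite mulrC -ler_pdivrMr// -[n.+1%:R]natr1 ler_wpDr//.
  by near: n; exact: nbhs_infty_ger.
have NB : B + r + 1 <= n.+1%:R.
  rewrite -[n.+1%:R]natr1 lerD2r; near: n; exact: nbhs_infty_ger.
rewrite lattice_sum_box.
have -> : (r / 2) ^+ d = \prod_(a < d) (r / 2).
  by rewrite prodr_const card_ord.
apply: ler_prod => a _; rewrite divr_ge0 ?(ltW r0)//= ler_pdivlMl//.
have cB : `|c 0 a| <= B by rewrite /B (bigD1 a)//= lerDl sumr_ge0.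
have /andP[cB1 cB2] : - B <= c 0 a <= B by rewrite -ler_norml.
set N : R := n.+1%:R in N0 Nr NB *.
(* [j0] is the last index whose coordinate does not exceed [c 0 a], and the [q] consecutive indices
   from [j0] on stay within [r] of it; [q] is at least half of [r * N] because [r * N] is at least
   2. *)
have h0 : 0 <= N * (N + c 0 a) by rewrite mulr_ge0 ?ltW//; lra.
have /andP[t1 t2] := truncn_itv h0; set j0 := Num.truncn _ in t1 t2.
have q0 : 0 <= r * N by lra.
have /andP[t3 t4] := truncn_itv q0; set q := Num.truncn _ in t3 t4.
rewrite -[q.+1%:R]natr1 in t4; rewrite -[j0.+1%:R]natr1 in t2.
have q1 : N * (r / 2) <= q%:R.
  by rewrite mulrA (mulrC N); lra.
apply: (@count_ge _ _ j0 q) => // i iq.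
have iq' : i%:R + 1 <= r * N.
  by apply: le_trans t3; rewrite natr1 ler_nat.
have jn : (j0 + i < (2 * n.+1 ^ 2).-1.+1)%N.
  rewrite prednK ?muln_gt0 ?expn_gt0// -(ltr_nat R) natrD natrM natrX -/N.
  have : (c 0 a + r) * N < N * N by rewrite ltr_pM2r//; lra.
  by rewrite expr2; lra.
exists (Ordinal jn) => //=; rewrite natrD.
have E : (j0%:R + i%:R) / N - N - c 0 a = (j0%:R + i%:R - N * (N + c 0 a)) / N.
  by field; rewrite gt_eqF.
rewrite E normrM normfV (gtr0_norm N0) ltr_pdivrMr// ltr_norml.
have i0 := ler0n R i; apply/andP; split; lra.
Unshelve. all: by end_near. Qed.

Lemma box_ge0 c r x : 0 <= box c r x. Proof. exact: prodr_ge0. Qed.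

Lemma coord_le_norm x a : `|x 0 a| <= `|x|.
Proof.
rewrite [leRHS](mx_normrE x); exact: (le_bigmax _ (fun ij => `|x ij.1 ij.2|) (0, a)).
Qed.

Lemma norm_rV_lt x (r : R) : 0 < r -> (forall a, `|x 0 a| < r) -> `|x| < r.
Proof.
move=> r0 xr; rewrite [ltLHS](mx_normrE x); apply/bigmax_ltP; split => //.
by move=> [i a] _ /=; rewrite ord1.
Qed.

Lemma boxT c r x : `|x - c| < r -> box c r x = 1.
Proof.
move=> xr; rewrite /box big1// => a _.
by have := coord_le_norm (x - c) a; rewrite !mxE => /le_lt_trans -> .
Qed.

Lemma boxF c r x : 0 < r -> ~~ (`|x - c| < r) -> box c r x = 0.
Proof.
move=> r0 xr; apply/eqP; apply: contraR xr => /prodf_neq0 xr.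
apply: norm_rV_lt => // a; have := xr a isT; rewrite !mxE.
by case: (_ < r)%R => //; rewrite eqxx.
Qed.

Lemma lattice_sum_bound n f (K e : R) : 0 < K -> 0 <= e ->
  (forall x, `|f x| <= e) -> supported_in K f ->
  `|lattice_sum n f| <= e * (2 * K + 1) ^+ d.
Proof.
move=> K0 e0 fe fK; apply: le_trans (ler_norm_lattice_sum _ _) _.
apply: (@le_trans _ _ (lattice_sum n (fun x => e * box 0 K x))); last first.
  by rewrite lattice_sumZ ler_wpM2l// lattice_sum_box_le// ltW.
apply: ler_lattice_sum => x.
have [xK|/fK ->] := ltP `|x| K; last by rewrite normr0 mulr_ge0// box_ge0.
by rewrite boxT ?subr0// mulr1.
Qed.

(** If [f x] were positive, [f] would exceed half of it on a cube around [x], whose lattice sums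
    stay above a fixed positive number. *)
Lemma lattice_sum_cvg0_eq0 f x : (forall y, 0 <= f y) ->
  {for x, continuous f} -> lattice_sum ^~ f @ \oo --> (0 : R) -> f x = 0.
Proof.
move=> f0 cf Ef; apply/eqP; rewrite eq_le f0 andbT leNgt; apply/negP => fx.
have fx2 : 0 < f x / 2 by rewrite divr_gt0.
have /cvgrPdist_lt /(_ _ fx2) /nbhs_ballP[r /= r0 rf] := cf.
have lef y : f x / 2 * box x r y <= f y.
  have [xy|xy] := boolP (`|y - x| < r); last by rewrite boxF// mulr0.
  rewrite boxT// mulr1.
  have : ball x r y by rewrite -ball_normE /ball_ /= distrC.
  by move=> /rf; rewrite ltr_norml => /andP[]; lra.
pose c := f x / 2 * (r / 2) ^+ d.
have c0 : 0 < c by rewrite mulr_gt0// exprn_gt0// divr_gt0.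
have /cvgrPdist_lt /(_ _ c0) Efc := Ef.
have [n [En cn]] := filter_ex (filterI Efc (lattice_sum_box_ge x r0)).
move: En; apply/negP; rewrite -leNgt sub0r normrN.
apply: le_trans (ler_norm _).
apply: le_trans (ler_lattice_sum n lef).
by rewrite lattice_sumZ ler_wpM2l// ltW.
Qed.

(** A shift by one mesh is the addition of a unit vector in the cyclic index group, hence a
    bijection of the indices, except for the wrap-around on the faces of the grid. *)
Lemma lattice_sum_shift n f (K : R) (a : 'I_d) : supported_in K f ->
  K <= n.+1%:R ->
  lattice_sum n (fun x => f (x + n.+1%:R^-1 *: delta_mx 0 a)) = lattice_sum n f.
Proof.
move=> fK Kn; rewrite /lattice_sum; congr (_ * _).
pose one : grid_index n := inord 1.
pose e : 'rV[grid_index n]_d := \row_b (if b == a then one else 0).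
rewrite [RHS](reindex_inj (addIr e)); apply: eq_bigr => k _.
have N0 : n.+1%:R != 0 :> R by rewrite pnatr_eq0.
have oneE : nat_of_ord one = 1%N.
  have n2 : (0 < n.+1 ^ 2)%N by rewrite expn_gt0.
  by rewrite inordK// prednK ?muln_gt0//; lia.
have S0 : (2 * n.+1 ^ 2).-1.+1 = (2 * n.+1 ^ 2)%N.
  by rewrite prednK// muln_gt0 expn_gt0.
have addE (i j : grid_index n) : nat_of_ord (i + j) = ((i + j) %% (2 * n.+1 ^ 2))%N.
  by rewrite -[X in (_ %% X)%N]S0.
have [klt|kge] := ltnP (k 0 a).+1 (2 * n.+1 ^ 2)%N.
  congr f; apply/rowP => b; rewrite !mxE eqxx addE.
  have [->|_] := eqVneq b a.
    by rewrite oneE addn1 modn_small// mulr1 -[(k 0 a).+1%:R]natr1; field.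
  by rewrite andbF mulr0 !addr0 addn0 modn_small// -[X in (_ < X)%N]S0 ltn_ord.
(* The last index: its cyclic successor 0 stands for the coordinate [- n.+1], whereas the shifted
   point has coordinate [n.+1]. Both points lie outside the support of [f]. *)
have kE : (k 0 a).+1 = (2 * n.+1 ^ 2)%N.
  by apply/eqP; rewrite eqn_leq kge -[X in (_ <= X)%N]S0 ltn_ord.
rewrite !fK//.
- apply: (le_trans Kn); apply: le_trans (coord_le_norm _ a).
  by rewrite !mxE eqxx addE oneE addn1 kE modnn mul0r sub0r normrN ger0_norm.
- apply: (le_trans Kn); apply: le_trans (coord_le_norm _ a).
  rewrite !mxE !eqxx mulr1.
  have -> : (k 0 a)%:R / n.+1%:R - n.+1%:R + n.+1%:R^-1 =
            (k 0 a).+1%:R / n.+1%:R - n.+1%:R :> R.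
    by rewrite -[(k 0 a).+1%:R]natr1; field.
  rewrite kE natrM natrX.
  have -> : 2 * n.+1%:R ^+ 2 / n.+1%:R - n.+1%:R = n.+1%:R :> R by field.
  by rewrite ger0_norm.
Qed.

End LatticeSum.

Lemma closed_ball_compact (R : realType) (d : nat) (K : R) :
  compact [set x : 'rV[R]_d | `|x| <= K].
Proof.
apply: bounded_closed_compact.
  exists K; split; first exact: num_real.
  by move=> r /ltW Kr x /= xK; exact: le_trans xK Kr.
rewrite (_ : [set _ | _] = (@Num.norm _ 'rV[R]_d) @^-1` [set y | y <= K])//.
apply: closed_comp; last exact: closed_le.
by move=> x _; exact: norm_continuous.
Qed.

Section UniformDerive.
Context {R : realType} {d : nat}.
Let V : normedModType R := (R * 'rV[R]_d)%type.

Definition supported_path (K : R) (G : V -> R) :=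
  forall s x, 0 <= s <= 1 -> K <= `|x| -> G (s, x) = 0.

Lemma derive_slice (G : V -> R) (s : R) (x v : 'rV[R]_d) :
  'D_((0, v) : V) G (s, x) = 'D_v (fun y => G (s, y)) x.
Proof.
rewrite /derive; apply: (congr1 (fun F : R -> R => lim (F @ 0^'))); apply/funext => h.
apply: (congr1 (fun z : V => h^-1 *: (G z - G (s, x)))).
by congr (_, _); rewrite /= scaler0 add0r.
Qed.

(** The difference quotient whose step is the mesh has lattice sum 0 by shift invariance, and it is
    uniformly close to the derivative by the mean value theorem and uniform continuity. Uniformity
    in [s] is what allows an unknown intermediate time in the homotopy argument. *)
Lemma lattice_sum_derive_uniform (G : V -> R) (a : 'I_d) (K e : R) :
  0 < K -> 0 < e -> Ck_on 1 setT G -> supported_path K G ->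
  \forall n \near \oo, forall s, 0 <= s <= 1 ->
    `|lattice_sum n (fun x => 'D_((0, delta_mx 0 a) : V) G (s, x))| <= e.
Proof.
move=> K0 e0 CG GK.
pose w : V := (0, delta_mx 0 a).
pose DG z := 'D_w G z.
have cDG z : {for z, continuous DG}.
  exact: (Ck_on_derive (k := 0) w openT CG z I).
have dG z : differentiable G z by exact: (CG.1 z I).
pose c : R := (2 * (K + 1) + 1) ^+ d.
have c0 : 0 < c by rewrite exprn_gt0//; lra.
pose Q : set V := `[0, 1] `*` [set x | `|x| <= K + 1].
have cQ : compact Q.
  by apply: compact_setX; [exact: segment_compact|exact: closed_ball_compact].
have [r r0 rDG] :=
  uniform_continuity_compact cQ (fun z _ => cDG z) (divr_gt0 e0 c0).
pose e_ : 'rV[R]_d := delta_mx 0 a.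
near=> n => s s01.
have N0 : 0 < n.+1%:R :> R by [].
have KN : K <= n.+1%:R.
  by rewrite -[n.+1%:R]natr1 ler_wpDr//; near: n; exact: nbhs_infty_ger.
have wN : n.+1%:R^-1 * `|w| < r.
  rewrite mulrC ltr_pdivrMr// mulrC -ltr_pdivrMr// -[n.+1%:R]natr1.
  rewrite ltr_wpDr//; near: n; exact: nbhs_infty_gtr.
have eN : n.+1%:R^-1 * `|e_| <= 1.
  rewrite mulrC ler_pdivrMr// mul1r -[n.+1%:R]natr1.
  rewrite ler_wpDr//; near: n; exact: nbhs_infty_ger.
pose g x := G (s, x).
have gK : supported_in K g by move=> x; exact: GK.
pose h x := DG (s, x) - n.+1%:R * (g (x + n.+1%:R^-1 *: e_) - g x).
have -> : lattice_sum n (fun x => DG (s, x)) = lattice_sum n h.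
  rewrite /h lattice_sumB lattice_sumZ lattice_sumB (lattice_sum_shift a gK KN).
  by rewrite subrr mulr0 subr0.
have -> : e = e / c * (2 * (K + 1) + 1) ^+ d by rewrite divfK// gt_eqF.
have hE x : exists2 t, 0 < t < n.+1%:R^-1 & h x = DG (s, x) - DG ((s, x) + t *: w).
  have [||t t01 Et] := @MVT_direction _ _ G (s, x) w n.+1%:R^-1.
  - by rewrite invr_gt0.
  - by move=> t _; exact: dG.
  exists t => //; rewrite /h; congr (_ - _).
  have -> : g (x + n.+1%:R^-1 *: e_) = G ((s, x) + n.+1%:R^-1 *: w).
    by rewrite /g; congr (G (_, _)); rewrite /= scaler0 addr0.
  by rewrite Et mulrA divff ?mul1r// gt_eqF.
(* The shift has norm at most 1 by [eN], whence the margin of 1 in the radius. *)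
have hK : supported_in (K + 1) h.
  move=> x Kx.
  have Kxn : K <= `|x + n.+1%:R^-1 *: e_|.
    have H := lerB_normD x (n.+1%:R^-1 *: e_).
    rewrite normrZ gtr0_norm ?invr_gt0// in H.
    by apply: le_trans H; rewrite lerBrDr; apply: le_trans Kx; rewrite lerD2l.
  rewrite /h !gK//; last by lra.
  rewrite subrr mulr0 subr0 /DG derive_slice.
  have gx0 : \near x, (cst 0 : 'rV[R]_d -> R) x = G (s, x).
    have KxK : K < `|x| by lra.
    have : \forall y \near x, K < `|y|.
      by apply: (@cvgr_gt _ _ (nbhs x) _ (fun y => `|y|) `|x|) => //; exact: norm_continuous.
    by apply: filterS => y /ltW Ky; rewrite GK.
  by rewrite -(near_eq_derive _ gx0) derive_cst.
apply: lattice_sum_bound => //; [lra|by rewrite divr_ge0 ?ltW|] => x.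
have [xK|Kx] := leP `|x| (K + 1); last by rewrite hK ?normr0 ?divr_ge0 ?ltW.
have [t /andP[t0 tN] ->] := hE x.
rewrite distrC; apply/ltW/rDG.
  by split => //=; rewrite in_itv.
rewrite normrZ gtr0_norm//; apply: le_lt_trans wN.
by rewrite ler_wpM2r// ltW.
Unshelve. all: by end_near. Qed.

End UniformDerive.

(** * Change of variables *)

(** Multiplication by the transposition reverses the sign and preserves [H], so the sum equals its
    opposite. *)
Lemma sign_sum_swap (R : numDomainType) (n : nat) (i j : 'I_n) (H : 'S_n -> R) :
  i != j -> (forall s, H (tperm i j * s)%g = H s) ->
  \sum_(s : 'S_n) (-1) ^+ s * H s = 0.
Proof.
move=> ij HE; set S := \sum_(s : 'S_n) _.
have SN : S = - S.
  rewrite {1}/S (reindex_inj (mulgI (tperm i j))) /= -sumrN.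
  apply: eq_bigr => s _; rewrite HE odd_permM odd_tperm ij signr_addb.
  by rewrite expr1 mulN1r mulNr.
by apply/eqP; rewrite -[_ == _](mulrn_eq0 S 2) mulr2n {1}SN addNr.
Qed.

Section Calculus.
Context {R : realType} {V : normedModType R}.

Lemma is_derive_prod (I : eqType) (r : seq I) (f : I -> V -> R) (x v : V) :
  uniq r -> (forall i, derivable (f i) x v) ->
  is_derive x v (fun y => \prod_(i <- r) f i y)
    (\sum_(i <- r) 'D_v (f i) x * \prod_(j <- r | j != i) f j x).
Proof.
move=> + df; elim: r => [_|i r IH /= /andP[ir ur]].
  rewrite big_nil; under eq_fun do rewrite big_nil.
  exact: is_derive_cst.
have {}IH := IH ur; under eq_fun do rewrite big_cons.
have dfi := derivableP (df i).
apply: is_derive_eq; rewrite !big_cons eqxx addrC; congr (_ + _).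
  rewrite /= mulrC; congr (_ * _); rewrite [RHS]big_seq_cond [LHS]big_seq.
  by apply: eq_bigl => j; case jr: (j \in r) => //=; apply/esym; apply: contraNneq ir => <-.
rewrite /GRing.scale /= big_distrr /=; apply: eq_big_seq => j jr.
rewrite big_cons; have -> : i != j by apply: contraNneq ir => ->.
by rewrite mulrCA.
Qed.

Lemma is_derive_bigsum (I : Type) (r : seq I) (f : I -> V -> R) (df : I -> R)
    (x v : V) : (forall i, is_derive x v (f i) (df i)) ->
  is_derive x v (fun y => \sum_(i <- r) f i y) (\sum_(i <- r) df i).
Proof.
move=> fdf; elim: r => [|i r IH].
  rewrite big_nil; under eq_fun do rewrite big_nil.
  exact: is_derive_cst.
rewrite big_cons; under eq_fun do rewrite big_cons.
exact: is_deriveD.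
Qed.

End Calculus.

Section Piola.
Context {R : realType} {V : normedModType R} {d : nat}.
Variables (w : 'I_d.+1 -> V) (F : 'I_d.+1 -> V -> R).
Hypothesis CF : forall i, Ck_on 2 setT (F i).

(* Only the rows other than [ord0] matter: all the cofactors below are taken
   along the row [ord0]. *)
Definition gradient_mx (z : V) : 'M[R]_d.+1 := \matrix_(i, a) 'D_(w a) (F i) z.

Let CDF (a i : 'I_d.+1) : Ck_on 1 setT (fun z => 'D_(w a) (F i) z).
Proof. exact: (Ck_on_derive (w a) openT (CF i)). Qed.

Lemma Ck_on_gradient_cofactor (a : 'I_d.+1) :
  Ck_on 1 setT (fun z => cofactor (gradient_mx z) ord0 a).
Proof.
under eq_fun do rewrite expand_cofactor.
apply: Ck_on_sum => [|s _]; first exact: openT.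
apply: Ck_onM; [exact: openT|exact: Ck_on_cst|].
apply: Ck_on_prod => [|i _]; first exact: openT.
by under eq_fun do rewrite mxE; exact: CDF.
Qed.

(** Piola's identity. Once the cofactors are expanded over permutations, each term contains one
    second derivative of some [F k], in the directions [s ord0] and [s k]; it is symmetric in them,
    and exchanging these two values of [s] cancels the terms in pairs. *)
Lemma divergence_cofactor (z : V) :
  \sum_a 'D_(w a) (fun z => cofactor (gradient_mx z) ord0 a) z = 0.
Proof.
pose r := [seq k : 'I_d.+1 <- index_enum 'I_d.+1 | ord0 != k].
have ur : uniq r by rewrite filter_uniq// index_enum_uniq.
pose D2 (s : 'S_d.+1) k := 'D_(w (s ord0)) (fun z => 'D_(w (s k)) (F k) z) z *
  \prod_(j <- r | j != k) 'D_(w (s j)) (F j) z.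
have E a : 'D_(w a) (fun z => cofactor (gradient_mx z) ord0 a) z =
    \sum_(s : 'S_d.+1 | s ord0 == a) (-1) ^+ s * \sum_(k <- r) D2 s k.
  have -> : (fun z => cofactor (gradient_mx z) ord0 a) =
      (fun z => \sum_(s <- [seq s : 'S_d.+1 <- index_enum _ | s ord0 == a])
        (-1) ^+ s * \prod_(k <- r) 'D_(w (s k)) (F k) z).
    apply/funext => y; rewrite expand_cofactor big_filter.
    apply: eq_bigr => s _; congr (_ * _); rewrite big_filter.
    by apply: eq_bigr => k _; rewrite mxE.
  pose D2' (s : 'S_d.+1) k := 'D_(w a) (fun z => 'D_(w (s k)) (F k) z) z *
    \prod_(j <- r | j != k) 'D_(w (s j)) (F j) z.
  rewrite (@derive_val _ _ _ _ _ _ _ (is_derive_bigsum _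
    (df := fun s : 'S_d.+1 => (-1) ^+ s * \sum_(k <- r) D2' s k) _)).
    by rewrite big_filter; apply: eq_bigr => s /eqP sa; rewrite /D2 sa.
  move=> s; apply: is_deriveZ; apply: is_derive_prod => // k.
  by apply/diff_derivable/(CDF (s k) k).1.
under eq_bigr do rewrite E.
rewrite (exchange_big_dep xpredT)//=.
transitivity (\sum_(s : 'S_d.+1) \sum_(k <- r) (-1) ^+ s * D2 s k).
  by apply: eq_bigr => s _; rewrite (big_pred1 (s ord0)) ?mulr_sumr.
rewrite exchange_big big_seq big1// => k; rewrite mem_filter => /andP[k0 _].
have swap (T Q : 'I_d.+1 -> 'I_d.+1 -> R) : (forall a b, T a b = T b a) ->
    \sum_(s : 'S_d.+1) (-1) ^+ s *
      (T (s ord0) (s k) * \prod_(j <- r | j != k) Q (s j) j) = 0.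
  move=> TC; apply: (sign_sum_swap k0) => s.
  rewrite !permM tpermL tpermR TC; congr (_ * _).
  rewrite big_seq_cond [RHS]big_seq_cond; apply: eq_bigr => j.
  rewrite mem_filter => /andP[/andP[j0 _] jk].
  by rewrite permM tpermD// eq_sym.
apply: (swap (fun a b => 'D_(w a) (fun z => 'D_(w b) (F k) z) z)
             (fun a j => 'D_(w a) (F j) z)) => a b.
exact: (Schwarz _ _ openT (CF k) I).
Qed.

(** An off-diagonal entry of the product of a matrix with its adjugate. *)
Lemma sum_gradient_cofactor (z : V) (i : 'I_d.+1) : ord0 != i ->
  \sum_a 'D_(w a) (F i) z * cofactor (gradient_mx z) ord0 a = 0.
Proof.
move=> i0; have := congr1 (fun A : 'M[R]_d.+1 => A i ord0) (mul_mx_adj (gradient_mx z)).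
rewrite !mxE eq_sym (negPf i0) mulr0n => E; rewrite -[RHS]E.
by apply: eq_bigr => a _; rewrite !mxE.
Qed.

End Piola.

Section Equivalence.
Context {R : realType} {d : nat}.
Implicit Types f g h : 'rV[R]_d -> R.

(* Stands for the equality of the integrals of f and g. *)
Definition sum_equiv f g :=
  (fun n => lattice_sum n f - lattice_sum n g) @ \oo --> (0 : R).

Lemma sum_equiv_refl f : sum_equiv f f.
Proof.
rewrite /sum_equiv; under eq_fun do rewrite subrr; exact: cvg_cst.
Qed.

Lemma sum_equiv_trans f g h : sum_equiv f g -> sum_equiv g h -> sum_equiv f h.
Proof.
move=> fg /(cvgD fg); rewrite addr0; apply: cvg_trans; apply: near_eq_cvg.
by apply: nearW => n; rewrite addrA subrK.
Qed.

(** The layout is that of ['J], for matrices acting on row vectors from the right. Being written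
    with partial derivatives of the components, it can be compared entry by entry with
    [gradient_mx]. *)
Definition partial_mx (phi : 'rV[R]_d -> 'rV[R]_d) (x : 'rV[R]_d) : 'M[R]_d :=
  \matrix_(i, j) 'D_(delta_mx 0 i) (fun y => phi y 0 j) x.

Lemma jacobianE (phi : 'rV[R]_d -> 'rV[R]_d) x :
  differentiable phi x -> 'J phi x = partial_mx phi x.
Proof.
move=> dphi; apply/matrixP => i j; rewrite !mxE -[LHS]/(('d phi x 'e_i) 0 j).
have dc : differentiable (fun y => phi y 0 j) x.
  exact: (differentiable_comp dphi (differentiable_coord _ 0 j)).
by rewrite (deriveE _ dc) (diff_component _ _ dphi).
Qed.

End Equivalence.

Section Homotopy.
Context {R : realType} {d : nat}.
Let V : normedModType R := (R * 'rV[R]_d)%type.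

Lemma is_derive_time (G : V -> R) (s : R) (x : 'rV[R]_d) :
  differentiable G (s, x) ->
  is_derive s (1 : R) (fun t : R => G (t, x)) ('D_((1, 0) : V) G (s, x)).
Proof.
move=> dG; have E : (fun h : R => h^-1 *: (G (h *: ((1, 0) : V) + (s, x)) - G (s, x))) =
    (fun h : R => h^-1 *: (G (h *: 1 + s, x) - G (s, x))).
  apply/funext => h; apply: (congr1 (fun z : V => h^-1 *: (G z - G (s, x)))).
  by congr (_, _); rewrite /= scaler0 add0r.
apply: DeriveDef; last by rewrite /derive E.
by have := @diff_derivable _ _ _ G (s, x) ((1, 0) : V) dG; rewrite /derivable E.
Qed.

Variables (Phi : V -> 'rV[R]_d) (f : 'rV[R]_d -> R) (K : R).
Hypothesis K0 : 0 < K.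
Hypothesis CPhi : forall a, Ck_on 2 setT (fun z => Phi z 0 a).
Hypothesis Cf : Ck_on 1 setT f.
Hypothesis fK : supported_path K (f \o Phi).

(* The index [ord0] is the time direction and [lift ord0 j] the j-th space
   direction; the divergence of g over all of them vanishes. *)
Let w (a : 'I_d.+1) : V :=
  if unlift ord0 a is Some j then (0, delta_mx 0 j) else (1, 0).
Let w0 : w ord0 = (1, 0). Proof. by rewrite /w unlift_none. Qed.
Let wl j : w (lift ord0 j) = (0, delta_mx 0 j). Proof. by rewrite /w liftK. Qed.
Let F (i : 'I_d.+1) (z : V) : R :=
  if unlift ord0 i is Some j then Phi z 0 j else 0.
Let cof (a : 'I_d.+1) (z : V) : R := cofactor (gradient_mx w F z) ord0 a.
Let g (a : 'I_d.+1) (z : V) : R := f (Phi z) * cof a z.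

Let CF i : Ck_on 2 setT (F i).
Proof.
rewrite /F; case: (unlift ord0 i) => [j|]; first exact: CPhi.
exact: Ck_on_cst.
Qed.

Let CfPhi : Ck_on 1 setT (fun z => f (Phi z)).
Proof.
apply: (@Ck_on_comp _ _ 1 d setT setT f Phi) => //; try exact: openT.
by move=> a; apply: Ck_onW; exact: CPhi.
Qed.

Let Cg a : Ck_on 1 setT (g a).
Proof.
by apply: Ck_onM; [exact: openT|exact: CfPhi|exact: Ck_on_gradient_cofactor].
Qed.

Let gK a : supported_path K (g a).
Proof. by move=> s x s01 Kx; rewrite /g [f _](fK s01 Kx) mul0r. Qed.

Let dPhi z : differentiable Phi z.
Proof. by apply: differentiable_components => a; exact: ((CPhi a).1 z I). Qed.

(** The terms that differentiate the cofactors cancel by Piola's identity. Those that differentiate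
    [f \o Phi] pair a row of the gradient matrix other than [ord0] with the cofactors of the row
    [ord0], which gives 0. *)
Let div_g z : \sum_a 'D_(w a) (g a) z = 0.
Proof.
have Dg a : 'D_(w a) (g a) z = f (Phi z) * 'D_(w a) (cof a) z +
    \sum_(j < d) 'D_(delta_mx 0 j) f (Phi z) *
      ('D_(w a) (F (lift ord0 j)) z * cof a z).
  have dcof := (Ck_on_gradient_cofactor w CF a).1 z I.
  have dfPhi := CfPhi.1 z I.
  rewrite (@deriveM _ _ (fun z => f (Phi z)) (cof a)); last 2 first.
  - exact: diff_derivable.
  - exact: diff_derivable.
  congr (_ + _).
  rewrite (derive_comp_rV _ (Cf.1 (Phi z) I) (dPhi z)).
  rewrite [LHS]mulrC mulr_suml; apply: eq_bigr => j _.
  have -> : (fun z => Phi z 0 j) = F (lift ord0 j).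
    by apply/funext => y; rewrite /F liftK.
  by rewrite -mulrA mulrCA.
under eq_bigr do rewrite Dg.
rewrite big_split /= -mulr_sumr divergence_cofactor// mulr0 add0r.
rewrite exchange_big big1// => j _.
by rewrite -mulr_sumr sum_gradient_cofactor ?mulr0// neq_lift.
Qed.

Let cof0 s x : cof ord0 (s, x) = \det (partial_mx (fun y => Phi (s, y)) x).
Proof.
rewrite /cof /cofactor addn0 expr0 mul1r -det_tr; congr (\det _).
apply/matrixP => i j; rewrite !mxE.
rewrite /w liftK derive_slice /F.
by under eq_fun do rewrite liftK.
Qed.

(** By the mean value theorem in [s], the difference is the time derivative of the lattice sum at an
    intermediate time. Since the space-time divergence of [g] vanishes, this derivative is minus a
    sum of lattice sums of space derivatives, which are small uniformly in [s]. *)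
Lemma lattice_sum_homotopy :
  sum_equiv (fun x => f (Phi (1, x)) * \det (partial_mx (fun y => Phi (1, y)) x))
            (fun x => f (Phi (0, x)) * \det (partial_mx (fun y => Phi (0, y)) x)).
Proof.
pose G n s := lattice_sum n (fun x => g ord0 (s, x)).
have GE s n : lattice_sum n (fun x => f (Phi (s, x)) *
    \det (partial_mx (fun y => Phi (s, y)) x)) = G n s.
  by rewrite /G; congr lattice_sum; apply/funext => x; rewrite /g cof0.
rewrite /sum_equiv; under eq_fun do rewrite !GE.
pose dG n s := - \sum_(j < d) lattice_sum n
  (fun x => 'D_((0, delta_mx 0 j) : V) (g (lift ord0 j)) (s, x)).
have GdG n (s : R) : is_derive s (1 : R) (G n) (dG n s).
  have -> : dG n s = n.+1%:R^-1 ^+ d *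
      \sum_(k : 'rV[grid_index n]_d) 'D_((1, 0) : V) (g ord0) (s, grid_point k).
    rewrite /dG -lattice_sum_sum /lattice_sum -mulrN -sumrN; congr (_ * _).
    apply: eq_bigr => k _; apply/eqP; rewrite eq_sym -addr_eq0; apply/eqP.
    have E := div_g (s, grid_point k); rewrite big_ord_recl w0 in E.
    apply: (etrans _ E); apply: (congr1 (+%R _)); apply: eq_bigr => j _.
    by rewrite wl.
  apply: is_deriveZ; apply: is_derive_bigsum => k.
  exact/is_derive_time/(Cg ord0).1.
(* There are [d] space directions; dividing by [d.+1] keeps the divisor nonzero when [d] is 0. *)
apply/cvgrPdist_le => e e0; pose e' := e / (d.+1)%:R.
have e'0 : 0 < e' by rewrite divr_gt0.
have : \forall n \near \oo, forall j : 'I_d, forall s, 0 <= s <= 1 ->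
  `|lattice_sum n (fun x => 'D_((0, delta_mx 0 j) : V) (g (lift ord0 j)) (s, x))| <= e'.
  apply: filter_forall => j.
  exact: (lattice_sum_derive_uniform _ K0 e'0 (Cg _) (@gK _)).
apply: filterS => n Hn.
have [|s s01 ->] := @MVT _ (G n) (dG n) 0 1 ltr01 (fun s _ => GdG n s).
- by apply: derivable_within_continuous => s _; apply: (@ex_derive _ _ _ _ _ _ _ (GdG n s)).
rewrite subr0 mulr1 sub0r normrN /dG normrN.
apply: le_trans (ler_norm_sum _ _ _) _.
apply: (@le_trans _ _ (\sum_(j < d) e')).
  apply: ler_sum => j _; apply: Hn; move: s01; rewrite in_itv /=.
  by move=> /andP[/ltW -> /ltW ->].
rewrite sumr_const card_ord -mulr_natl mulrCA ger_pMr// ler_pdivrMr// mul1r.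
by rewrite ler_nat.
Qed.

End Homotopy.

Section CkPair.
Context {R : realType} {d : nat}.
Let V : normedModType R := (R * 'rV[R]_d)%type.

Lemma Ck_on_fst k (U : set V) : Ck_on k U (fun z : V => z.1).
Proof.
have l : linear (fun z : V => z.1 : R) by [].
pose L : {linear V -> R} := HB.pack (fun z : V => z.1)
  (GRing.isLinear.Build _ _ _ _ _ l).
by apply: (@Ck_on_linear _ _ k _ _ L) => z; exact: cvg_fst.
Qed.

Lemma Ck_on_snd k (a : 'I_d) : Ck_on k setT (fun z : V => z.2 0 a).
Proof.
have l : linear (fun z : V => z.2) by [].
pose L : {linear V -> 'rV[R]_d} := HB.pack (fun z : V => z.2)
  (GRing.isLinear.Build _ _ _ _ _ l).
have CL : Ck_on k setT (fun z : V => z.2).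
  by apply: (@Ck_on_linear _ _ k _ _ L) => z; exact: cvg_snd.
exact: (Ck_on_component a openT CL).
Qed.

Lemma Ck_on_coord k (U : set 'rV[R]_d) (a : 'I_d) : Ck_on k U (fun x => x 0 a).
Proof.
have C : Ck_on k setT (fun x : 'rV[R]_d => x 0 a).
  apply: (@Ck_on_component _ _ _ k setT id a openT).
  exact: (@Ck_on_linear _ _ k _ setT idfun (fun x => cvg_id)).
exact: Ck_on_sub C.
Qed.

Lemma Ck_on_mulmx k (T : 'M[R]_d) (b : 'I_d) :
  Ck_on k setT (fun x : 'rV[R]_d => (x *m T) 0 b).
Proof.
under eq_fun do rewrite mxE.
apply: Ck_on_sum => [|a _]; first exact: openT.
by apply: Ck_onM; [exact: openT|exact: Ck_on_coord|exact: Ck_on_cst].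
Qed.

Lemma derive_of_affine (W : normedModType R) (g : W -> R) (v x : W) (c : R) :
  (forall h : R, g (h *: v + x) - g x = h * c) -> 'D_v g x = c.
Proof.
move=> gE; rewrite /derive; apply/cvg_lim => //.
apply: (@cvg_trans _ (cst c @ (0 : R)^')); last exact: cvg_cst.
apply: near_eq_cvg; near=> h; rewrite /= gE -[RHS]/(h^-1 * (h * c)) mulrA mulVf ?mul1r//.
near: h; exact: nbhs_dnbhs_neq.
Unshelve. all: by end_near. Qed.

Lemma partial_mx_affine (T : 'M[R]_d) (x b c : 'rV[R]_d) :
  partial_mx (fun y => b + (y - c) *m T) x = T.
Proof.
apply/matrixP => i j; rewrite mxE; apply: derive_of_affine => h.
have -> : h *: delta_mx 0 i + x - c = h *: delta_mx 0 i + (x - c) by rewrite addrA.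
rewrite mulmxDl -scalemxAl -rowE !mxE; ring.
Qed.

Lemma norm_mulmx_le (T : 'M[R]_d) :
  exists2 c, 0 < c & forall x : 'rV[R]_d, `|x *m T| <= c * `|x|.
Proof.
exists (\sum_i \sum_j `|T i j| + 1) => [|x].
  by rewrite ltr_wpDl// sumr_ge0// => i _; rewrite sumr_ge0.
have [->|x0] := eqVneq x 0; first by rewrite mul0mx normr0 mulr0.
have nx : 0 < `|x| by rewrite normr_gt0.
apply/ltW/norm_rV_lt => [|a].
  by rewrite mulr_gt0// ltr_wpDl// sumr_ge0// => i _; rewrite sumr_ge0.
apply: (@le_lt_trans _ _ ((\sum_i \sum_j `|T i j|) * `|x|)); last first.
  by rewrite ltr_pM2r// ltrDl.
rewrite mxE; apply: le_trans (ler_norm_sum _ _ _) _.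
rewrite mulr_suml; apply: ler_sum => i _; rewrite normrM mulrC.
rewrite ler_pM// ?coord_le_norm//.
by rewrite (bigD1 a)//= lerDl sumr_ge0.
Qed.

End CkPair.

(** * Linear changes of variables *)

Section LinearChange.
Context {R : realType} {d : nat}.
Implicit Types (f : 'rV[R]_d.+1 -> R) (A B : 'M[R]_d.+1).

Definition compactly_supported f := exists2 K, 0 < K & supported_in K f.

(** The absolute value is there because the factors of an LUP decomposition may reverse the
    orientation even when their product does not. *)
Definition preserves_sums A := forall f, Ck_on 1 setT f -> compactly_supported f ->
  sum_equiv (fun x => f (x *m A) * `|\det A|) f.

(** The property of [A] is applied to [f (y *m B) * |\det B|], whose support is compact because [B]
    is invertible. *)
Lemma preserves_sumsM A B : B \in unitmx ->
  preserves_sums A -> preserves_sums B -> preserves_sums (A *m B).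
Proof.
move=> uB pA pB f Cf [K K0 fK].
apply: sum_equiv_trans (pB f Cf (ex_intro2 _ _ K K0 fK)).
have -> : (fun x => f (x *m (A *m B)) * `|\det (A *m B)|) =
    (fun x => (fun y => f (y *m B) * `|\det B|) (x *m A) * `|\det A|).
  by apply/funext => x; rewrite mulmxA det_mulmx normrM mulrA mulrAC.
apply: pA.
  apply: Ck_onM; [exact: openT| |exact: Ck_on_cst].
  exact: (@Ck_on_comp _ _ 1 _ setT setT f (fun y => y *m B) openT openT
    (fun _ _ => I) Cf (Ck_on_mulmx 1 B)).
have [c c0 cB] := norm_mulmx_le (invmx B).
exists (c * K); first exact: mulr_gt0.
move=> x xK; rewrite fK ?mul0r// -(ler_pM2l c0).
by apply: (le_trans xK); have := cB (x *m B); rewrite mulmxK.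
Qed.

Lemma preserves_sums_perm (s : 'S_d.+1) : preserves_sums (perm_mx s).
Proof.
move=> f _ _; rewrite det_perm normrX normrN normr1 expr1n.
rewrite /sum_equiv; under eq_fun => n.
  have -> : lattice_sum n (fun x => f (x *m perm_mx s) * 1) = lattice_sum n f.
    rewrite /lattice_sum; congr (_ * _).
    have cpI : injective (fun k : 'rV[grid_index n]_d.+1 => col_perm s^-1%g k).
      move=> k k' /(congr1 (col_perm s)).
      by rewrite -!col_permM mulgV !col_perm1.
    rewrite [RHS](reindex_inj cpI).
    apply: eq_bigr => k _; rewrite mulr1 -[s in LHS]invgK -col_permE.
    by congr f; apply/rowP => a; rewrite !mxE.
  rewrite subrr; over.
exact: cvg_cst.
Qed.

Definition sign_mx (b : 'I_d.+1 -> bool) : 'M[R]_d.+1 :=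
  diag_mx (\row_a (-1) ^+ b a).

(** Negation in the cyclic index group is the reflection of the grid, except at the index 0. *)
Lemma preserves_sums_sign b : preserves_sums (sign_mx b).
Proof.
move=> f _ [K K0 fK].
have -> : `|\det (sign_mx b)| = 1.
  rewrite det_diag normr_prod big1// => a _.
  by rewrite mxE normrX normrN normr1 expr1n.
rewrite /sum_equiv; apply: (@cvg_trans _ (cst (0 : R) @ \oo)); last exact: cvg_cst.
apply: near_eq_cvg; near=> n; have KN : K <= n.+1%:R.
  by rewrite -[n.+1%:R]natr1 ler_wpDr//; near: n; exact: nbhs_infty_ger.
rewrite /cst; apply/esym/eqP; rewrite subr_eq0; apply/eqP.
rewrite /lattice_sum; congr (_ * _).
pose flip (k : 'rV[grid_index n]_d.+1) : 'rV[grid_index n]_d.+1 :=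
  \row_a (if b a then - k 0 a else k 0 a).
have flipK : involutive flip.
  by move=> k; apply/rowP => a; rewrite !mxE; case: (b a); rewrite ?opprK.
rewrite [RHS](reindex_inj (inv_inj flipK)); apply: eq_bigr => k _; rewrite mulr1.
have N0 : n.+1%:R != 0 :> R by rewrite pnatr_eq0.
have gE (k' : 'rV[grid_index n]_d.+1) a :
    (grid_point k' : 'rV[R]_d.+1) 0 a = (nat_of_ord (k' 0 a))%:R / n.+1%:R - n.+1%:R.
  by rewrite mxE.
(* The index 0 is its own opposite, whereas the reflection sends its coordinate [- n.+1] to [n.+1];
   [f] vanishes at both points. *)
have [/existsP[a /eqP ka]|] := boolP [exists a, k 0 a == 0].
  rewrite !fK//; apply: (le_trans KN); apply: le_trans (coord_le_norm _ a).
    rewrite gE mxE ka oppr0 if_same mul0r sub0r normrN.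
    by rewrite ger0_norm.
  rewrite mul_mx_diag mxE gE ka mul0r sub0r mxE mulNr normrN normrM.
  by rewrite normrX normrN normr1 expr1n mulr1 ger0_norm.
rewrite negb_exists => /forallP k0.
congr f; apply/rowP => a; rewrite mul_mx_diag mxE !gE !mxE.
case: (b a); last by rewrite expr0 mulr1.
have S0 : (2 * n.+1 ^ 2).-1.+1 = (2 * n.+1 ^ 2)%N.
  by rewrite prednK// muln_gt0 expn_gt0.
have kp : (0 < nat_of_ord (k ord0 a))%N.
  by rewrite lt0n; apply: contra (k0 a) => /eqP k0a; apply/eqP/val_inj.
have oppE : nat_of_ord (- k 0 a) = (2 * n.+1 ^ 2 - k ord0 a)%N.
  by rewrite -[X in (X - _)%N]S0 /= modn_small// ltn_subrL kp.
rewrite oppE natrB; last by rewrite -[X in (_ <= X)%N]S0 ltnW.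
by rewrite natrM natrX expr1; field.
Unshelve. all: by end_near. Qed.

(** The homotopy is [x *m M s], where [M s] runs along the segment from 1 to [A]. Invertibility
    along the segment bounds the supports of all the functions [f \o Phi_s] at once. *)
Lemma preserves_sums_segment A :
  (forall s : R, 0 <= s <= 1 -> 0 < \det ((1 - s)%:M + s *: A)) -> preserves_sums A.
Proof.
move=> detA f Cf [K K0 fK].
pose V : normedModType R := (R * 'rV[R]_d.+1)%type.
pose M (s : R) := (1 - s)%:M + s *: A.
pose Phi (z : V) : 'rV[R]_d.+1 := z.2 *m M z.1.
have PhiE z a : Phi z 0 a = (1 - z.1) * z.2 0 a + z.1 * \sum_i z.2 0 i * A i a.
  rewrite /Phi /M mulmxDr mul_mx_scalar -scalemxAr !mxE; congr (_ + _ * _).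
have CPhi k a : Ck_on k setT (fun z : V => Phi z 0 a).
  under eq_fun do rewrite PhiE.
  have C1 : Ck_on k setT (fun z : V => 1 - z.1).
    apply: Ck_onD; [exact: openT|exact: Ck_on_cst|].
    under eq_fun do rewrite -scaleN1r.
    by apply: Ck_onZ; [exact: openT|exact: Ck_on_fst].
  apply: Ck_onD; [exact: openT| |].
    by apply: Ck_onM; [exact: openT| |exact: Ck_on_snd].
  apply: Ck_onM; [exact: openT|exact: Ck_on_fst|].
  apply: Ck_on_sum => [|i _]; first exact: openT.
  by apply: Ck_onM; [exact: openT|exact: Ck_on_snd|exact: Ck_on_cst].
have cPhi (z : V) : {for z, continuous Phi}.
  by apply: continuous_components => a; exact: (CPhi 0 a z I).
(* [c] is the minimum of the norm of [Phi] over the product of [[0, 1]] and the unit sphere; it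
   extends to all [x] by homogeneity. *)
have [c c0 Hc] : exists2 c, 0 < c & forall s x, 0 <= s <= 1 -> c * `|x| <= `|Phi (s, x)|.
  pose S : set V := `[0, 1] `*` [set x | `|x| = 1].
  have cS : compact S.
    apply: compact_setX; first exact: segment_compact.
    apply: (subclosed_compact _ (closed_ball_compact (K := 1))); last first.
      by move=> x /= ->.
    rewrite (_ : [set x | _] = (@Num.norm _ 'rV[R]_d.+1) @^-1` [set 1])//.
    apply: closed_comp; last exact: closed_eq.
    by move=> x _; exact: norm_continuous.
  have S0 : S !=set0.
    exists (0, const_mx 1); split; first by rewrite /= in_itv /= lexx ler01.
    rewrite /=; apply/eqP; rewrite eq_le; apply/andP; split; last first.
      by have := coord_le_norm (const_mx 1 : 'rV[R]_d.+1) ord0; rewrite mxE normr1.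
    apply/ler_addgt0Pr => e e0; apply/ltW/norm_rV_lt => [|a].
      by rewrite addr_gt0.
    by rewrite mxE normr1 ltrDl.
  have [|[s x] + Hmin] := compact_EVT_min S0 cS (f := fun z => `|Phi z|).
    apply: continuous_subspaceT => z.
    apply: (@continuous_comp _ _ _ Phi (@Num.norm _ 'rV[R]_d.+1)).
      exact: cPhi.
    exact: norm_continuous.
  rewrite inE => -[/= s01 x1].
  exists `|Phi (s, x)|.
    rewrite normr_gt0; apply/eqP => Phi0.
    have := detA s s01; rewrite lt_neqAle eq_sym -unitfE => /andP[uM _].
    have : x = 0 by rewrite -(mulmxK uM x) [x *m _]Phi0 mul0mx.
    by move=> x0; move/eqP: x1; rewrite x0 normr0 eq_sym oner_eq0.
  move=> s' x' s01'; have [->|x0] := eqVneq x' 0; first by rewrite normr0 mulr0.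
  have nx : 0 < `|x'| by rewrite normr_gt0.
  rewrite -ler_pdivlMr//.
  have := Hmin (s', `|x'|^-1 *: x'); rewrite inE => /(_ _).
  have -> : Phi (s', `|x'|^-1 *: x') = `|x'|^-1 *: Phi (s', x').
    by rewrite /Phi /= -scalemxAl.
  rewrite normrZ normfV normr_id mulrC; apply.
  split => /=; first by rewrite in_itv.
  by rewrite normrZ normfV normr_id mulVf// gt_eqF.
have fPhiK : supported_path (K / c) (f \o Phi).
  move=> s x s01 Kx; rewrite /= fK//; apply: le_trans (Hc s x s01).
  by rewrite mulrC -ler_pdivrMr.
have E s : (fun x => f (Phi (s, x)) * \det (partial_mx (fun y => Phi (s, y)) x)) =
    (fun x => f (x *m M s) * \det (M s)).
  have EM : (fun y => Phi (s, y)) = (fun y => 0 + (y - 0) *m M s).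
    by apply/funext => y; rewrite subr0 add0r.
  apply/funext => x; apply: (congr1 (fun T => f (x *m M s) * \det T)).
  by rewrite EM partial_mx_affine.
have := lattice_sum_homotopy (divr_gt0 K0 c0) (CPhi 2) Cf fPhiK.
have -> := congr2 sum_equiv (E 1) (E 0).
have -> : M 1 = A by rewrite /M subrr scale1r raddf0 add0r.
have -> : M 0 = 1%:M by rewrite /M subr0 scale0r addr0.
have -> : (fun x => f (x *m 1%:M) * \det (1%:M : 'M[R]_d.+1)) = f.
  by apply/funext => x; rewrite mulmx1 det1 mulr1.
rewrite gtr0_norm//; have := detA 1; rewrite subrr scale1r raddf0 add0r.
by apply; rewrite ler01 lexx.
Qed.

Lemma preserves_sums_trig A : is_trig_mx A -> (forall i, 0 < A i i) ->
  preserves_sums A.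
Proof.
move=> /is_trig_mxP tA A0; apply: preserves_sums_segment => s /andP[s0 s1].
rewrite det_trig; last first.
  apply/is_trig_mxP => i j ij; rewrite !mxE tA// mulr0 addr0.
  by rewrite (_ : (i == j) = false) ?mulr0n//; apply/negP => /eqP ij'; rewrite ij' ltnn in ij.
apply: prodr_gt0 => i _; rewrite !mxE eqxx mulr1n.
have [->|s10] := eqVneq s 1; first by rewrite subrr add0r mul1r.
have : s < 1 by rewrite lt_neqAle s10.
by move=> ?; rewrite ltr_wpDr ?subr_gt0// mulr_ge0// ltW.
Qed.

Lemma preserves_sums_trig_tr A : is_trig_mx A^T -> (forall i, 0 < A i i) ->
  preserves_sums A.
Proof.
move=> /is_trig_mxP tA A0; apply: preserves_sums_segment => s /andP[s0 s1].
rewrite -det_tr det_trig; last first.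
  apply/is_trig_mxP => i j ij; have := tA i j ij; rewrite !mxE => ->; rewrite mulr0 addr0.
  by rewrite (_ : (j == i) = false) ?mulr0n//; apply/negP => /eqP ij'; rewrite ij' ltnn in ij.
apply: prodr_gt0 => i _; rewrite !mxE eqxx mulr1n.
have [->|s10] := eqVneq s 1; first by rewrite subrr add0r mul1r.
have : s < 1 by rewrite lt_neqAle s10.
by move=> ?; rewrite ltr_wpDr ?subr_gt0// mulr_ge0// ltW.
Qed.

(* The sign matrix makes the diagonal of the upper triangular factor positive;
   triangular matrices with positive diagonal are joined to 1 by segments of
   invertible matrices. *)
Lemma preserves_sums_unitmx A : A \in unitmx -> preserves_sums A.
Proof.
move=> uA; have := cormen_lup_perm A; have := cormen_lup_correct A.
have := @cormen_lup_lower _ _ A; have := @cormen_lup_upper _ _ A.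
have := cormen_lup_detL A.
case: (cormen_lup A) => -[P L] U /= detL Uup Llow PLU /is_perm_mxP[s Ps].
pose b (a : 'I_d.+1) := U a a < 0.
pose U' := sign_mx b *m U.
have bb : sign_mx b *m sign_mx b = 1%:M.
  apply/matrixP => i j; rewrite mul_diag_mx !mxE; case: (i == j); last by rewrite mulr0n mulr0.
  by rewrite !mulr1n -expr2 sqrr_sign.
have -> : A = perm_mx s^-1%g *m (L *m (sign_mx b *m U')).
  rewrite /U' (mulmxA (sign_mx b)) bb mul1mx -[L *m U]PLU Ps.
  by rewrite -[(_ * A)%R]/(_ *m A) mulmxA -perm_mxM mulVg perm_mx1 mul1mx.
have uL : L \in unitmx by rewrite unitmxE detL unitr1.
have uU : U \in unitmx.
  have : P *m A \in unitmx by rewrite unitmx_mul uA Ps unitmx_perm.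
  by rewrite [P *m A]PLU unitmx_mul => /andP[].
have ub : sign_mx b \in unitmx by case/mulmx1_unit: bb.
have uU' : U' \in unitmx by rewrite unitmx_mul ub uU.
have U0 i : U i i != 0.
  have : \det U^T != 0 by rewrite det_tr -unitfE -unitmxE.
  rewrite det_trig; first by move/prodf_neq0/(_ i isT); rewrite mxE.
  by apply/is_trig_mxP => j k jk; rewrite mxE Uup.
apply: preserves_sumsM; first by rewrite !unitmx_mul uL ub uU.
  exact: preserves_sums_perm.
apply: preserves_sumsM; first by rewrite !unitmx_mul ub uU.
  apply: preserves_sums_trig; last by move=> i; rewrite Llow// eqxx.
  apply/is_trig_mxP => i j ij; rewrite Llow ?(ltnW ij)//.
  by rewrite (_ : (i == j) = false)//; apply/negP => /eqP ij'; rewrite ij' ltnn in ij.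
apply: preserves_sumsM => //; first exact: preserves_sums_sign.
apply: preserves_sums_trig_tr.
  by apply/is_trig_mxP => i j ij; rewrite mxE /U' /sign_mx mul_diag_mx mxE Uup// mulr0.
move=> i; rewrite /U' /sign_mx mul_diag_mx !mxE /b.
have [Ui|Ui] := ltrP (U i i) 0; first by rewrite expr1 mulN1r oppr_gt0.
by rewrite expr0 mul1r lt_neqAle eq_sym U0.
Qed.

End LinearChange.

(** * Bump and cutoff functions of class C^k *)

Section Bump.
Context {R : realType}.

Definition pos_part (t : R) : R := Num.max t 0.

Lemma pos_part_ge0 t : 0 <= pos_part t.
Proof. by rewrite le_max lexx orbT. Qed.

Lemma pos_part_gt0 t : 0 < t -> 0 < pos_part t.
Proof. by move=> t0; rewrite lt_max t0. Qed.

Lemma pos_part0 t : t <= 0 -> pos_part t = 0.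
Proof. by move=> t0; rewrite /pos_part max_r. Qed.

Lemma pos_part_continuous : continuous pos_part.
Proof. by move=> t; apply: continuous_max; [exact: cvg_id|exact: cvg_cst]. Qed.

Lemma pos_part_exp_continuous k : continuous (fun t => pos_part t ^+ k).
Proof.
move=> t; apply: (@continuous_comp _ _ _ pos_part (fun u : R => u ^+ k)).
  exact: pos_part_continuous.
exact: exprn_continuous.
Qed.

(** Away from 0 the function is locally zero or a power. At 0 the difference quotient is
    [pos_part h ^+ k.+1], which tends to 0. *)
Lemma is_derive_pos_part_exp k (t : R) :
  is_derive t (1 : R) (fun t => pos_part t ^+ k.+2) (k.+2%:R * pos_part t ^+ k.+1).
Proof.
have [t0|t0|->] := ltgtP t 0.
- rewrite pos_part0 ?ltW// expr0n /= mulr0.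
  have N0 : \near t, cst (0 : R) t = pos_part t ^+ k.+2.
    near=> u; rewrite /cst pos_part0 ?expr0n//; near: u.
    by apply: filterS (lt_nbhsl t0) => u /ltW.
  exact: near_eq_is_derive N0 (is_derive_cst _ _ _).
- rewrite /pos_part max_l ?ltW//.
  have N0 : \near t, t ^+ k.+2 = Num.max t 0 ^+ k.+2.
    by near=> u; rewrite max_l//; near: u; apply: filterS (lt_nbhsr t0) => u /ltW.
  apply: (near_eq_is_derive N0).
  apply: DeriveDef; first exact: exprn_derivable.
  by rewrite exp_derive /GRing.scale /= mulr1.
- rewrite [pos_part 0]pos_part0// expr0n /= mulr0.
  have E : (fun h : R => h^-1 *: (pos_part (h *: (1 : R) + 0) ^+ k.+2 - pos_part 0 ^+ k.+2))
      @ 0^' --> (0 : R).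
    apply: (@cvg_trans _ ((fun h => pos_part h ^+ k.+1) @ 0^')).
      apply: near_eq_cvg; near=> h.
      have h0 : h != 0 by near: h; exact: nbhs_dnbhs_neq.
      rewrite [pos_part 0]pos_part0// expr0n /= subr0 addr0 -[h *: 1]/(h * 1) mulr1.
      rewrite -[RHS]/(h^-1 * _); have [hle|hgt] := leP h 0.
        by rewrite pos_part0// !expr0n /= mulr0.
      by rewrite /pos_part max_l ?ltW// [in RHS]exprS mulrA mulVf ?mul1r.
    have Z : pos_part (0 : R) ^+ k.+1 = 0 by rewrite pos_part0// expr0n.
    have := @pos_part_exp_continuous k.+1 0; rewrite /continuous_at Z.
    exact: cvg_within_filter.
  apply: DeriveDef; first by apply/cvg_ex; exists 0.
  exact/cvg_lim.
Unshelve. all: by end_near. Qed.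

Lemma Ck_on_pos_part_exp k : Ck_on k setT (fun t => pos_part t ^+ k.+1).
Proof.
elim: k => [|k IH]; first by move=> t _; exact: pos_part_exp_continuous.
have df t : differentiable (fun t => pos_part t ^+ k.+2) t.
  by apply/derivable1_diffP; exact: (@ex_derive _ _ _ _ _ _ _ (is_derive_pos_part_exp k t)).
split=> [t _|v]; first exact: df.
apply: (Ck_on_ext openT _ (Ck_onZ (v * k.+2%:R) openT IH)) => t _.
have E : 'd (fun t => pos_part t ^+ k.+2) t (v *: (1 : R)) =
    v *: 'd (fun t => pos_part t ^+ k.+2) t 1 by rewrite linearZ.
rewrite -[X in _ = 'd _ _ X]mulr1 [RHS]E -deriveE//.
rewrite (@derive_val _ _ _ _ _ _ _ (is_derive_pos_part_exp k t)).
by rewrite -[LHS]mulrA.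
Qed.

End Bump.

Section BumpRV.
Context {R : realType} {d : nat}.
Implicit Types x : 'rV[R]_d.

(* Class C^k is enough below, hence powers instead of the usual exponentials. *)
Definition bump_fun k x : R := \prod_a pos_part (1 - x 0 a ^+ 2) ^+ k.+1.

Lemma Ck_on_sqr_coord k (c e : R) (a : 'I_d) :
  Ck_on k setT (fun x : 'rV[R]_d => c + e * x 0 a ^+ 2).
Proof.
apply: Ck_onD; [exact: openT|exact: Ck_on_cst|].
apply: Ck_onM; [exact: openT|exact: Ck_on_cst|].
by apply: Ck_onM; [exact: openT|exact: Ck_on_coord|exact: Ck_on_coord].
Qed.

Lemma Ck_on_bump k : Ck_on k setT (bump_fun k).
Proof.
apply: Ck_on_prod => [|a _]; first exact: openT.
apply: (Ck_on_comp1 openT (Ck_on_pos_part_exp k)).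
by under eq_fun do rewrite -mulN1r; exact: Ck_on_sqr_coord.
Qed.

Lemma bump_ge0 k x : 0 <= bump_fun k x.
Proof. by apply: prodr_ge0 => a _; rewrite exprn_ge0// pos_part_ge0. Qed.

Lemma bump_gt0 k x : `|x| < 1 -> 0 < bump_fun k x.
Proof.
move=> x1; apply: prodr_gt0 => a _; rewrite exprn_gt0// pos_part_gt0// subr_gt0.
by rewrite -real_normK ?num_real// expr_lt1// (le_lt_trans (coord_le_norm x a)).
Qed.

Lemma bump_eq0 k x : 1 <= `|x| -> bump_fun k x = 0.
Proof.
move=> x1; apply/eqP; apply: contraTT x1; rewrite -ltNge => /prodf_neq0 b0.
apply: norm_rV_lt => // a; have := b0 a isT.
rewrite expf_eq0 /=; apply: contraNT; rewrite -leNgt => xa.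
rewrite pos_part0// subr_le0 -[x 0 a ^+ 2]real_normK ?num_real//.
by rewrite expr_ge1.
Qed.

(** [u] is positive exactly in the open cube of radius 2, and [v] exactly outside the closed cube of
    radius 1. So the denominator never vanishes, and the quotient is 1 on the small cube and 0
    outside the large one. *)
Definition cutoff k x : R :=
  let u := bump_fun k (2^-1 *: x) in
  let v := \sum_a pos_part (x 0 a ^+ 2 - 1) ^+ k.+1 in u / (u + v).

Lemma cutoff_denom_gt0 k x :
  0 < bump_fun k (2^-1 *: x) + \sum_a pos_part (x 0 a ^+ 2 - 1) ^+ k.+1.
Proof.
have v0 a : 0 <= pos_part (x 0 a ^+ 2 - 1) ^+ k.+1 by rewrite exprn_ge0// pos_part_ge0.
have [x2|x2] := ltP `|x| 2.
  rewrite ltr_pwDl ?sumr_ge0// bump_gt0// normrZ normfV.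
  by rewrite ger0_norm// mulrC ltr_pdivrMr// mul1r.
rewrite ltr_wpDl ?bump_ge0//.
have [a xa] : exists a, 2 <= `|x 0 a|.
  apply/not_existsP => H; have : `|x| < 2; last by rewrite ltNge x2.
  by apply: norm_rV_lt => // a; rewrite ltNge; apply/negP; exact: H.
rewrite (bigD1 a)//= ltr_pwDl ?sumr_ge0// exprn_gt0// pos_part_gt0// subr_gt0.
by rewrite -real_normK ?num_real// expr_gt1//; lra.
Qed.

Lemma Ck_on_cutoff k : Ck_on k setT (cutoff k).
Proof.
have Cu : Ck_on k setT (fun x => bump_fun k (2^-1 *: x)).
  apply: (@Ck_on_comp _ _ k d setT setT (bump_fun k) (fun x => 2^-1 *: x) openT openT
    (fun _ _ => I) (Ck_on_bump k)) => a.
  under eq_fun do rewrite mxE.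
  by apply: Ck_onM; [exact: openT|exact: Ck_on_cst|exact: Ck_on_coord].
apply: Ck_onM; [exact: openT|exact: Cu|].
apply: Ck_onV; [exact: openT|by move=> x _; rewrite gt_eqF ?cutoff_denom_gt0|].
apply: Ck_onD; [exact: openT|exact: Cu|].
apply: Ck_on_sum => [|a _]; first exact: openT.
apply: (Ck_on_comp1 openT (Ck_on_pos_part_exp k)).
under eq_fun do rewrite addrC -[_ ^+ 2]mul1r.
exact: Ck_on_sqr_coord.
Qed.

Lemma cutoff_eq1 k x : `|x| <= 1 -> cutoff k x = 1.
Proof.
move=> x1; have := cutoff_denom_gt0 k x; rewrite /cutoff.
rewrite [X in _ + X]big1 => [|a _].
  by rewrite addr0 => u0; rewrite divff// gt_eqF.
rewrite pos_part0 ?expr0n// subr_le0 -real_normK ?num_real//.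
by rewrite expr_le1// (le_trans (coord_le_norm x a)).
Qed.

Lemma cutoff_eq0 k x : 2 <= `|x| -> cutoff k x = 0.
Proof.
move=> x2; rewrite /cutoff bump_eq0 ?mul0r// normrZ normfV.
by rewrite ger0_norm// mulrC ler_pdivlMr// mul1r.
Qed.

Lemma cutoff_ge0 k x : 0 <= cutoff k x.
Proof. by rewrite divr_ge0 ?bump_ge0// ltW// cutoff_denom_gt0. Qed.

Lemma cutoff_le1 k x : cutoff k x <= 1.
Proof.
rewrite ler_pdivrMr ?cutoff_denom_gt0// mul1r lerDl sumr_ge0// => a _.
by rewrite exprn_ge0// pos_part_ge0.
Qed.

End BumpRV.

(** * Local change of variables *)

Section LocalChange.
Context {R : realType} {d : nat}.
Let D := d.+1.
Let V : normedModType R := (R * 'rV[R]_D)%type.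

(** Since [b] need not be a lattice vector, the translation does not permute the lattice; the
    homotopy [x + s *: b] is used instead. *)
Lemma sum_equiv_translation (f : 'rV[R]_D -> R) (b : 'rV[R]_D) :
  Ck_on 1 setT f -> compactly_supported f ->
  sum_equiv (fun x => f (b + x)) f.
Proof.
move=> Cf [K K0 fK].
pose Phi (z : V) : 'rV[R]_D := z.2 + z.1 *: b.
have CPhi a : Ck_on 2 setT (fun z : V => Phi z 0 a).
  under eq_fun do rewrite !mxE.
  apply: Ck_onD; [exact: openT|exact: Ck_on_snd|].
  by apply: Ck_onM; [exact: openT|exact: Ck_on_fst|exact: Ck_on_cst].
have fPhiK : supported_path (K + `|b|) (f \o Phi).
  move=> s x /andP[s0 s1] Kx; rewrite /= fK// /Phi /=.
  have H := lerB_normD x (s *: b); apply: le_trans H.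
  rewrite lerBrDr; apply: le_trans Kx; rewrite lerD2l normrZ ger0_norm//.
  by rewrite ler_piMl.
have K0b : 0 < K + `|b| by rewrite ltr_wpDr.
have E s : (fun x => f (Phi (s, x)) * \det (partial_mx (fun y => Phi (s, y)) x)) =
    (fun x => f (x + s *: b)).
  have EM : (fun y => Phi (s, y)) = (fun y => s *: b + (y - 0) *m 1%:M).
    by apply/funext => y; rewrite subr0 mulmx1 addrC.
  by apply/funext => x; rewrite EM partial_mx_affine det1 mulr1.
have := lattice_sum_homotopy K0b CPhi Cf fPhiK.
have -> := congr2 sum_equiv (E 1) (E 0).
congr sum_equiv; apply/funext => x.
  by rewrite scale1r addrC.
by rewrite scale0r addr0.
Qed.

Lemma sum_equiv_affine (f : 'rV[R]_D -> R) (b c : 'rV[R]_D) (L : 'M[R]_D) :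
  Ck_on 1 setT f -> compactly_supported f -> 0 < \det L ->
  sum_equiv (fun x => f (b + (x - c) *m L) * \det L) f.
Proof.
move=> Cf Kf L0; pose t := b - c *m L; pose h y := f (t + y).
have Ch : Ck_on 1 setT h.
  apply: (@Ck_on_comp _ _ 1 D setT setT f (fun y => t + y) openT openT
    (fun _ _ => I) Cf) => a.
  under eq_fun do rewrite mxE.
  by apply: Ck_onD; [exact: openT|exact: Ck_on_cst|exact: Ck_on_coord].
have Kh : compactly_supported h.
  have [K K0 fK] := Kf; exists (K + `|t|); first by rewrite ltr_wpDr.
  move=> x Kx; rewrite /h fK//.
  have H := lerB_normD x t; rewrite addrC; apply: le_trans H.
  by rewrite lerBrDr.
apply: sum_equiv_trans (sum_equiv_translation t Cf Kf).
have uL : L \in unitmx by rewrite unitmxE unitfE gt_eqF.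
have := preserves_sums_unitmx uL Ch Kh; congr sum_equiv.
apply/funext => x; rewrite gtr0_norm// /h /t; congr (f _ * _).
by rewrite mulmxBl addrA addrAC.
Qed.

(* The homotopy joins psi to its affine part at x0 after multiplying the
   remainder by a cutoff; near x0 the remainder is dominated by half of the
   linear part, so that the support of f o Phi_s stays close to x0. *)
Lemma sum_equiv_local (A : set 'rV[R]_D) (psi : 'rV[R]_D -> 'rV[R]_D) (x0 : 'rV[R]_D) :
  open A -> A x0 -> (forall a, Ck_on 2 A (fun x => psi x 0 a)) ->
  0 < \det (partial_mx psi x0) ->
  exists2 r, 0 < r & forall f g : 'rV[R]_D -> R, Ck_on 1 setT f ->
    (forall y, f y != 0 -> `|y - psi x0| < r) ->
    (forall x, g x != 0 -> `|x - x0| < r) ->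
    (forall x, A x -> g x = f (psi x) * \det (partial_mx psi x)) ->
    sum_equiv g f.
Proof.
move=> oA Ax0 Cpsi detL; set L := partial_mx psi x0 in detL.
have uL : L \in unitmx by rewrite unitmxE unitfE gt_eqF.
have [c1 c10 Hc1] := norm_mulmx_le (invmx L).
pose c := c1^-1; have c0 : 0 < c by rewrite invr_gt0.
have Hc (v : 'rV[R]_D) : c * `|v| <= `|v *m L|.
  by rewrite mulrC ler_pdivrMr// mulrC; have := Hc1 (v *m L); rewrite mulmxK.
have dpsi x : A x -> differentiable psi x.
  by move=> Ax; apply: differentiable_components => a; exact: ((Cpsi a).1 x Ax).
pose rem x := psi x - psi x0 - (x - x0) *m L.
(* Differentiability at [x0] makes the remainder at most half of the lower bound [c * |x - x0|] of
   the linear part. *)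
have [e e0 He] : exists2 e, 0 < e & forall x, `|x - x0| < e ->
    A x /\ `|rem x| <= c / 2 * `|x - x0|.
  have c20 : 0 < c / 2 by rewrite divr_gt0.
  have /eqaddoP/(_ _ c20) := diff_locally (dpsi x0 Ax0).
  have : \forall h \near (0 : 'rV[R]_D), A (h + x0).
    have : \forall y \near x0, A y by exact: (open_nbhs_nbhs (conj oA Ax0)).
    rewrite (near_shift 0 x0).
    by apply: filterS => h; rewrite /= subr0.
  move=> N1 N2.
  have : \forall h \near (0 : 'rV[R]_D), A (h + x0) /\
      `|(psi \o shift x0 - (cst (psi x0) + 'd psi x0)) h| <= c / 2 * `|h|.
    by apply: filterS2 N1 N2 => h Ah bh; split.
  move=> /nbhs_ballP[e /= e0 He].
  exists e => // x xe; have := He (x - x0).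
  rewrite -ball_normE /ball_ /= sub0r normrN => /(_ xe) [].
  rewrite subrK => Ax; rewrite !fctE /= subrK opprD addrA.
  have -> : 'd psi x0 (x - x0) = (x - x0) *m L.
    by rewrite /L -(jacobianE (dpsi x0 Ax0)) mul_rV_lin1.
  by split.
(* The cutoff [chi] vanishes from the radius [2 * dl] on, which is thus smaller than [e], and it is
   1 up to the radius [dl]. *)
pose dl := e / 3; have dl0 : 0 < dl by rewrite divr_gt0.
have dle : 2 * dl < e by rewrite /dl; lra.
pose chi x := cutoff 2 (dl^-1 *: (x - x0)).
have chi0 x : 2 * dl <= `|x - x0| -> chi x = 0.
  move=> xd; apply: cutoff_eq0; rewrite normrZ gtr0_norm ?invr_gt0//.
  by rewrite mulrC ler_pdivlMr.
have chi1 x : `|x - x0| <= dl -> chi x = 1.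
  move=> xd; apply: cutoff_eq1; rewrite normrZ gtr0_norm ?invr_gt0//.
  by rewrite mulrC ler_pdivrMr// mul1r.
have Cchi : Ck_on 2 setT chi.
  apply: (@Ck_on_comp _ _ 2 D setT setT (cutoff 2) (fun x => dl^-1 *: (x - x0))
    openT openT (fun _ _ => I) (Ck_on_cutoff 2)) => a.
  under eq_fun do rewrite !mxE.
  apply: Ck_onM; [exact: openT|exact: Ck_on_cst|].
  by apply: Ck_onD; [exact: openT|exact: Ck_on_coord|exact: Ck_on_cst].
pose rho a x := chi x * rem x 0 a.
have Crho a : Ck_on 2 setT (rho a).
  (* [psi] is arbitrary outside [A], but the cutoff vanishes on the open set [C]; since [A] and [C]
     cover the space, [rho a] is of class C^2 everywhere. *)
  pose C := [set x : 'rV[R]_D | 2 * dl < `|x - x0|].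
  have oC : open C.
    have cs : continuous (fun x : 'rV[R]_D => x - x0).
      move=> x; apply: continuous_components => b.
      have E : (fun x : 'rV[R]_D => (x - x0) 0 b) = (fun x => x 0 b + - x0 0 b).
        by apply/funext => y; rewrite !mxE.
      have C0 : Ck_on 0 setT (fun x : 'rV[R]_D => x 0 b + - x0 0 b).
        by apply: Ck_onD; [exact: openT|exact: Ck_on_coord|exact: Ck_on_cst].
      by rewrite E; exact: (C0 x I).
    have cn : continuous (@Num.norm _ 'rV[R]_D \o (fun x : 'rV[R]_D => x - x0)).
      by move=> x; apply: continuous_comp; [exact: cs|exact: norm_continuous].
    have := @open_comp _ _ _ _ (fun x _ => cn x) (@open_gt _ (2 * dl)).
    exact.
  have AC : A `|` C = setT.
    apply/seteqP; split => // x _; have [xd|xd] := leP `|x - x0| (2 * dl); last by right.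
    by left; apply: (He x _).1; exact: le_lt_trans dle.
  rewrite -AC; apply: Ck_on_setU.
    apply: Ck_onM; [exact: oA|exact: Ck_on_sub Cchi|].
    have -> : (fun x => rem x 0 a) = (fun x => psi x 0 a + (- psi x0 0 a +
        (-1) * ((x *m L) 0 a + - (x0 *m L) 0 a))).
      apply/funext => x; rewrite /rem mulmxBl.
      by move: (x *m L) (x0 *m L) => u v; rewrite !mxE; ring.
    apply: Ck_onD; [exact: oA|exact: Cpsi|].
    apply: Ck_onD; [exact: oA|exact: Ck_on_cst|].
    apply: Ck_onM; [exact: oA|exact: Ck_on_cst|].
    apply: Ck_onD; [exact: oA| |exact: Ck_on_cst].
    exact: Ck_on_sub (Ck_on_mulmx 2 L a).
  apply: (Ck_on_ext oC _ (Ck_on_cst 2 C (0 : R))) => x; rewrite inE => Cx.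
  by rewrite /rho chi0 ?mul0r// ltW.
pose Phi (z : V) : 'rV[R]_D :=
  psi x0 + (z.2 - x0) *m L + z.1 *: (chi z.2 *: rem z.2).
have CPhi a : Ck_on 2 setT (fun z : V => Phi z 0 a).
  have -> : (fun z : V => Phi z 0 a) = (fun z : V => psi x0 0 a +
     (\sum_i z.2 0 i * L i a + - (x0 *m L) 0 a) + z.1 * (rho a \o snd) z).
    apply/funext => z; have E1 : \sum_i z.2 0 i * L i a = (z.2 *m L) 0 a by rewrite mxE.
    rewrite E1 /Phi /= /rho mulmxBl.
    by move: (rem z.2) (z.2 *m L) (x0 *m L) => p u v; rewrite !mxE; ring.
  apply: Ck_onD; [exact: openT| |].
    apply: Ck_onD; [exact: openT|exact: Ck_on_cst|].
    apply: Ck_onD; [exact: openT| |exact: Ck_on_cst].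
    apply: Ck_on_sum => [|i _]; first exact: openT.
    by apply: Ck_onM; [exact: openT|exact: Ck_on_snd|exact: Ck_on_cst].
  apply: Ck_onM; [exact: openT|exact: Ck_on_fst|].
  exact: (@Ck_on_comp _ _ 2 D setT setT (rho a) snd openT openT (fun _ _ => I)
    (Crho a) (fun a => Ck_on_snd 2 a)).
have PhiE s x : Phi (s, x) - psi x0 = (x - x0) *m L + (s * chi x) *: rem x.
  by rewrite /Phi /= scalerA -!addrA addrC addrA subrK.
have chirem s x : 0 <= s <= 1 -> `|(s * chi x) *: rem x| <= c / 2 * `|x - x0|.
  move=> /andP[s0 s1]; have [xd|xd] := leP (2 * dl) `|x - x0|.
    by rewrite chi0// mulr0 scale0r normr0 !mulr_ge0// ?invr_ge0// ltW.
  have [_ Hrem] := He x (lt_trans xd dle).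
  rewrite normrZ; apply: le_trans Hrem; rewrite ler_piMl//.
  rewrite normrM (ger0_norm s0) ger0_norm ?cutoff_ge0//.
  by rewrite mulr_ile1// ?cutoff_ge0// cutoff_le1.
have Phi_far s x : 0 <= s <= 1 -> c / 2 * `|x - x0| <= `|Phi (s, x) - psi x0|.
  move=> s01; rewrite PhiE.
  have H1 := lerB_normD ((x - x0) *m L) ((s * chi x) *: rem x).
  have H2 := Hc (x - x0); have H3 := chirem s x s01.
  by apply: le_trans H1; lra.
(* At distance at least [dl] from [x0], the bound [c / 2 * dl] makes [f \o Phi_s] vanish and the
   bound [dl] makes [g] vanish; at smaller distance [chi] is 1 and [Phi_1] is [psi]. *)
pose r := Num.min dl (c / 2 * dl).
have r0 : 0 < r by rewrite lt_min dl0 mulr_gt0// divr_gt0.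
exists r => // f g Cf fr gr gA.
have fPhi0 s x : 0 <= s <= 1 -> dl <= `|x - x0| -> f (Phi (s, x)) = 0.
  move=> s01 xd; apply/eqP; apply: contraT => /fr.
  rewrite ltNge (le_trans _ (Phi_far s x s01))//.
  rewrite ge_min ler_pM2l ?divr_gt0// xd orbT//.
have K0 : 0 < `|x0| + dl by rewrite ltr_wpDl.
have fPhiK : supported_path (`|x0| + dl) (f \o Phi).
  move=> s x s01 Kx; apply: fPhi0 => //.
  by have := lerB_dist x x0; apply: le_trans; rewrite lerBrDl.
have Kf : compactly_supported f.
  exists (`|psi x0| + r); first by rewrite ltr_wpDl.
  move=> y yK; apply/eqP; apply: contraT => /fr; rewrite ltNge.
  by have := lerB_dist y (psi x0); move/(le_trans _) => -> //; rewrite lerBrDl.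
apply: sum_equiv_trans (sum_equiv_affine (psi x0) x0 Cf Kf detL).
have := lattice_sum_homotopy K0 CPhi Cf fPhiK.
have E0 : (fun x => f (Phi (0, x)) * \det (partial_mx (fun y => Phi (0, y)) x)) =
    (fun x => f (psi x0 + (x - x0) *m L) * \det L).
  have EM : (fun y => Phi (0, y)) = (fun y => psi x0 + (y - x0) *m L).
    by apply/funext => y; rewrite /Phi scale0r addr0.
  apply/funext => x; have PhiE0 := congr1 (fun h => h x) EM.
  by rewrite EM partial_mx_affine [Phi (0, x)]PhiE0.
have E1 : (fun x => f (Phi (1, x)) * \det (partial_mx (fun y => Phi (1, y)) x)) = g.
  apply/funext => x.
  have [xd|xd] := leP dl `|x - x0|.
    rewrite fPhi0 ?ler01 ?lexx// mul0r; apply/esym/eqP; apply: contraT => /gr.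
    by rewrite ltNge ge_min xd.
  have Phi1 y : `|y - x0| < dl -> Phi (1, y) = psi y.
    move=> yd; rewrite -[LHS](subrK (psi x0)) PhiE chi1 ?ltW// mul1r scale1r.
    by rewrite /rem; move: (_ *m L) => u; rewrite [u + _]addrC !subrK.
  rewrite gA; last by apply: (He x _).1; apply: lt_trans dle; lra.
  rewrite Phi1//; congr (_ * \det _); apply/matrixP => i j; rewrite !mxE.
  apply: near_eq_derive.
  have : \forall y \near x, `|y - x0| < dl.
    have xb : ball x0 dl x by rewrite -ball_normE /ball_ /= distrC.
    have := open_nbhs_nbhs (conj (ball_open x0 dl) xb).
    by apply: filterS => y; rewrite -ball_normE /ball_ /= distrC.
  by apply: filterS => y /Phi1 ->.
by have -> := congr2 sum_equiv E1 E0.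
Qed.

End LocalChange.

(** * Charts and partitions of unity *)

Section ZeroExtension.
Context {R : realType} {V : normedModType R}.

Definition zero_ext (U : set V) (f : V -> R) (x : V) : R := if `[< U x >] then f x else 0.

Lemma zero_extE (U : set V) f x : U x -> zero_ext U f x = f x.
Proof. by rewrite /zero_ext; case: asboolP. Qed.

Lemma zero_ext_out (U : set V) f x : ~ U x -> zero_ext U f x = 0.
Proof. by rewrite /zero_ext; case: asboolP. Qed.

(** The open sets [U] and the complement of [C] cover the space, and the extension is zero on the
    latter. *)
Lemma Ck_on_zero_ext k (U C : set V) (f : V -> R) : open U -> closed C ->
  C `<=` U -> (forall x, U x -> ~ C x -> f x = 0) -> Ck_on k U f ->
  Ck_on k setT (zero_ext U f).
Proof.
move=> oU cC CU f0 Cf; have oC := closed_openC cC.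
have -> : setT = U `|` ~` C.
  apply/seteqP; split => // x _; have [/CU|] := pselect (C x); first by left.
  by right.
apply: Ck_on_setU.
  by apply: (Ck_on_ext oU _ Cf) => x; rewrite inE => Ux; rewrite zero_extE.
apply: (Ck_on_ext oC _ (Ck_on_cst k (~` C) (0 : R))) => x; rewrite inE => nCx.
by rewrite /zero_ext; case: asboolP => // Ux; rewrite f0.
Qed.

End ZeroExtension.

(** Near-covering compactness, applied to the filter generated by the sets of all sequences that
    contain a given one. *)
Lemma finite_subcover (T : topologicalType) (K : set T) (O : T -> set T) :
  compact K -> (forall p, K p -> nbhs p (O p)) ->
  exists s : seq T, forall q, K q -> exists2 p, p \in s & O p q.
Proof.
move=> /compact_near_coveringP cK KO.
pose F : set_system (seq T) := [set P | exists s0 : seq T, forall s : seq T,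
  {subset s0 <= s} -> P s].
have FF : Filter F.
  split.
  - by exists [::].
  - move=> P Q [s1 Ps] [s2 Qs]; exists (s1 ++ s2) => s ss; split.
      by apply: Ps => p ps; apply: ss; rewrite mem_cat ps.
    by apply: Qs => p ps; apply: ss; rewrite mem_cat ps orbT.
  - by move=> P Q PQ [s0 Ps]; exists s0 => s /Ps/PQ.
have [|s0 H] := cK _ F (fun s q => exists2 p, p \in s & O p q).
  move=> p Kp; exists (O p, [set s : seq T | p \in s]) => /=.
    split; first exact: KO.
    by exists [:: p] => s; apply; rewrite mem_head.
  by move=> [q s] /= [Oq ps]; exists p.
by exists s0 => q; exact: H.
Qed.

Section Charts.
Context {R : realType} {d : nat} {N : oriented_manifold R d}.
Implicit Types (i j : chart_index N) (p q : N).

Definition cimg i : set 'rV[R]_d := cmap (atlas i) @` cdom (atlas i).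

Lemma open_cimg i : open (cimg i). Proof. exact: cimg_open. Qed.

Lemma cimgP i p : cdom (atlas i) p -> cimg i (cmap (atlas i) p).
Proof. by exists p. Qed.

Lemma cinv_cdom i x : cimg i x -> cdom (atlas i) (cinv (atlas i) x).
Proof. by move=> [p pi <-]; rewrite cmapK. Qed.

Lemma cinvK i x : cimg i x -> cmap (atlas i) (cinv (atlas i) x) = x.
Proof. by move=> [p pi <-]; rewrite cmapK. Qed.

Lemma open_cimgI i (O : set N) : open O -> open (cimg i `&` cinv (atlas i) @^-1` O).
Proof.
move=> oO; have := @cinv_continuous _ _ _ (atlas i).
rewrite continuous_open_subspace; last exact: open_cimg.
by move/(continuous_inP _ (@open_cimg i))/(_ O oO).
Qed.

Lemma open_cdomI i (O : set 'rV[R]_d) : open O ->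
  open (cdom (atlas i) `&` cmap (atlas i) @^-1` O).
Proof.
move=> oO; have := @cmap_continuous _ _ _ (atlas i).
rewrite continuous_open_subspace; last exact: cdom_open.
by move/(continuous_inP _ (cdom_open (atlas i)))/(_ O oO).
Qed.

Lemma open_cimg_cdom i j : open (cmap (atlas i) @` (cdom (atlas i) `&` cdom (atlas j))).
Proof.
have := @open_cimgI i _ (cdom_open (atlas j)); congr open; apply/seteqP; split => x.
  by move=> [xi xj]; exists (cinv (atlas i) x); [split => //; exact: cinv_cdom|exact: cinvK].
by move=> [p [pi pj] <-]; split; [exact: cimgP|rewrite /= cmapK].
Qed.

Lemma cmap_compact i (S : set N) : compact S -> S `<=` cdom (atlas i) ->
  compact (cmap (atlas i) @` S).
Proof.
move=> cS Si; apply: continuous_compact => //.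
exact: continuous_subspaceW (@cmap_continuous _ _ _ (atlas i)).
Qed.

Lemma cinv_compact i (K : set 'rV[R]_d) : compact K -> K `<=` cimg i ->
  compact (cinv (atlas i) @` K).
Proof.
move=> cK Ki; apply: continuous_compact => //.
exact: continuous_subspaceW (@cinv_continuous _ _ _ (atlas i)).
Qed.

Definition Ck_manifold (k : nat) (f : N -> R) :=
  forall i, Ck_on k (cimg i) (f \o cinv (atlas i)).

Lemma Ck_on_transition k i j (a : 'I_d) :
  Ck_on k (cmap (atlas i) @` (cdom (atlas i) `&` cdom (atlas j)))
    (fun x => (cmap (atlas j) \o cinv (atlas i)) x 0 a).
Proof. exact: (Ck_on_component a (@open_cimg_cdom i j) (atlas_smooth i j k)). Qed.

(** [S] is some compact set outside which [f] vanishes, carried as data in place of the closed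
    support. *)
Record partition_function (W S : set N) (f : N -> R) := PartitionFunction {
  pf_C2 : Ck_manifold 2 f ;
  pf_ge0 : forall q, 0 <= f q ;
  pf_compact : compact S ;
  pf_sub : S `<=` W ;
  pf_supp : forall q, ~ S q -> f q = 0 }.

Lemma exists_bump (W : set N) (p : N) : open W -> W p ->
  exists f S, partition_function W S f /\ \forall q \near p, 0 < f q.
Proof.
move=> oW Wp; have [i pi] := atlas_cover p.
pose x0 := cmap (atlas i) p.
have oWi := @open_cimgI i _ oW.
have : (cimg i `&` cinv (atlas i) @^-1` W) x0.
  by split; [exact: cimgP|rewrite /x0 /= cmapK].
move=> /(conj oWi)/open_nbhs_nbhs/nbhs_ballP[r /= r0 rW].
pose r2 := r / 2; have r20 : 0 < r2 by rewrite divr_gt0.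
have r2r : r2 < r by rewrite ltr_pdivrMr// ltr_pMr// ltr1n.
pose K := [set x : 'rV[R]_d | `|x - x0| <= r2].
have KW : K `<=` cimg i `&` cinv (atlas i) @^-1` W.
  move=> x Kx; apply: rW; rewrite -ball_normE /ball_ /= distrC.
  exact: le_lt_trans r2r.
have cK : compact K.
  have -> : K = (fun x => x0 + x) @` [set x : 'rV[R]_d | `|x| <= r2].
    apply/seteqP; split => x /=; first by move=> Kx; exists (x - x0); rewrite // addrC subrK.
    by move=> [y Ky <-]; rewrite /K /= addrAC subrr add0r.
  apply: continuous_compact; last exact: closed_ball_compact.
  apply: continuous_subspaceT => x.
  apply: continuous_components => a.
  have E : (fun x : 'rV[R]_d => (x0 + x) 0 a) = (fun x => x0 0 a + x 0 a).
    by apply/funext => y; rewrite !mxE.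
  have C0 : Ck_on 0 setT (fun x : 'rV[R]_d => x0 0 a + x 0 a).
    by apply: Ck_onD; [exact: openT|exact: Ck_on_cst|exact: Ck_on_coord].
  by rewrite E; exact: (C0 x I).
pose beta x := bump_fun 2 (r2^-1 *: (x - x0)).
have Cbeta : Ck_on 2 setT beta.
  apply: (@Ck_on_comp _ _ 2 d setT setT (bump_fun 2) (fun x => r2^-1 *: (x - x0))
    openT openT (fun _ _ => I) (Ck_on_bump 2)) => a.
  under eq_fun do rewrite !mxE.
  apply: Ck_onM; [exact: openT|exact: Ck_on_cst|].
  by apply: Ck_onD; [exact: openT|exact: Ck_on_coord|exact: Ck_on_cst].
have beta0 x : r2 <= `|x - x0| -> beta x = 0.
  move=> xr; apply: bump_eq0; rewrite normrZ gtr0_norm ?invr_gt0//.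
  by rewrite mulrC ler_pdivlMr// mul1r.
have beta_gt0 x : `|x - x0| < r2 -> 0 < beta x.
  move=> xr; apply: bump_gt0; rewrite normrZ gtr0_norm ?invr_gt0//.
  by rewrite mulrC ltr_pdivrMr// mul1r.
pose S := cinv (atlas i) @` K.
have cS : compact S by apply: cinv_compact => // x /KW[].
have Sdom : S `<=` cdom (atlas i) by move=> _ [x /KW[xi _] <-]; exact: cinv_cdom.
pose f q := if `[< cdom (atlas i) q >] then beta (cmap (atlas i) q) else 0.
have fS q : ~ S q -> f q = 0.
  move=> nSq; rewrite /f; case: asboolP => // qi; apply: beta0.
  rewrite leNgt; apply/negP => qK; apply: nSq; exists (cmap (atlas i) q).
    exact: ltW.
  exact: cmapK.
exists f, S; split; first split => //.
- move=> j.
  have clS : closed S by apply: compact_closed => //; exact: carrier_hausdorff.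
  have oT := @open_cimg_cdom j i; have oS := @open_cimgI j _ (closed_openC clS).
  (* In any chart [j], [f] is a bump composed with the transition map on the overlap with the chart
     [i], and 0 off [S]. The latter region is open because the compact set [S] is closed in a
     Hausdorff space. *)
  have -> : cimg j = cmap (atlas j) @` (cdom (atlas j) `&` cdom (atlas i)) `|`
      (cimg j `&` cinv (atlas j) @^-1` (~` S)).
    apply/seteqP; split => x; last first.
      by move=> [[q [qj _] <-]|[]//]; exact: cimgP.
    move=> xj; have [xi|nxi] := pselect (cdom (atlas i) (cinv (atlas j) x)).
      left; exists (cinv (atlas j) x); last exact: cinvK.
      by split => //; exact: cinv_cdom.
    by right; split => // /Sdom.
  apply: Ck_on_setU.
    have := @Ck_on_comp _ _ 2 d _ setT beta (cmap (atlas i) \o cinv (atlas j))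
      oT openT (fun _ _ => I) Cbeta (Ck_on_transition 2 j i).
    apply: Ck_on_ext => // x; rewrite inE => -[q [qj qi] <-].
    by rewrite /= /f cmapK//; case: asboolP.
  apply: (Ck_on_ext oS _ (Ck_on_cst 2 _ (0 : R))) => x; rewrite inE => -[xj nS].
  by rewrite /= fS.
- by move=> q; rewrite /f; case: asboolP => // _; exact: bump_ge0.
- by move=> _ [x /KW[_ xW] <-].
- have oB : open [set x : 'rV[R]_d | `|x - x0| < r2].
    have -> : [set x : 'rV[R]_d | `|x - x0| < r2] = ball x0 r2.
      by apply/seteqP; split => x; rewrite -ball_normE /ball_ /= distrC.
    exact: ball_open.
  have : (cdom (atlas i) `&` cmap (atlas i) @^-1` [set x | `|x - x0| < r2]) p.
    by split => //=; rewrite subrr normr0.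
  move=> /(conj (@open_cdomI i _ oB))/open_nbhs_nbhs; apply: filterS => q [qi qr].
  by rewrite /f; case: asboolP => // _; exact: beta_gt0.
Qed.

(** Each point has its own bump; finitely many of them, indexed by [s], are positive somewhere at
    every point, and all bumps are divided by the sum over [s]. *)
Lemma partition_of_unity (W : N -> set N) : compact [set: N] ->
  (forall p, open (W p)) -> (forall p, W p p) ->
  exists (s : seq N) (f : N -> N -> R) (S : N -> set N),
    (forall p, partition_function (W p) (S p) (f p)) /\
    (forall q, \sum_(p <- s) f p q = 1).
Proof.
move=> cN oW Wp.
have /choice[fS fSP] : forall p, exists fS : (N -> R) * set N,
    partition_function (W p) fS.2 fS.1 /\ \forall q \near p, 0 < fS.1 q.
  by move=> p; have [f [S HfS]] := exists_bump (oW p) (Wp p); exists (f, S).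
pose b p := (fS p).1; pose S p := (fS p).2.
have bP p : partition_function (W p) (S p) (b p) by have [] := fSP p.
pose O p := [set q | 0 < b p q].
have [|s scov] := finite_subcover (O := O) cN.
  by move=> q _; have [] := fSP q.
pose B q := \sum_(p <- s) b p q.
have B0 q : 0 < B q.
  have [p pD Oq] := scov q I.
  rewrite /B (big_rem p)//=; apply: ltr_pwDl; first exact: Oq.
  by apply: sumr_ge0 => p' _; exact: (pf_ge0 (bP p')).
exists s, (fun p q => b p q * (B q)^-1), S; split => [p|q]; last first.
  by rewrite -mulr_suml -/(B q) divff ?gt_eqF ?B0.
have CB : Ck_manifold 2 B.
  move=> i; rewrite /B; apply: (Ck_on_sum _ (P := predT) (@open_cimg i)) => p' _.
  exact: (pf_C2 (bP p')).
split.
- move=> i; apply: (Ck_onM (@open_cimg i)); first exact: (pf_C2 (bP p)).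
  apply: (@Ck_onV _ _ _ _ (B \o cinv (atlas i)) (@open_cimg i)); last exact: CB.
  by move=> x _; rewrite gt_eqF ?B0.
- by move=> q; rewrite divr_ge0 ?(ltW (B0 q))// (pf_ge0 (bP p)).
- exact: (pf_compact (bP p)).
- exact: (pf_sub (bP p)).
- by move=> q /(pf_supp (bP p)) ->; rewrite mul0r.
Qed.

End Charts.

Section Transitions.
Context {R : realType} {d : nat} {N : oriented_manifold R d.+1}.
Implicit Types (i j : chart_index N) (p q : N).

Definition transition i j : 'rV[R]_d.+1 -> 'rV[R]_d.+1 :=
  cmap (atlas j) \o cinv (atlas i).

Lemma transitionE i j q : cdom (atlas i) q ->
  transition i j (cmap (atlas i) q) = cmap (atlas j) q.
Proof. by move=> qi; rewrite /transition /= cmapK. Qed.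

Lemma differentiable_transition i j q : cdom (atlas i) q -> cdom (atlas j) q ->
  differentiable (transition i j) (cmap (atlas i) q).
Proof.
move=> qi qj; apply: (atlas_smooth i j 1%N).1.
by exists q.
Qed.

(** The local change of variables for a transition map, with both smallness conditions expressed by
    one neighbourhood [W] of [q] in the manifold. The orientation of the atlas supplies the positive
    Jacobian determinant. *)
Lemma sum_equiv_charts i j q : cdom (atlas i) q -> cdom (atlas j) q ->
  exists W : set N, [/\ open W, W q & forall f g : 'rV[R]_d.+1 -> R,
    Ck_on 1 setT f ->
    (forall y, f y != 0 -> exists2 q', W q' & y = cmap (atlas j) q') ->
    (forall x, g x != 0 -> exists2 q', W q' & x = cmap (atlas i) q') ->
    (forall q', cdom (atlas i) q' -> cdom (atlas j) q' ->
      g (cmap (atlas i) q') =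
      f (cmap (atlas j) q') * \det ('J (transition i j) (cmap (atlas i) q'))) ->
    sum_equiv g f].
Proof.
move=> qi qj; pose x0 := cmap (atlas i) q.
pose A := cmap (atlas i) @` (cdom (atlas i) `&` cdom (atlas j)).
have Ax0 : A x0 by exists q.
have [|r r0 Hr] := sum_equiv_local (@open_cimg_cdom _ _ _ i j) Ax0
  (fun a => Ck_on_transition (N := N) 2 i j a).
  have := atlas_oriented qi qj.
  by rewrite -/(transition i j) (jacobianE (differentiable_transition qi qj)).
pose W := (cdom (atlas i) `&` cmap (atlas i) @^-1` (ball x0 r)) `&`
  (cdom (atlas j) `&` cmap (atlas j) @^-1` (ball (transition i j x0) r)).
exists W; split.
- by apply: openI; apply: open_cdomI; exact: ball_open.
- by split; split => //=; rewrite ?transitionE//; exact: ballxx.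
move=> f g Cf fW gW fg; apply: Hr => //.
- by move=> y /fW[q' [_ [_ +]] ->]; rewrite /= -ball_normE /ball_ /= distrC.
- by move=> x /gW[q' [[_ +] _] ->]; rewrite /= -ball_normE /ball_ /= distrC.
- move=> _ [q' [q'i q'j] <-]; rewrite fg// -/(transition i j) transitionE//.
  by rewrite (jacobianE (differentiable_transition q'i q'j)).
Qed.

Lemma derive_chart (rho : N -> R) i j q a : Ck_manifold 2 rho ->
  cdom (atlas i) q -> cdom (atlas j) q ->
  'D_(delta_mx 0 a) (rho \o cinv (atlas i)) (cmap (atlas i) q) =
  \sum_b 'J (transition i j) (cmap (atlas i) q) a b *
    'D_(delta_mx 0 b) (rho \o cinv (atlas j)) (cmap (atlas j) q).
Proof.
move=> Crho qi qj; set x := cmap (atlas i) q.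
have Ax : (cmap (atlas i) @` (cdom (atlas i) `&` cdom (atlas j))) x by exists q.
have E : \near x, ((rho \o cinv (atlas j)) \o transition i j) x = (rho \o cinv (atlas i)) x.
  apply: filterS (open_nbhs_nbhs (conj (@open_cimg_cdom _ _ _ i j) Ax)).
  by move=> _ [q' [q'i q'j] <-] /=; rewrite !cmapK.
have dt := differentiable_transition qi qj.
have drho : differentiable (rho \o cinv (atlas j)) (transition i j x).
  by rewrite transitionE//; exact: ((Crho j).1 _ (cimgP qj)).
rewrite -(near_eq_derive _ E) (derive_comp_rV _ drho dt); apply: eq_bigr => b _.
by rewrite (jacobianE dt) mxE transitionE.
Qed.

Lemma derive_off_support (rho : N -> R) (S : set N) i q a : compact S ->
  (forall q, ~ S q -> rho q = 0) -> cdom (atlas i) q -> ~ S q ->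
  'D_(delta_mx 0 a) (rho \o cinv (atlas i)) (cmap (atlas i) q) = 0.
Proof.
move=> cS rho0 qi nSq.
have clS : closed S by apply: compact_closed => //; exact: carrier_hausdorff.
pose x := cmap (atlas i) q.
have E : \near x, cst (0 : R) x = (rho \o cinv (atlas i)) x.
  have : (cimg i `&` cinv (atlas i) @^-1` (~` S)) x.
    by split; [exact: cimgP|rewrite /x /= cmapK].
  move=> /(conj (@open_cimgI _ _ _ i _ (closed_openC clS)))/open_nbhs_nbhs.
  by apply: filterS => y [_ nSy]; rewrite /= rho0.
by rewrite -(near_eq_derive _ E) derive_cst.
Qed.

End Transitions.

Section Divergence.
Context {R : realType} {d : nat}.
Let V : normedModType R := (R * 'rV[R]_d.+1)%type.

Lemma lattice_sum_derive (f : 'rV[R]_d.+1 -> R) (a : 'I_d.+1) :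
  Ck_on 1 setT f -> compactly_supported f ->
  lattice_sum ^~ (fun x => 'D_(delta_mx 0 a) f x) @ \oo --> (0 : R).
Proof.
move=> Cf [K K0 fK]; pose G (z : V) := f z.2.
have CG : Ck_on 1 setT G.
  exact: (@Ck_on_comp _ _ 1 d.+1 setT setT f snd openT openT (fun _ _ => I) Cf
    (fun a => Ck_on_snd 1 a)).
have GK : supported_path K G by move=> s x _; exact: fK.
apply/cvgrPdist_le => e e0.
have := lattice_sum_derive_uniform a K0 e0 CG GK.
apply: filterS => n /(_ 0); rewrite lexx ler01 => /(_ isT).
under eq_fun do rewrite derive_slice.
by rewrite sub0r normrN.
Qed.

End Divergence.

(** * The divergence theorem on a closed manifold *)

Lemma cvg_sum0 (R : realType) (I : Type) (r : seq I) (f : I -> nat -> R) :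
  (forall i, f i @ \oo --> (0 : R)) -> (fun n => \sum_(i <- r) f i n) @ \oo --> (0 : R).
Proof.
move=> f0; elim: r => [|i r IH].
  by under eq_fun do rewrite big_nil; exact: cvg_cst.
under eq_fun do rewrite big_cons.
by have H := cvgD (f0 i) IH; rewrite addr0 in H; exact: H.
Qed.

Section Stokes.
Context {R : realType} {d : nat} {N : oriented_manifold R d.+1}.
Variable X : chart_index N -> 'rV[R]_d.+1 -> 'I_d.+1 -> R.
Hypothesis N_compact : compact [set: N].
Hypothesis CX : forall i a, Ck_on 1 (cimg i) (fun x => X i x a).
(* X is a vector density, i.e. a form of degree one less than the dimension. *)
Hypothesis X_density : forall i j q, cdom (atlas i) q -> cdom (atlas j) q ->
  forall u : 'I_d.+1 -> R,
  \sum_a (\sum_b 'J (transition i j) (cmap (atlas i) q) a b * u b) *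
    X i (cmap (atlas i) q) a =
  \det ('J (transition i j) (cmap (atlas i) q)) *
    \sum_b u b * X j (cmap (atlas j) q) b.

Definition divergence i (x : 'rV[R]_d.+1) : R :=
  \sum_a 'D_(delta_mx 0 a) (fun y => X i y a) x.

Hypothesis divergence_ge0 : forall i q, cdom (atlas i) q ->
  0 <= divergence i (cmap (atlas i) q).

Let local_fun (rho : N -> R) i (x : 'rV[R]_d.+1) := rho (cinv (atlas i) x).

Let contraction (rho : N -> R) i (x : 'rV[R]_d.+1) : R :=
  \sum_a 'D_(delta_mx 0 a) (local_fun rho i) x * X i x a.

Let Ck_contraction rho i : Ck_manifold 2 rho -> Ck_on 1 (cimg i) (contraction rho i).
Proof.
move=> Crho; apply: Ck_on_sum => [|a _]; first exact: open_cimg.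
apply: Ck_onM; [exact: open_cimg| |exact: CX].
by apply: Ck_on_derive; [exact: open_cimg|exact: (Crho i)].
Qed.

Let supp_contraction rho S i x : compact S -> (forall q, ~ S q -> rho q = 0) ->
  cimg i x -> contraction rho i x != 0 -> S (cinv (atlas i) x).
Proof.
move=> cS rho0 [q qi <-]; rewrite cmapK// => c0; apply: contrapT => nSq.
move/eqP: c0; apply; apply: big1 => a _.
by rewrite [X in X * _](derive_off_support _ cS rho0 qi nSq) mul0r.
Qed.

Let contraction_density rho i j q : Ck_manifold 2 rho ->
  cdom (atlas i) q -> cdom (atlas j) q ->
  contraction rho i (cmap (atlas i) q) =
  contraction rho j (cmap (atlas j) q) *
    \det ('J (transition i j) (cmap (atlas i) q)).
Proof.
move=> Crho qi qj; rewrite mulrC -X_density//; apply: eq_bigr => a _.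
by rewrite [X in X * _](derive_chart _ Crho qi qj).
Qed.

Let closed_image i (S : set N) : compact S -> S `<=` cdom (atlas i) ->
  closed (cmap (atlas i) @` S).
Proof.
move=> cS Si; apply: compact_closed; last exact: cmap_compact.
exact: norm_hausdorff.
Qed.

Let bounded_image i (S : set N) (f : 'rV[R]_d.+1 -> R) : compact S ->
  S `<=` cdom (atlas i) ->
  (forall x, f x != 0 -> exists2 q, S q & x = cmap (atlas i) q) ->
  compactly_supported f.
Proof.
move=> cS Si fS; have /compact_bounded[M [Mreal HM]] := cmap_compact cS Si.
exists (`|M| + 2); first by rewrite ltr_wpDl.
move=> x xM; apply/eqP; apply: contraT => /fS[q Sq xq].
have := HM (`|M| + 1) _ x; rewrite (le_lt_trans (ler_norm M)) ?ltrDl// => /(_ isT).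
move=> H; have : `|x| <= `|M| + 1 by apply: H; exists q.
by move=> H2; exfalso; have := le_trans xM H2; lra.
Qed.

Let zero_ext_smooth k i (S : set N) (f : 'rV[R]_d.+1 -> R) : compact S ->
  S `<=` cdom (atlas i) -> (forall q, cdom (atlas i) q -> ~ S q ->
    f (cmap (atlas i) q) = 0) ->
  Ck_on k (cimg i) f -> Ck_on k setT (zero_ext (cimg i) f).
Proof.
move=> cS Si f0; apply: Ck_on_zero_ext; first exact: open_cimg.
- exact: (closed_image cS Si).
- by move=> _ [q Sq <-]; exact/cimgP/Si.
- move=> _ [q qi <-] nS; apply: f0 => // Sq; apply: nS; by exists q.
Qed.

Let zero_ext_supp i (S : set N) (f : 'rV[R]_d.+1 -> R) :
  (forall q, cdom (atlas i) q -> ~ S q -> f (cmap (atlas i) q) = 0) ->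
  forall x, zero_ext (cimg i) f x != 0 -> exists2 q, S q & x = cmap (atlas i) q.
Proof.
move=> f0 x; rewrite /zero_ext; case: asboolP => [[q qi <-] fq|]; last by rewrite eqxx.
exists q => //; apply: contrapT => nS; by rewrite f0 ?eqxx in fq.
Qed.

Let weighted (rho : N -> R) i := zero_ext (cimg i)
  (fun x => local_fun rho i x * divergence i x).

Let flux (rho : N -> R) i := zero_ext (cimg i) (contraction rho i).

(** By the product rule the two functions add up to the divergence of [rho] times [X], which is
    compactly supported in the chart [i]. *)
Let weighted_flux rho W S i : partition_function W S rho -> W `<=` cdom (atlas i) ->
  (fun n => lattice_sum n (weighted rho i) + lattice_sum n (flux rho i)) @ \oo
    --> (0 : R).
Proof.
move=> [Crho _ cS SW rho0] Wi; have Si : S `<=` cdom (atlas i) by move=> q /SW/Wi.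
pose F a := zero_ext (cimg i) (fun x => local_fun rho i x * X i x a).
have F0 a q : cdom (atlas i) q -> ~ S q ->
    local_fun rho i (cmap (atlas i) q) * X i (cmap (atlas i) q) a = 0.
  by move=> qi nS; rewrite /local_fun cmapK// rho0// mul0r.
have Crho1 : Ck_on 1 (cimg i) (local_fun rho i) by exact: Ck_onW (Crho i).
have CF a : Ck_on 1 setT (F a).
  apply: (zero_ext_smooth cS Si); first exact: F0.
  by apply: Ck_onM; [exact: open_cimg|exact: Crho1|exact: CX].
have KF a : compactly_supported (F a).
  by apply: (bounded_image cS Si); apply: zero_ext_supp; exact: F0.
have E x : weighted rho i x + flux rho i x = \sum_a 'D_(delta_mx 0 a) (F a) x.
  have [xi|nxi] := pselect (cimg i x); last first.
    rewrite /weighted /flux !zero_ext_out// addr0; apply/esym/big1 => a _.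
    have oC := closed_openC (closed_image cS Si).
    have nx : (~` (cmap (atlas i) @` S)) x.
      by move=> [q Sq qx]; apply: nxi; rewrite -qx; exact/cimgP/Si.
    have E0 : \near x, cst (0 : R) x = F a x.
      apply: filterS (open_nbhs_nbhs (conj oC nx)) => y ny.
      apply/esym/eqP; apply: contraT => /(zero_ext_supp (F0 a))[q Sq yq].
      by exfalso; apply: ny; exists q.
    by rewrite -(near_eq_derive _ E0) derive_cst.
  rewrite /weighted /flux !zero_extE// /divergence mulr_sumr -big_split /=.
  apply: eq_bigr => a _.
  have E1 : \near x, (fun y => local_fun rho i y * X i y a) x = F a x.
    apply: filterS (open_nbhs_nbhs (conj (@open_cimg _ _ _ i) xi)) => y yi.
    by rewrite /F zero_extE.
  rewrite -(near_eq_derive _ E1).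
  rewrite (@deriveM _ _ (local_fun rho i) (fun y => X i y a)).
  - by congr (_ + _); rewrite mulrC.
  - exact/diff_derivable/(Crho1.1 x xi).
  - exact/diff_derivable/((CX i a).1 x xi).
have -> : (fun n => lattice_sum n (weighted rho i) + lattice_sum n (flux rho i)) =
    (fun n => \sum_a lattice_sum n (fun x => 'D_(delta_mx 0 a) (F a) x)).
  apply/funext => n; rewrite -lattice_sumD -lattice_sum_sum.
  by congr lattice_sum; apply/funext => x; exact: E.
by apply: cvg_sum0 => a; exact: lattice_sum_derive.
Qed.

Let restricted (theta rho : N -> R) i :=
  zero_ext (cimg i) (fun x => local_fun theta i x * contraction rho i x).

Let Ck_restricted theta W S rho j : partition_function W S theta ->
  W `<=` cdom (atlas j) -> Ck_manifold 2 rho -> Ck_on 1 setT (restricted theta rho j).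
Proof.
move=> [Ctheta _ cS SW theta0] Wj Crho.
apply: (zero_ext_smooth cS) => [q /SW/Wj//|q qj nS|].
  by rewrite /local_fun cmapK// theta0// mul0r.
apply: Ck_onM; [exact: open_cimg| |exact: Ck_contraction].
exact: Ck_onW (Ctheta j).
Qed.

Let restricted_supp theta W S rho W' S' j x : partition_function W S theta ->
  partition_function W' S' rho -> restricted theta rho j x != 0 ->
  exists q, [/\ S q, S' q, cdom (atlas j) q & x = cmap (atlas j) q].
Proof.
move=> [_ _ cS _ theta0] [_ _ cS' _ rho0]; rewrite /restricted /zero_ext.
case: asboolP => [xj|]; last by rewrite eqxx.
rewrite mulf_eq0 negb_or => /andP[th0 c0]; exists (cinv (atlas j) x); split.
- by apply: contrapT => nS; move: th0; rewrite /local_fun theta0 ?eqxx.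
- exact: (supp_contraction cS' rho0 xj c0).
- exact: cinv_cdom.
- by rewrite cinvK.
Qed.

Let restricted_density theta rho i j q : Ck_manifold 2 rho ->
  cdom (atlas i) q -> cdom (atlas j) q ->
  restricted theta rho i (cmap (atlas i) q) =
  restricted theta rho j (cmap (atlas j) q) *
    \det ('J (transition i j) (cmap (atlas i) q)).
Proof.
move=> Crho qi qj; rewrite /restricted !zero_extE; [|exact: cimgP|exact: cimgP].
by rewrite (contraction_density Crho qi qj) /local_fun !cmapK// mulrA.
Qed.

(** If [q] is outside [S], a neighbourhood avoiding [S] makes both functions zero. Otherwise [q]
    lies in both charts and the change of variables applies. *)
Lemma sum_equiv_restricted (S : set N) i j q : closed S ->
  S `<=` cdom (atlas i) -> cdom (atlas j) q ->
  exists W : set N, [/\ open W, W q & forall theta V T rho V',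
    partition_function V T theta -> V `<=` W -> V `<=` cdom (atlas j) ->
    partition_function V' S rho ->
    sum_equiv (restricted theta rho i) (restricted theta rho j)].
Proof.
move=> clS Si qj; have [Sq|nSq] := pselect (S q); last first.
  exists (~` S); split => //; first exact: closed_openC.
  move=> theta V T rho V' ptheta VW _ prho.
  have Z k : restricted theta rho k = (fun=> 0).
    apply/funext => x; apply/eqP; apply: contraT => /(restricted_supp ptheta prho).
    by move=> [q' [Tq' Sq' _ _]]; case: (VW q' (pf_sub ptheta Tq') Sq').
  by rewrite !Z; exact: sum_equiv_refl.
have [W [oW Wq HW]] := sum_equiv_charts (Si q Sq) qj.
exists W; split => // theta V T rho V' ptheta VW Vj prho; apply: HW.
- exact: (Ck_restricted ptheta Vj (pf_C2 prho)).
- move=> y /(restricted_supp ptheta prho)[q' [Tq' _ _ ->]].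
  by exists q' => //; exact/VW/(pf_sub ptheta).
- move=> x /(restricted_supp ptheta prho)[q' [Tq' _ _ ->]].
  by exists q' => //; exact/VW/(pf_sub ptheta).
- by move=> q' q'i q'j; exact: (restricted_density _ (pf_C2 prho)).
Qed.

(** The differentials of a partition of unity add up to the differential of the constant 1. *)
Let sum_contraction (s : seq N) (rho : N -> N -> R) i x :
  (forall p, Ck_manifold 2 (rho p)) -> (forall q, \sum_(p <- s) rho p q = 1) ->
  cimg i x -> \sum_(p <- s) contraction (rho p) i x = 0.
Proof.
move=> Crho rho1 xi; rewrite exchange_big /=; apply: big1 => a _.
rewrite -mulr_suml.
have D p : is_derive x (delta_mx 0 a) (local_fun (rho p) i)
    ('D_(delta_mx 0 a) (local_fun (rho p) i) x).
  by apply/derivableP/diff_derivable; exact: ((Crho p i).1 x xi).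
have := is_derive_bigsum s D.
have -> : (fun y => \sum_(p <- s) local_fun (rho p) i y) = cst 1.
  by apply/funext => y; rewrite /local_fun rho1.
by move=> /(@derive_val _ _ _ _ _ _ _) <-; rewrite derive_cst mul0r.
Qed.

Theorem divergence_eq0 i q : cdom (atlas i) q -> divergence i (cmap (atlas i) q) = 0.
Proof.
move: i q => i0 p0 p0i.
(* The chart assigned to p is the given one whenever it can be, and the
   neighbourhoods of the other points avoid p0: so p0 is only seen in i0. *)
have /choice[c cP] : forall p, exists i, cdom (atlas i) p /\ (cdom (atlas i0) p -> i = i0).
  move=> p; have [pi0|npi0] := pselect (cdom (atlas i0) p); first by exists i0.
  by have [i pi] := atlas_cover p; exists i.
have cdomc p : cdom (atlas (c p)) p by have [] := cP p.
pose W1 p : set N := cdom (atlas (c p)) `&` [set q | q = p0 -> cdom (atlas i0) p].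
have oW1 p : open (W1 p).
  rewrite /W1; have [pi0|npi0] := pselect (cdom (atlas i0) p).
    have -> : [set q | q = p0 -> cdom (atlas i0) p] = setT by apply/seteqP; split => // q _ _.
    by rewrite setIT; exact: cdom_open.
  have -> : [set q | q = p0 -> cdom (atlas i0) p] = ~` [set p0].
    by apply/seteqP; split => q /= H // => /H.
  apply: openI; first exact: cdom_open.
  by apply/closed_openC/accessible_closed_set1/hausdorff_accessible/carrier_hausdorff.
have W1p p : W1 p p by split => //= ->.
have [s [rho [S [Prho rho1]]]] := partition_of_unity N_compact oW1 W1p.
have W1c p : W1 p `<=` cdom (atlas (c p)) by move=> q [].
have Sc p : S p `<=` cdom (atlas (c p)) by move=> q /(pf_sub (Prho p))/W1c.
have clS p : closed (S p).
  by apply: compact_closed; [exact: carrier_hausdorff|exact: (pf_compact (Prho p))].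
have /choice[T HT] : forall pq : N * N, exists W : set N, [/\ open W, W pq.2 &
    forall theta V T' rho' V', partition_function V T' theta -> V `<=` W ->
    V `<=` cdom (atlas (c pq.2)) -> partition_function V' (S pq.1) rho' ->
    sum_equiv (restricted theta rho' (c pq.1)) (restricted theta rho' (c pq.2))].
  by move=> [p q]; exact: sum_equiv_restricted.
(* The first partition is finite, so one neighbourhood of [q] serves the change of variables from
   every chart [c p]. *)
pose W2 q : set N := cdom (atlas (c q)) `&` \big[setI/setT]_(p <- s) T (p, q).
have oW2 q : open (W2 q).
  apply: openI; first exact: cdom_open.
  elim/big_ind : _ => [|A B|p _]; [exact: openT|exact: openI|].
  by have [] := HT (p, q).
have W2q q : W2 q q.
  split => //; elim/big_ind : _ => // p _.
  by have [] := HT (p, q).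
have [s2 [theta [S2 [Ptheta theta1]]]] := partition_of_unity N_compact oW2 W2q.
have equiv p q : p \in s ->
    sum_equiv (restricted (theta q) (rho p) (c p)) (restricted (theta q) (rho p) (c q)).
  move=> ps; have [_ _ H] := HT (p, q).
  apply: (H (theta q) (W2 q) (S2 q) (rho p) (W1 p)).
  - exact: Ptheta.
  - by move=> q' [_]; rewrite -bigcap_seq; exact.
  - by move=> q' [].
  - exact: Prho.
(* [A] stands for the integral of the divergence over the manifold; all its terms are
   nonnegative. *)
pose A n := \sum_(p <- s) lattice_sum n (weighted (rho p) (c p)).
have fluxE n p : lattice_sum n (flux (rho p) (c p)) =
    \sum_(q <- s2) lattice_sum n (restricted (theta q) (rho p) (c p)).
  rewrite -lattice_sum_sum; congr lattice_sum; apply/funext => x.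
  rewrite /flux /restricted; have [xi|nxi] := pselect (cimg (c p) x); last first.
    by rewrite zero_ext_out// big1// => q _; rewrite zero_ext_out.
  rewrite zero_extE//; under eq_bigr do rewrite zero_extE//.
  by rewrite -mulr_suml /local_fun theta1 mul1r.
(* All the pieces around [q] are now summed over the same lattice, that of the chart [c q], so they
   cancel point by point. *)
have restr0 n q : \sum_(p <- s) lattice_sum n (restricted (theta q) (rho p) (c q)) = 0.
  rewrite -lattice_sum_sum /lattice_sum big1 ?mulr0// => k _.
  rewrite /restricted; move: (grid_point k) => x.
  have [xi|nxi] := pselect (cimg (c q) x); last first.
    by rewrite big1// => p _; rewrite zero_ext_out.
  under eq_bigr do rewrite zero_extE//.
  rewrite -mulr_sumr (sum_contraction _ rho1 xi) ?mulr0// => p.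
  exact: (pf_C2 (Prho p)).
have AE : A = (fun n => \sum_(p <- s) (lattice_sum n (weighted (rho p) (c p)) +
      lattice_sum n (flux (rho p) (c p))) -
    \sum_(p <- s) \sum_(q <- s2)
      (lattice_sum n (restricted (theta q) (rho p) (c p)) -
       lattice_sum n (restricted (theta q) (rho p) (c q)))).
  apply/funext => n; rewrite big_split /=.
  under [X in _ - X]eq_bigr do rewrite sumrB -fluxE.
  rewrite sumrB opprB [X in _ + (X - _)]exchange_big /=.
  by rewrite [X in _ + (X - _)]big1 ?sub0r ?addrK// => q _; exact: restr0.
have A0 : A @ \oo --> (0 : R).
  rewrite AE.
  have H1 : (fun n => \sum_(p <- s) (lattice_sum n (weighted (rho p) (c p)) +
      lattice_sum n (flux (rho p) (c p)))) @ \oo --> (0 : R).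
    by apply: cvg_sum0 => p; exact: (weighted_flux (Prho p) (@W1c p)).
  have H2 : (fun n => \sum_(p <- s) \sum_(q <- s2)
      (lattice_sum n (restricted (theta q) (rho p) (c p)) -
       lattice_sum n (restricted (theta q) (rho p) (c q)))) @ \oo --> (0 : R).
    (* [equiv] is available only for [p] in [s], whereas [cvg_sum0] asks for a limit at every index;
       the conditional supplies it. *)
    rewrite (_ : (fun n => _) = (fun n => \sum_(p <- s) if p \in s then \sum_(q <- s2)
      (lattice_sum n (restricted (theta q) (rho p) (c p)) -
       lattice_sum n (restricted (theta q) (rho p) (c q))) else 0)); last first.
      by apply/funext => n; apply: eq_big_seq => p ->.
    apply: cvg_sum0 => p; case ps: (p \in s); last exact: cvg_cst.
    by apply: cvg_sum0 => q; exact: equiv.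
  by have H := cvgB H1 H2; rewrite subrr in H; exact: H.
have weighted_ge0 p x : 0 <= weighted (rho p) (c p) x.
  rewrite /weighted /zero_ext; case: asboolP => // -[q qi <-].
  by rewrite mulr_ge0 ?divergence_ge0// (pf_ge0 (Prho p)).
have [p ps rp0] : exists2 p, p \in s & rho p p0 != 0.
  apply: contrapT => H; have := rho1 p0; rewrite big_seq big1 => [/eqP|p ps].
    by rewrite eq_sym oner_eq0.
  by apply/eqP; apply: contraT => rp; exfalso; apply: H; exists p.
have Sp0 : S p p0.
  by apply: contrapT => /(pf_supp (Prho p)) E; rewrite E eqxx in rp0.
have ci : c p = i0.
  have [_ /= H] := pf_sub (Prho p) Sp0; have [_] := cP p; apply.
  exact: H.
(* Nonnegativity of the other terms squeezes this one between 0 and [A]. *)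
have Ep : lattice_sum ^~ (weighted (rho p) (c p)) @ \oo --> (0 : R).
  apply: (@squeeze_cvgr _ _ _ _ (fun=> 0) A) => //; last 1 first.
  - exact: cvg_cst.
  apply: nearW => n; rewrite lattice_sum_ge0//= /A (big_rem p)//= lerDl.
  by apply: sumr_ge0 => p' _; exact: lattice_sum_ge0.
have Cw : Ck_on 0 setT (weighted (rho p) (c p)).
  apply: (zero_ext_smooth (pf_compact (Prho p)) (@Sc p)) => [q qi nS|].
    by rewrite /local_fun cmapK// (pf_supp (Prho p))// mul0r.
  apply: Ck_onM; [exact: open_cimg| |].
    exact: (Ck_on_le (leq0n 2) (pf_C2 (Prho p) (c p))).
  apply: Ck_on_sum => [|a _]; first exact: open_cimg.
  by apply: Ck_on_derive; [exact: open_cimg|exact: CX].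
have := lattice_sum_cvg0_eq0 (@weighted_ge0 p) (Cw (cmap (atlas (c p)) p0) I) Ep.
rewrite ci /weighted zero_extE; last exact: cimgP.
rewrite /local_fun cmapK// => /eqP; rewrite mulf_eq0 (negPf rp0) /=.
by move/eqP.
Qed.

End Stokes.

(** * Wedge products as alternations *)

Section Alternation.
Context {R : realType} {d : nat}.
Implicit Types k l : nat.

Definition alternation k (F : 'M[R]_(k, d) -> R) (v : 'M[R]_(k, d)) : R :=
  \sum_(s : 'S_k) (-1) ^+ s * F (row_perm s v).

Definition tensor k l (F : 'M[R]_(k, d) -> R) (G : 'M[R]_(l, d) -> R)
    (v : 'M[R]_(k + l, d)) : R := F (usubmx v) * G (dsubmx v).

Fixpoint tensor_pow (w : 'M[R]_(2, d) -> R) (m : nat) : 'M[R]_(m.*2, d) -> R :=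
  match m with
  | 0 => fun=> 1
  | m'.+1 => tensor w (@tensor_pow w m')
  end.
Arguments tensor_pow : clear implicits.

Definition rshift_perm_fun k l (r : 'S_l) (i : 'I_(k + l)) : 'I_(k + l) :=
  match fintype.split i with inl a => lshift l a | inr b => rshift k (r b) end.

Lemma rshift_perm_inj k l (r : 'S_l) : injective (@rshift_perm_fun k l r).
Proof.
apply: (can_inj (g := @rshift_perm_fun k l r^-1%g)) => i; rewrite /rshift_perm_fun.
case: (fintype.splitP i) => [a ia|b ib].
  by rewrite (fintype.unsplitK (inl _ a)); apply/val_inj.
by rewrite (fintype.unsplitK (inr _ (r b))) permK; apply/val_inj.
Qed.

Definition rshift_perm k l (r : 'S_l) : 'S_(k + l) := perm (@rshift_perm_inj k l r).

Lemma rshift_permL k l (r : 'S_l) (a : 'I_k) :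
  rshift_perm k r (lshift l a) = lshift l a.
Proof. by rewrite permE /rshift_perm_fun (fintype.unsplitK (inl _ a)). Qed.

Lemma rshift_permR k l (r : 'S_l) (b : 'I_l) :
  rshift_perm k r (rshift k b) = rshift k (r b).
Proof. by rewrite permE /rshift_perm_fun (fintype.unsplitK (inr _ b)). Qed.

(** The sign is the determinant of the permutation matrix, which is block diagonal. *)
Lemma sign_rshift_perm k l (r : 'S_l) :
  (-1) ^+ rshift_perm k r = (-1) ^+ r :> R.
Proof.
rewrite -!det_perm.
have -> : perm_mx (rshift_perm k r) = block_mx 1%:M 0 0 (perm_mx r) :> 'M[R]_(k + l).
  apply/matrixP => i j; rewrite mxE -[i]fintype.splitK -[j]fintype.splitK.
  case: (fintype.split i) => a; case: (fintype.split j) => b /=;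
    rewrite ?rshift_permL ?rshift_permR ?block_mxEul ?block_mxEur ?block_mxEdl ?block_mxEdr !mxE.
  - by rewrite (inj_eq (@lshift_inj _ _)).
  - by rewrite eq_lrshift.
  - by rewrite eq_rlshift.
  - by rewrite (inj_eq (@rshift_inj _ _)).
by rewrite det_ublock det1 mul1r.
Qed.

Lemma eq_alternation k (F G : 'M[R]_(k, d) -> R) : F =1 G -> alternation F =1 alternation G.
Proof. by move=> FG v; apply: eq_bigr => s _; rewrite FG. Qed.

Lemma alternationZ k c (F : 'M[R]_(k, d) -> R) v :
  alternation (fun v => c * F v) v = c * alternation F v.
Proof. by rewrite /alternation mulr_sumr; apply: eq_bigr => s _; rewrite mulrCA. Qed.

Lemma alternation_tensor k l (F : 'M[R]_(k, d) -> R) (G : 'M[R]_(l, d) -> R) v :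
  alternation (tensor F (alternation G)) v = l`!%:R * alternation (tensor F G) v.
Proof.
transitivity (\sum_(r : 'S_l) alternation (tensor F G) v); last first.
  by rewrite sumr_const card_Sn mulr_natl.
rewrite /alternation /tensor.
under eq_bigr do rewrite mulr_sumr mulr_sumr.
rewrite exchange_big; apply: eq_bigr => r _.
rewrite [RHS](reindex_inj (mulgI (rshift_perm k r))); apply: eq_bigr => s _.
rewrite odd_permM signr_addb sign_rshift_perm.
have -> : usubmx (row_perm (rshift_perm k r * s)%g v) = usubmx (row_perm s v).
  by apply/matrixP => i j; rewrite !mxE permM rshift_permL.
have -> : dsubmx (row_perm (rshift_perm k r * s)%g v) = row_perm r (dsubmx (row_perm s v)).
  by apply/matrixP => i j; rewrite !mxE permM rshift_permR.
have ring_id (a b f g : R) : a * (f * (b * g)) = b * a * (f * g) by ring.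
exact: ring_id.
Qed.

End Alternation.

Arguments tensor_pow {R d} w m v.

Section WedgeAlternation.
Context {R : realType} {d : nat} {N : oriented_manifold R d}.

(** At each wedge the factor [(m.*2)]![produced by the inner alternation cancels against the
    normalisation, and only the factor]2[!] remains in the denominator. *)
Lemma wedge_powE (w : local_form N 2) m i x v :
  wedge_pow w m i x v = (2 ^+ m)^-1 * alternation (tensor_pow (w i x) m) v.
Proof.
elim: m v => [|m IH] v /=.
  rewrite expr0 invr1 mul1r /alternation (big_pred1 1%g) ?odd_perm1 ?mul1r// => s.
  by rewrite /= permS0 eqxx.
rewrite /wedge.
rewrite -[X in _ * X]/(alternation (tensor (w i x) (wedge_pow w m i x)) v).
rewrite (@eq_alternation _ _ _ _ (fun u => (2 ^+ m)^-1 *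
  tensor (w i x) (alternation (tensor_pow (w i x) m)) u)); last first.
  by move=> u; rewrite /tensor IH mulrCA.
rewrite alternationZ alternation_tensor /= natrM exprS.
have f0 : (m.*2)`!%:R != 0 :> R by rewrite pnatr_eq0 -lt0n fact_gt0.
have p0 : 2 ^+ m != 0 :> R by rewrite expf_neq0.
set f := (m.*2)`!%:R in f0 *; set p := 2 ^+ m in p0 *.
rewrite (_ : 2`! = 2%N)//; field.
by rewrite p0 f0.
Qed.

Lemma wedge_wedge_powE (nu : local_form N 1) (w : local_form N 2) m i x v :
  wedge nu (wedge_pow w m) i x v =
  (2 ^+ m)^-1 * alternation (tensor (nu i x) (tensor_pow (w i x) m)) v.
Proof.
rewrite /wedge.
rewrite -[X in _ * X]/(alternation (tensor (nu i x) (wedge_pow w m i x)) v).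
rewrite (@eq_alternation _ _ _ _ (fun u => (2 ^+ m)^-1 *
  tensor (nu i x) (alternation (tensor_pow (w i x) m)) u)); last first.
  by move=> u; rewrite /tensor wedge_powE mulrCA.
rewrite alternationZ alternation_tensor (_ : 1`! = 1%N)// mul1n.
have f0 : (m.*2)`!%:R != 0 :> R by rewrite pnatr_eq0 -lt0n fact_gt0.
by rewrite mulrCA mulKf.
Qed.

End WedgeAlternation.

(** * Multilinear functions of the rows of a matrix *)

Section Multilinear.
Context {R : realType}.

Lemma multilinear_rows_sum d k (F : 'M[R]_(k, d) -> R) (A : 'M[R]_(k, d)) (i0 : 'I_k)
    (I : Type) (r : seq I) (c : I -> R) (B : I -> 'M[R]_(k, d)) :
  multilinear_rows F -> row i0 A = \sum_(i <- r) c i *: row i0 (B i) ->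
  (forall i, row' i0 (B i) = row' i0 A) -> F A = \sum_(i <- r) c i * F (B i).
Proof.
move=> mF; elim: r A => [|i r IH] A.
  rewrite !big_nil => A0 _.
  have E := mF A A A i0 0 0; rewrite !mul0r !scale0r !addr0 in E.
  exact: E.
rewrite !big_cons => EA BA.
pose A' : 'M[R]_(k, d) := \matrix_(a, b) if a == i0 then (\sum_(i <- r) c i *: row i0 (B i)) 0 b else A a b.
have rA' : row i0 A' = \sum_(i <- r) c i *: row i0 (B i).
  by apply/rowP => b; rewrite mxE mxE eqxx.
have r'A' : row' i0 A' = row' i0 A.
  by apply/matrixP => a b; rewrite !mxE eq_sym (negPf (neq_lift _ _)).
rewrite (mF A (B i) A' i0 (c i) 1); last 3 first.
- by rewrite EA rA' scale1r.
- exact: BA.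
- exact: r'A'.
by rewrite mul1r (IH A')// => j; rewrite BA r'A'.
Qed.

Definition delta_rows d k (g : {ffun 'I_k -> 'I_d}) : 'M[R]_(k, d) :=
  \matrix_(i, j) (j == g i)%:R.

(** The first row is expanded in the basis; the induction hypothesis is then applied to [F] with
    that row fixed to a basis vector. *)
Lemma multilinear_expand d k (F : 'M[R]_(k, d) -> R) (v : 'M[R]_(k, d)) :
  multilinear_rows F ->
  F v = \sum_(g : {ffun 'I_k -> 'I_d}) (\prod_i v i (g i)) * F (delta_rows g).
Proof.
elim: k F v => [|k IH] F v mF.
  rewrite (big_pred1 (ffun0 (card_ord 0))) => [|g]; last first.
    by apply/esym/eqP/ffunP => -[].
  by rewrite big_ord0 mul1r; congr F; apply/matrixP => -[].
pose G b (w : 'M[R]_(k, d)) := F (col_mx (delta_mx 0 b : 'rV_d) w).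
have mG b : multilinear_rows (G b).
  move=> A B C i0 c1 c2 rA rB rC.
  have rowE (M : 'M[R]_(k, d)) : row (rshift 1 i0) (col_mx (delta_mx 0 b) M) = row i0 M.
    by apply/rowP => j; rewrite !mxE (fintype.unsplitK (inr _ i0)).
  have row'E (M M' : 'M[R]_(k, d)) : row' i0 M = row' i0 M' ->
      row' (rshift 1 i0) (col_mx (delta_mx 0 b) M) =
      row' (rshift 1 i0) (col_mx (delta_mx 0 b) M').
    move=> MM; apply/matrixP => a j; rewrite !mxE.
    case: fintype.splitP => // a' Ea; have a'i0 : i0 != a'.
      apply/eqP => ia; have := neq_lift (rshift 1 i0) a; rewrite (_ : lift _ a = rshift 1 i0) ?eqxx//.
      by apply/ord_inj; rewrite Ea -ia.
    have [a'' ->] := unlift_some a'i0.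
    by have := congr1 (fun T : 'M[R]_(k.-1, d) => T a'' j) MM; rewrite !mxE => ->.
  apply: (mF _ _ _ (rshift 1 i0)); first by rewrite !rowE.
    exact: row'E.
  exact: row'E.
have -> : F v = \sum_b v ord0 b * G b (dsubmx (v : 'M[R]_(1 + k, d))).
  apply: (multilinear_rows_sum (i0 := ord0)) => //.
    apply/rowP => j; rewrite summxE (bigD1 j)//= big1 => [|b bj].
      rewrite addr0 !mxE; case: fintype.splitP => // a _; rewrite !mxE.
      by rewrite [a]ord1 !eqxx mulr1.
    rewrite !mxE; case: fintype.splitP => // a _.
    by rewrite !mxE [j == b]eq_sym (negPf bj) andbF mulr0.
  move=> b; apply/matrixP => a j; rewrite !mxE.
  case: fintype.splitP => [a' Ea|a' Ea].
    by have := Ea; rewrite [a']ord1 => /esym/eqP; rewrite -[_ == _]/(ord0 == lift ord0 a) (negPf (neq_lift _ _)).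
  by rewrite !mxE; congr (v _ _); apply/ord_inj.
under eq_bigr do rewrite IH// mulr_sumr.
rewrite pair_big /=.
pose h (bg : 'I_d * {ffun 'I_k -> 'I_d}) : {ffun 'I_k.+1 -> 'I_d} :=
  [ffun i => if unlift ord0 i is Some j then bg.2 j else bg.1].
rewrite [RHS](reindex h); last first.
  exists (fun g : {ffun 'I_k.+1 -> 'I_d} => (g ord0, [ffun j => g (lift ord0 j)])).
    move=> [b g] _; rewrite /h ffunE unlift_none; congr (_, _).
    by apply/ffunP => j; rewrite !ffunE liftK.
  move=> g _; apply/ffunP => i; rewrite ffunE.
  by case: unliftP => [j ->|->]; rewrite ?ffunE.
apply: eq_bigr => -[b g] _; rewrite big_ord_recl /h ffunE unlift_none /= mulrA.
congr (_ * _ * _).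
  apply: eq_bigr => i _; rewrite ffunE liftK mxE; congr (v _ _); exact/val_inj.
rewrite /G; congr F; apply/matrixP => i j; rewrite !mxE ffunE.
case: fintype.splitP => [a Ea|a Ea].
  have -> : i = ord0 by apply/ord_inj; rewrite Ea [a]ord1.
  by rewrite unlift_none mxE [a]ord1 eqxx.
have -> : i = lift ord0 a by apply/ord_inj; rewrite Ea.
by rewrite liftK mxE.
Qed.

(** After expansion of [F] on basis rows, the alternating sum of each monomial in the entries of [v]
    is [\det v] times a constant that depends only on the choice [g] of columns. *)
Lemma alternation_det d (F : 'M[R]_d -> R) (v : 'M[R]_d) :
  multilinear_rows F -> alternation F v = \det v * alternation F 1%:M.
Proof.
move=> mF.
have D (u : 'M[R]_d) (g : {ffun 'I_d -> 'I_d}) : \sum_(s : 'S_d) (-1) ^+ s * \prod_i u (s i) (g i) =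
    \det u * \det (delta_rows g).
  rewrite -(det_tr u) mulrC -det_mulmx; apply: eq_bigr => s _; congr (_ * _).
  apply: eq_bigr => i _; rewrite mxE (bigD1 (g i))//= !mxE eqxx mul1r.
  by rewrite big1 ?addr0// => j jg; rewrite !mxE (negPf jg) mul0r.
have E u : alternation F u = \det u *
    \sum_(g : {ffun 'I_d -> 'I_d}) \det (delta_rows g) * F (delta_rows g).
  rewrite /alternation; under eq_bigr do rewrite (multilinear_expand _ mF) mulr_sumr.
  rewrite exchange_big mulr_sumr; apply: eq_bigr => g _.
  rewrite mulrA -D mulr_suml; apply: eq_bigr => s _.
  by rewrite mulrA; congr (_ * _ * _); apply: eq_bigr => i _; rewrite mxE.
by rewrite E [in RHS]E det1 mul1r.
Qed.

End Multilinear.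

Section TensorForms.
Context {R : realType} {d : nat}.

Lemma row'_eq k (A B : 'M[R]_(k, d)) (i0 i : 'I_k) (j : 'I_d) :
  row' i0 B = row' i0 A -> i0 != i -> B i j = A i j.
Proof.
move=> BA /unlift_some[i' -> _].
by have := congr1 (fun M : 'M[R]_(k.-1, d) => M i' j) BA; rewrite !mxE.
Qed.

Lemma multilinear_tensor k l (F : 'M[R]_(k, d) -> R) (G : 'M[R]_(l, d) -> R) :
  multilinear_rows F -> multilinear_rows G -> multilinear_rows (tensor F G).
Proof.
move=> mF mG A B C i0 b c EA BA CA; rewrite /tensor.
have rowE j : A i0 j = b * B i0 j + c * C i0 j.
  by have := congr1 (fun M : 'rV[R]_d => M 0 j) EA; rewrite !mxE.
have [a Ea|a Ea] := fintype.splitP i0.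
  have i0E : i0 = lshift l a by exact/ord_inj.
  have dE M : row' i0 M = row' i0 A -> dsubmx (M : 'M[R]_(k + l, d)) = dsubmx A.
    move=> MA; apply/matrixP => i j; rewrite !mxE; apply: (row'_eq _ MA).
    by rewrite i0E eq_lrshift.
  have uE M : row' i0 M = row' i0 A ->
      row' a (usubmx (M : 'M[R]_(k + l, d))) = row' a (usubmx A).
    move=> MA; apply/matrixP => i j; rewrite !mxE; apply: (row'_eq _ MA).
    by rewrite i0E (inj_eq (@lshift_inj _ _)) neq_lift.
  rewrite (mF _ (usubmx B) (usubmx C) a b c) ?uE//; last first.
    by apply/rowP => j; rewrite !mxE -i0E.
  by rewrite !dE// mulrDl !mulrA.
have i0E : i0 = rshift k a by exact/ord_inj.
have uE M : row' i0 M = row' i0 A -> usubmx (M : 'M[R]_(k + l, d)) = usubmx A.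
  move=> MA; apply/matrixP => i j; rewrite !mxE; apply: (row'_eq _ MA).
  by rewrite i0E eq_rlshift.
have dE M : row' i0 M = row' i0 A ->
    row' a (dsubmx (M : 'M[R]_(k + l, d))) = row' a (dsubmx A).
  move=> MA; apply/matrixP => i j; rewrite !mxE; apply: (row'_eq _ MA).
  by rewrite i0E (inj_eq (@rshift_inj _ _)) neq_lift.
rewrite (mG _ (dsubmx B) (dsubmx C) a b c) ?dE//; last first.
  by apply/rowP => j; rewrite !mxE -i0E.
by rewrite !uE// mulrDr !(mulrCA _ b) !(mulrCA _ c).
Qed.

Lemma multilinear_tensor_pow (w : 'M[R]_(2, d) -> R) m :
  multilinear_rows w -> multilinear_rows (tensor_pow w m).
Proof.
move=> mw; elim: m => [|m IH]; first by move=> A B C [].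
exact: (@multilinear_tensor 2 m.*2 w (tensor_pow w m) mw IH).
Qed.

Definition covector (u : 'I_d -> R) (v : 'M[R]_(1, d)) : R := \sum_a v 0 a * u a.

Definition bilinear_of (B : 'I_d -> 'I_d -> R) (v : 'M[R]_(2, d)) : R :=
  \sum_a \sum_b v 0 a * (v 1 b * B a b).

Lemma multilinear_covector u : multilinear_rows (covector u).
Proof.
move=> A B C i0 b c EA _ _; rewrite /covector !mulr_sumr -big_split /=.
apply: eq_bigr => a _.
have := congr1 (fun M : 'rV[R]_d => M 0 a) EA; rewrite !mxE (ord1 i0) => ->.
by rewrite mulrDl !mulrA.
Qed.

Lemma multilinear_bilinear_of B : multilinear_rows (bilinear_of B).
Proof.
move=> A A1 A2 i0 b c EA E1 E2; rewrite /bilinear_of !mulr_sumr -big_split /=.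
apply: eq_bigr => j _; rewrite !mulr_sumr -big_split /=; apply: eq_bigr => k _.
have rowE j' : A i0 j' = b * A1 i0 j' + c * A2 i0 j'.
  by have := congr1 (fun M : 'rV[R]_d => M 0 j') EA; rewrite !mxE.
have [i00|i01] : i0 = 0 \/ i0 = 1.
  by case: i0 {EA E1 E2 rowE} => -[|[|//]] i0; [left|right]; exact/ord_inj.
- rewrite -i00 rowE (row'_eq (i := 1) k E1) ?(row'_eq (i := 1) k E2) ?i00//; ring.
- rewrite -i01 rowE (row'_eq (i := 0) j E1) ?(row'_eq (i := 0) j E2) ?i01//; ring.
Qed.

Lemma covector_mulmx u (J : 'M[R]_d) v :
  covector u (v *m J) = covector (fun a => \sum_b J a b * u b) v.
Proof.
rewrite /covector; under eq_bigr do rewrite mxE mulr_suml.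
rewrite exchange_big; apply: eq_bigr => a _; rewrite mulr_sumr.
by apply: eq_bigr => b _; rewrite mulrA.
Qed.

Lemma bilinear_of_mulmx B (J : 'M[R]_d) v :
  bilinear_of B (v *m J) =
  bilinear_of (fun a b => \sum_c \sum_e J a c * (J b e * B c e)) v.
Proof.
rewrite /bilinear_of.
transitivity (\sum_c \sum_e \sum_a \sum_b v 0 a * (v 1 b * (J a c * (J b e * B c e)))).
  apply: eq_bigr => c _; apply: eq_bigr => e _; rewrite !mxE mulr_suml.
  apply: eq_bigr => a _; rewrite mulr_suml mulr_sumr.
  by apply: eq_bigr => b _; ring.
transitivity (\sum_a \sum_b \sum_c \sum_e v 0 a * (v 1 b * (J a c * (J b e * B c e)))).
  under eq_bigr do rewrite exchange_big.
  rewrite exchange_big; apply: eq_bigr => a _.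
  under eq_bigr do rewrite exchange_big.
  by rewrite exchange_big.
apply: eq_bigr => a _; apply: eq_bigr => b _.
by rewrite !mulr_sumr; apply: eq_bigr => c _; rewrite !mulr_sumr.
Qed.

Lemma tensor_mulmx k l (F F' : 'M[R]_(k, d) -> R) (G G' : 'M[R]_(l, d) -> R)
    (J : 'M[R]_d) : (forall v, F' v = F (v *m J)) -> (forall v, G' v = G (v *m J)) ->
  forall v, tensor F' G' v = tensor F G (v *m J).
Proof.
move=> FF GG v; rewrite /tensor FF GG.
by congr (F _ * G _); apply/matrixP => i j; rewrite !mxE; apply: eq_bigr => b _; rewrite !mxE.
Qed.

Lemma tensor_pow_mulmx (w w' : 'M[R]_(2, d) -> R) m (J : 'M[R]_d) :
  (forall v, w' v = w (v *m J)) ->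
  forall v, tensor_pow w' m v = tensor_pow w m (v *m J).
Proof. by move=> ww; elim: m => [//|m IH] v; exact: tensor_mulmx. Qed.

Lemma alternation_mulmx (F F' : 'M[R]_d -> R) (J : 'M[R]_d) : multilinear_rows F ->
  (forall v, F' v = F (v *m J)) ->
  alternation F' 1%:M = \det J * alternation F 1%:M.
Proof.
move=> mF FF; rewrite -(alternation_det _ mF); apply: eq_bigr => s _.
by rewrite FF !row_permE mulmx1.
Qed.

(** Indexing by natural numbers turns the splitting of the rows into a shift of [e], without casts
    between ordinals. *)
Definition basis_rows k (e : nat -> 'I_d) : 'M[R]_(k, d) :=
  \matrix_(i, j) (j == e i)%:R.

Lemma usubmx_basis_rows k l e : usubmx (basis_rows (k + l) e) = basis_rows k e.
Proof. by apply/matrixP => i j; rewrite !mxE. Qed.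

Lemma dsubmx_basis_rows k l e :
  dsubmx (basis_rows (k + l) e) = basis_rows l (fun a => e (k + a)%N).
Proof. by apply/matrixP => i j; rewrite !mxE. Qed.

Lemma sum_basis_row (e : 'I_d) (f : 'I_d -> R) : \sum_a (a == e)%:R * f a = f e.
Proof.
by rewrite (bigD1 e)//= eqxx mul1r big1 ?addr0// => a /negPf ->; rewrite mul0r.
Qed.

Lemma covector_basis_rows u e : covector u (basis_rows 1 e) = u (e 0).
Proof. by rewrite /covector; under eq_bigr do rewrite mxE; exact: sum_basis_row. Qed.

Lemma bilinear_of_basis_rows B e : bilinear_of B (basis_rows 2 e) = B (e 0) (e 1).
Proof.
rewrite /bilinear_of; under eq_bigr do rewrite -mulr_sumr mxE.
rewrite sum_basis_row; under eq_bigr do rewrite mxE.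
exact: sum_basis_row.
Qed.

Lemma tensor_pow_basis_rows B m e :
  tensor_pow (bilinear_of B) m (basis_rows m.*2 e) =
  \prod_(j < m) B (e j.*2) (e j.*2.+1).
Proof.
elim: m e => [|m IH] e; first by rewrite big_ord0.
rewrite /= /tensor (usubmx_basis_rows 2 m.*2) (dsubmx_basis_rows 2 m.*2) IH.
by rewrite bilinear_of_basis_rows big_ord_recl.
Qed.

End TensorForms.

(** * Alternating sums over permutations *)

Section PermutationRows.
Context {R : realType} {d : nat}.

(** Meaningful for [a <= d] only; [inord] sends larger numbers to the index 0. *)
Definition perm_nat (s : 'S_d.+1) (a : nat) : 'I_d.+1 := s (inord a).

Lemma perm_mx_basis_rows (s : 'S_d.+1) : perm_mx s = basis_rows d.+1 (perm_nat s) :> 'M[R]_d.+1.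
Proof. by apply/matrixP => i j; rewrite !mxE /perm_nat inord_val eq_sym. Qed.

Lemma alternation_basis_rows (F : 'M[R]_d.+1 -> R) : alternation F 1%:M =
  \sum_(s : 'S_d.+1) (-1) ^+ s * F (basis_rows d.+1 (perm_nat s)).
Proof.
by apply: eq_bigr => s _; rewrite row_permE mulmx1 perm_mx_basis_rows.
Qed.

Lemma sign_sum_perm_nat (a b : nat) (H : (nat -> 'I_d.+1) -> R) :
  (a <= d)%N -> (b <= d)%N -> a != b ->
  (forall e e', e' a = e b -> e' b = e a ->
    (forall c, (c <= d)%N -> c != a -> c != b -> e' c = e c) -> H e' = H e) ->
  \sum_(s : 'S_d.+1) (-1) ^+ s * H (perm_nat s) = 0.
Proof.
move=> ad bd ab HH; apply: (@sign_sum_swap _ _ (inord a) (inord b)).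
  by apply: contra ab => /eqP/(congr1 val); rewrite /= !inordK// => ->.
move=> s; apply: HH; rewrite /perm_nat; [by rewrite permM tpermL|by rewrite permM tpermR|].
move=> c cd ca cb; rewrite permM tpermD//.
  by apply: contra ca => /eqP/(congr1 val); rewrite /= !inordK// => ->.
by apply: contra cb => /eqP/(congr1 val); rewrite /= !inordK// => ->.
Qed.

End PermutationRows.

Section AlternatingSums.
Context {R : realType} {m : nat}.
Let D := m.*2.+3.
Implicit Types (s : 'S_D) (e : nat -> 'I_D) (N E : 'I_D -> R) (B T : 'I_D -> 'I_D -> R).

(** Slot 0 carries nu, slot 1 the direction of differentiation, slot 2 eta, and the pairs (3, 4),
    (5, 6), ... the factors d eta. *)
Let tail B (e : nat -> 'I_D) : R := \prod_(j < m) B (e j.*2.+3) (e j.*2.+4).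

Let tail_but B (j : 'I_m) (e : nat -> 'I_D) : R :=
  \prod_(i < m | i != j) B (e i.*2.+3) (e i.*2.+4).

Let alt (H : (nat -> 'I_D) -> R) : R := \sum_(s : 'S_D) (-1) ^+ s * H (perm_nat s).

Let altD H K : alt (fun e => H e + K e) = alt H + alt K.
Proof. by rewrite /alt -big_split; apply: eq_bigr => s _; rewrite mulrDr. Qed.

Let alt_sum (I : Type) (r : seq I) (H : I -> (nat -> 'I_D) -> R) :
  alt (fun e => \sum_(i <- r) H i e) = \sum_(i <- r) alt (H i).
Proof.
by rewrite /alt exchange_big; apply: eq_bigr => s _; rewrite mulr_sumr.
Qed.

Let eq_alt H K : (forall e, H e = K e) -> alt H = alt K.
Proof. by move=> HK; apply: eq_bigr => s _; rewrite HK. Qed.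

Let altZ c H : alt (fun e => c * H e) = c * alt H.
Proof. by rewrite /alt mulr_sumr; apply: eq_bigr => s _; rewrite mulrCA. Qed.

Let alt_swap01 T E B : (forall a b, T a b = T b a) ->
  alt (fun e => T (e 1) (e 0) * (E (e 2) * tail B e)) = 0.
Proof.
move=> Ts; apply: (sign_sum_perm_nat (a := 0) (b := 1)) => // e e' e0 e1 ec.
rewrite e0 e1 Ts (ec 2)//; congr (_ * (_ * _)).
by apply: eq_bigr => j _; rewrite !ec//; have := ltn_ord j; rewrite -!muln2; lia.
Qed.

Let alt_swap12 T N B : (forall a b, T a b = T b a) ->
  alt (fun e => N (e 0) * (T (e 1) (e 2) * tail B e)) = 0.
Proof.
move=> Ts; apply: (sign_sum_perm_nat (a := 1) (b := 2)) => // e e' e1 e2 ec.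
rewrite e1 e2 Ts (ec 0)//; congr (_ * (_ * _)).
by apply: eq_bigr => j _; rewrite !ec//; have := ltn_ord j; rewrite -!muln2; lia.
Qed.

Let alt_swap_tail (T : 'I_D -> 'I_D -> 'I_D -> R) N E B (j : 'I_m) :
  (forall a b c, T a b c = T b a c) ->
  alt (fun e => N (e 0) * (E (e 2) *
    (T (e 1) (e j.*2.+3) (e j.*2.+4) * tail_but B j e))) = 0.
Proof.
move=> Ts; have := ltn_ord j => jm.
apply: (sign_sum_perm_nat (a := 1) (b := j.*2.+3)) => //.
  by rewrite -!muln2; lia.
move=> e e' e1 e2 ec.
have ec' c : (c <= m.*2.+2)%N -> c != 1%N -> c != j.*2.+3 -> e' c = e c by exact: ec.
rewrite e1 e2 Ts (ec' 0)// (ec' 2)// (ec' j.*2.+4); last 3 first.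
- by rewrite -!muln2; lia.
- by [].
- by rewrite -!muln2; lia.
congr (_ * (_ * (_ * _))); apply: eq_bigr => i ij.
have im := ltn_ord i; have ij' : nat_of_ord i != j by [].
by rewrite !ec'//; rewrite -!muln2; lia.
Qed.

Let alt_swap_tail' (T : 'I_D -> 'I_D -> 'I_D -> R) N E B (j : 'I_m) :
  (forall a b c, T a b c = T b a c) ->
  alt (fun e => N (e 0) * (E (e 2) *
    (T (e 1) (e j.*2.+4) (e j.*2.+3) * tail_but B j e))) = 0.
Proof.
move=> Ts; have := ltn_ord j => jm.
apply: (sign_sum_perm_nat (a := 1) (b := j.*2.+4)) => //.
  by rewrite -!muln2; lia.
move=> e e' e1 e2 ec.
have ec' c : (c <= m.*2.+2)%N -> c != 1%N -> c != j.*2.+4 -> e' c = e c by exact: ec.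
rewrite e1 e2 Ts (ec' 0)// (ec' 2)// (ec' j.*2.+3); last 3 first.
- by rewrite -!muln2; lia.
- by [].
- by rewrite -!muln2; lia.
congr (_ * (_ * (_ * _))); apply: eq_bigr => i ij.
have im := ltn_ord i; have ij' : nat_of_ord i != j by [].
by rewrite !ec'//; rewrite -!muln2; lia.
Qed.

(** The pointwise algebra of the exterior derivative of nu /\ eta /\ (d eta)^m. The symmetry of
    [DN], that is d nu = 0, kills the terms differentiating nu by the swap of slots 0 and 1; the
    symmetry of [DDE], that is d d eta = 0, kills those differentiating a factor d eta by the swap
    of slot 1 with a slot of that factor. Only the derivative of eta survives. *)
Lemma alternating_Leibniz N E DN DE (DDE : 'I_D -> 'I_D -> 'I_D -> R) :
  let B a b := DE a b - DE b a in
  (forall a b, DN a b = DN b a) -> (forall a b c, DDE a b c = DDE b a c) ->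
  \sum_(s : 'S_D) (-1) ^+ s * (let e := perm_nat s in
    N (e 0) * (E (e 2) * (\sum_(j < m)
        (DDE (e 1) (e j.*2.+3) (e j.*2.+4) - DDE (e 1) (e j.*2.+4) (e j.*2.+3)) *
        \prod_(i < m | i != j) B (e i.*2.+3) (e i.*2.+4)) +
      DE (e 1) (e 2) * \prod_(j < m) B (e j.*2.+3) (e j.*2.+4)) +
    DN (e 1) (e 0) * (E (e 2) * \prod_(j < m) B (e j.*2.+3) (e j.*2.+4))) =
  2^-1 * \sum_(s : 'S_D) (-1) ^+ s * (let e := perm_nat s in
    N (e 0) * \prod_(j < m.+1) B (e j.*2.+1) (e j.*2.+2)).
Proof.
move=> B DNs DDEs.
rewrite -[LHS]/(alt (fun e => N (e 0) * (E (e 2) * (\sum_(j < m)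
        (DDE (e 1) (e j.*2.+3) (e j.*2.+4) - DDE (e 1) (e j.*2.+4) (e j.*2.+3)) *
        tail_but B j e) +
      DE (e 1) (e 2) * tail B e) +
    DN (e 1) (e 0) * (E (e 2) * tail B e))).
rewrite -[X in 2^-1 * X]/(alt (fun e => N (e 0) *
  \prod_(j < m.+1) B (e j.*2.+1) (e j.*2.+2))).
(* [B] differs from [2 * DE] by the symmetric part of [DE] doubled, whose alternating sum is 0; this
   is the origin of the factor 1/2. *)
have -> : alt (fun e => N (e 0) * \prod_(j < m.+1) B (e j.*2.+1) (e j.*2.+2)) =
    2 * alt (fun e => N (e 0) * (DE (e 1) (e 2) * tail B e)).
  rewrite -altZ -[LHS]addr0.
  rewrite -[X in _ + X](@alt_swap12 (fun a b => DE a b + DE b a) N B); last first.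
    by move=> a b; rewrite addrC.
  rewrite -altD; apply: eq_alt => e; rewrite big_ord_recl /tail.
  rewrite [X in _ * (_ * X)](_ : _ = \prod_(j < m) B (e j.*2.+3) (e j.*2.+4))//.
  by rewrite {1}/B /=; ring.
rewrite mulKf ?pnatr_eq0// altD alt_swap01// addr0.
transitivity (alt (fun e => N (e 0) * (DE (e 1) (e 2) * tail B e)) +
  \sum_(j < m) (alt (fun e => N (e 0) * (E (e 2) *
      (DDE (e 1) (e j.*2.+3) (e j.*2.+4) * tail_but B j e))) +
    -1 * alt (fun e => N (e 0) * (E (e 2) *
      (DDE (e 1) (e j.*2.+4) (e j.*2.+3) * tail_but B j e))))); last first.
  rewrite big1 ?addr0// => j _.
  by rewrite alt_swap_tail// alt_swap_tail'// mulr0 addr0.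
under [X in _ = _ + X]eq_bigr do rewrite -altZ -altD.
rewrite -alt_sum -altD; apply: eq_alt => e.
rewrite addrC mulrDr; congr (_ + _); rewrite mulrA mulr_sumr; apply: eq_bigr => j _.
ring.
Qed.

End AlternatingSums.

(** * A primitive of the wedge product *)

Definition curl (R : realType) (d : nat) (eta : 'I_d -> 'rV[R]_d -> R)
    (a b : 'I_d) (y : 'rV[R]_d) : R :=
  'D_(delta_mx 0 a) (eta b) y - 'D_(delta_mx 0 b) (eta a) y.

Section DensityField.
Context {R : realType} {m : nat}.
Let D := m.*2.+3.
Variables (U : set 'rV[R]_D) (nu eta : 'I_D -> 'rV[R]_D -> R).

(* The density of nu /\ eta /\ (d eta)^m: the slot 1 of [e] is left free for
   the direction of differentiation. *)
Definition density_term (e : nat -> 'I_D) (y : 'rV[R]_D) : R :=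
  nu (e 0) y * (eta (e 2) y * \prod_(j < m) curl eta (e j.*2.+3) (e j.*2.+4) y).

Definition density_field (y : 'rV[R]_D) (a : 'I_D) : R :=
  \sum_(s : 'S_D | perm_nat s 1 == a) (-1) ^+ s * density_term (perm_nat s) y.

Hypothesis oU : open U.
Hypothesis Cnu : forall a, Ck_on 2 U (nu a).
Hypothesis Ceta : forall a, Ck_on 2 U (eta a).
Hypothesis nu_closed : forall x a b, U x ->
  'D_(delta_mx 0 a) (nu b) x = 'D_(delta_mx 0 b) (nu a) x.

Let Ccurl a b : Ck_on 1 U (curl eta a b).
Proof.
rewrite /curl; under eq_fun do rewrite -mulN1r.
apply: Ck_onD => //; first exact: (Ck_on_derive (delta_mx 0 a) oU (Ceta b)).
apply: Ck_onM => //; first exact: Ck_on_cst.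
exact: (Ck_on_derive (delta_mx 0 b) oU (Ceta a)).
Qed.

Let Ck_density_term e : Ck_on 1 U (density_term e).
Proof.
apply: Ck_onM => //; first exact: Ck_onW (Cnu _).
apply: Ck_onM => //; first exact: Ck_onW (Ceta _).
by apply: Ck_on_prod => // j _; exact: Ccurl.
Qed.

Lemma Ck_on_density_field a : Ck_on 1 U (fun y => density_field y a).
Proof.
apply: Ck_on_sum => // s _.
by apply: Ck_onM; [exact: oU|exact: Ck_on_cst|exact: Ck_density_term].
Qed.

Let DDE x p q r := 'D_(delta_mx 0 p) (fun y => 'D_(delta_mx 0 q) (eta r) y) x.

Let is_derive_density_term (e : nat -> 'I_D) x : U x ->
  is_derive x (delta_mx 0 (e 1)) (density_term e)
   (nu (e 0) x * (eta (e 2) x * (\sum_(j < m)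
        (DDE x (e 1) (e j.*2.+3) (e j.*2.+4) - DDE x (e 1) (e j.*2.+4) (e j.*2.+3)) *
        \prod_(i < m | i != j) curl eta (e i.*2.+3) (e i.*2.+4) x) +
      'D_(delta_mx 0 (e 1)) (eta (e 2)) x *
        \prod_(j < m) curl eta (e j.*2.+3) (e j.*2.+4) x) +
    'D_(delta_mx 0 (e 1)) (nu (e 0)) x *
      (eta (e 2) x * \prod_(j < m) curl eta (e j.*2.+3) (e j.*2.+4) x)).
Proof.
move=> Ux; set v := delta_mx 0 (e 1).
have dnu : is_derive x v (nu (e 0)) ('D_v (nu (e 0)) x).
  exact/derivableP/diff_derivable/((Cnu (e 0)).1 x Ux).
have deta : is_derive x v (eta (e 2)) ('D_v (eta (e 2)) x).
  exact/derivableP/diff_derivable/((Ceta (e 2)).1 x Ux).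
have dDeta p q : derivable (fun y => 'D_(delta_mx 0 p) (eta q) y) x v.
  exact/diff_derivable/((Ck_on_derive (delta_mx 0 p) oU (Ceta q)).1 x Ux).
have dcurl p q : derivable (curl eta p q) x v.
  exact/diff_derivable/((Ccurl p q).1 x Ux).
have Dcurl p q : 'D_v (curl eta p q) x =
    'D_v (fun y => 'D_(delta_mx 0 p) (eta q) y) x -
    'D_v (fun y => 'D_(delta_mx 0 q) (eta p) y) x.
  exact: (deriveB (dDeta p q) (dDeta q p)).
have dprod := @is_derive_prod _ _ 'I_m (index_enum 'I_m)
  (fun j => curl eta (e j.*2.+3) (e j.*2.+4)) x v (index_enum_uniq _)
  (fun j => dcurl _ _).
have -> : density_term e = nu (e 0) * (eta (e 2) *
    (fun y => \prod_(j <- index_enum 'I_m) curl eta (e j.*2.+3) (e j.*2.+4) y)) by [].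
apply: (is_derive_eq (is_deriveM dnu (is_deriveM deta dprod))).
rewrite /GRing.scale /=; congr (_ * (_ * _ + _) + _).
- by apply: eq_bigr => j _; rewrite Dcurl.
- by rewrite mulrC.
- by rewrite mulrC.
Qed.

(** A given permutation contributes only in the direction [a = perm_nat s 1], so the double sum
    collapses to the one treated by [alternating_Leibniz]. *)
Lemma divergence_density_field x : U x ->
  \sum_a 'D_(delta_mx 0 a) (fun y => density_field y a) x =
  2^-1 * \sum_(s : 'S_D) (-1) ^+ s * (let e := perm_nat s in
    nu (e 0) x * \prod_(j < m.+1) curl eta (e j.*2.+1) (e j.*2.+2) x).
Proof.
move=> Ux.
rewrite -(@alternating_Leibniz R m (nu^~ x) (eta^~ x)
  (fun a b => 'D_(delta_mx 0 a) (nu b) x) (fun a b => 'D_(delta_mx 0 a) (eta b) x)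
  (DDE x)); last 2 first.
- by move=> a b; exact: nu_closed.
- by move=> a b c; exact: (Schwarz _ _ oU (Ceta c) Ux).
transitivity (\sum_a \sum_(s : 'S_D | perm_nat s 1 == a)
    (-1) ^+ s * 'D_(delta_mx 0 (perm_nat s 1)) (density_term (perm_nat s)) x).
  apply: eq_bigr => a _.
  have Ea : (fun y => density_field y a) = (fun y =>
      \sum_(s <- [seq s : 'S_D <- index_enum _ | perm_nat s 1 == a])
        (-1) ^+ s * density_term (perm_nat s) y).
    by apply/funext => y; rewrite big_filter.
  have dterm (s : 'S_D) : is_derive x (delta_mx 0 a)
      (fun y => (-1) ^+ s * density_term (perm_nat s) y)
      ((-1) ^+ s * 'D_(delta_mx 0 a) (density_term (perm_nat s)) x).
    apply: is_deriveZ; apply/derivableP/diff_derivable.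
    exact: ((Ck_density_term (perm_nat s)).1 x Ux).
  rewrite Ea (@derive_val _ _ _ _ _ _ _ (is_derive_bigsum _ dterm)) big_filter.
  by apply: eq_bigr => s /eqP <-.
rewrite (exchange_big_dep xpredT)//=; apply: eq_bigr => s _.
rewrite (big_pred1 (perm_nat s 1)); last by move=> a; rewrite /= eq_sym.
by rewrite (@derive_val _ _ _ _ _ _ _ (is_derive_density_term (perm_nat s) Ux)).
Qed.

End DensityField.

(** * Forms in coordinates and their transformation laws *)

Section FormsInCharts.
Context {R : realType} {d : nat} {N : oriented_manifold R d.+1}.
Implicit Types (i j : chart_index N) (q : N) (w : local_form N 1).

Definition component w i (a : 'I_d.+1) (x : 'rV[R]_d.+1) : R := w i x (delta_mx 0 a).

Lemma covector_delta (u : 'I_d.+1 -> R) a : covector u (delta_mx 0 a) = u a.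
Proof.
by rewrite -(sum_basis_row a u); apply: eq_bigr => b _; rewrite mxE.
Qed.

Lemma covector_component w i q v : is_form w -> cdom (atlas i) q ->
  w i (cmap (atlas i) q) v = covector (component w i ^~ (cmap (atlas i) q)) v.
Proof.
move=> [mw _ _] qi; have [mlw _] := mw i q qi.
apply: (multilinear_rows_sum (i0 := 0) (B := fun a => delta_mx 0 a)) => //.
  apply/rowP => b; rewrite !mxE summxE (bigD1 b)//= big1 => [|a ab].
    by rewrite addr0 !mxE !eqxx mulr1.
  by rewrite !mxE [b == a]eq_sym (negPf ab) andbF mulr0.
by move=> a; apply/matrixP => -[].
Qed.

Lemma Ck_on_component_form k w i a : is_form w -> Ck_on k (cimg i) (component w i a).
Proof. by move=> [_ sw _]; exact: sw. Qed.

Lemma component_transition w i j q v : is_form w ->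
  cdom (atlas i) q -> cdom (atlas j) q ->
  w i (cmap (atlas i) q) v =
  w j (cmap (atlas j) q) (v *m 'J (transition i j) (cmap (atlas i) q)).
Proof. by move=> [_ _ tw] qi qj; exact: tw. Qed.

Lemma derive_linear_combination (f : 'rV[R]_d.+1 -> R) (x u : 'rV[R]_d.+1) :
  differentiable f x -> 'D_u f x = \sum_a u 0 a * 'D_(delta_mx 0 a) f x.
Proof.
move=> df; rewrite (deriveE _ df) linear_rV_sum; apply: eq_bigr => a _.
by rewrite (deriveE _ df).
Qed.

Lemma derive_form w i q (u v : 'rV[R]_d.+1) : is_form w -> cdom (atlas i) q ->
  'D_u (fun y => w i y v) (cmap (atlas i) q) =
  \sum_a \sum_b u 0 a * (v 0 b * 'D_(delta_mx 0 a) (component w i b) (cmap (atlas i) q)).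
Proof.
move=> fw qi; set x := cmap (atlas i) q.
have xi : cimg i x by exact: cimgP.
have dw b : differentiable (component w i b) x.
  exact: ((Ck_on_component_form 1 i b fw).1 x xi).
have E : \near x, (fun y => \sum_(b <- index_enum 'I_d.+1) v 0 b * component w i b y) x = w i x v.
  apply: filterS (open_nbhs_nbhs (conj (@open_cimg _ _ _ i) xi)) => _ [q' q'i <-].
  by rewrite (covector_component _ fw q'i).
rewrite -(near_eq_derive _ E).
have D b : is_derive x u (fun y => v 0 b * component w i b y) (v 0 b * 'D_u (component w i b) x).
  by apply: is_deriveZ; apply/derivableP/diff_derivable.
rewrite (@derive_val _ _ _ _ _ _ _ (is_derive_bigsum _ D)).
rewrite exchange_big; apply: eq_bigr => b _.
rewrite (derive_linear_combination _ (dw b)) mulr_sumr; apply: eq_bigr => a _.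
by rewrite mulrCA.
Qed.

Lemma ext_d_curl w i q v : is_form w -> cdom (atlas i) q ->
  ext_d w i (cmap (atlas i) q) v =
  bilinear_of (fun a b => curl (component w i) a b (cmap (atlas i) q)) v.
Proof.
move=> fw qi; rewrite /ext_d big_ord_recl big_ord1 expr0 mul1r expr1 mulN1r.
rewrite !(derive_form _ _ fw qi) /bilinear_of /curl.
have r0 b : row' ord0 v 0 b = v 1 b.
  by rewrite mxE; congr (v _ _); exact/ord_inj.
have r1 b : row' (lift ord0 ord0) v 0 b = v 0 b.
  by rewrite mxE; congr (v _ _); exact/ord_inj.
have e0 b : row ord0 v 0 b = v 0 b by rewrite mxE.
have e1 b : row (lift ord0 ord0) v 0 b = v 1 b.
  by rewrite mxE; congr (v _ _); exact/ord_inj.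
rewrite [X in _ - X]exchange_big -sumrB; apply: eq_bigr => a _.
rewrite -sumrB; apply: eq_bigr => b _.
by rewrite r0 r1 e0 e1; ring.
Qed.

(** Naturality of the exterior derivative: differentiating the transformation law of the components
    brings in second derivatives of the transition map, which are symmetric and cancel in the
    curl. *)
Lemma curl_transition w i j q a b : is_form w ->
  cdom (atlas i) q -> cdom (atlas j) q ->
  let J := 'J (transition i j) (cmap (atlas i) q) in
  curl (component w i) a b (cmap (atlas i) q) =
  \sum_c \sum_e J a c * (J b e * curl (component w j) c e (cmap (atlas j) q)).
Proof.
move=> fw qi qj J; set x := cmap (atlas i) q.
pose A := cmap (atlas i) @` (cdom (atlas i) `&` cdom (atlas j)).
have oA : open A by exact: open_cimg_cdom.
have Ax : A x by exists q.
pose psi e (y : 'rV[R]_d.+1) := transition i j y 0 e.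
have Cpsi e : Ck_on 2 A (psi e) by exact: Ck_on_transition.
pose h e y := component w j e (transition i j y).
have dt : differentiable (transition i j) x by exact: differentiable_transition.
have dwj e : differentiable (component w j e) (transition i j x).
  rewrite transitionE//.
  exact: ((Ck_on_component_form 1 j e fw).1 _ (cimgP qj)).
have Jpsi p e : 'D_(delta_mx 0 p) (psi e) x = J p e by rewrite /J (jacobianE dt) mxE.
have Dcomp p r : 'D_(delta_mx 0 p) (component w i r) x =
    \sum_e ('D_(delta_mx 0 p) (fun y => 'D_(delta_mx 0 r) (psi e) y) x * h e x +
      J r e * \sum_c J p c * 'D_(delta_mx 0 c) (component w j e) (cmap (atlas j) q)).
  have E : \near x, (fun y => \sum_(e <- index_enum 'I_d.+1)
      'D_(delta_mx 0 r) (psi e) y * h e y) x = component w i r x.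
    apply: filterS (open_nbhs_nbhs (conj oA Ax)) => _ [q' [q'i q'j] <-].
    rewrite /component (component_transition _ fw q'i q'j) covector_component//.
    rewrite covector_mulmx covector_delta.
    rewrite (jacobianE (differentiable_transition q'i q'j)).
    by apply: eq_bigr => e _; rewrite mxE /h transitionE.
  rewrite -(near_eq_derive _ E).
  have dh e : differentiable (h e) x by exact: (differentiable_comp dt (dwj e)).
  have dDpsi e : differentiable (fun y => 'D_(delta_mx 0 r) (psi e) y) x.
    exact: ((Ck_on_derive (delta_mx 0 r) oA (Cpsi e)).1 x Ax).
  have D e : is_derive x (delta_mx 0 p) (fun y => 'D_(delta_mx 0 r) (psi e) y * h e y)
      ('D_(delta_mx 0 r) (psi e) x * 'D_(delta_mx 0 p) (h e) x +
       h e x * 'D_(delta_mx 0 p) (fun y => 'D_(delta_mx 0 r) (psi e) y) x).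
    have D1 := derivableP (@diff_derivable _ _ _ _ _ (delta_mx 0 p) (dDpsi e)).
    have D2 := derivableP (@diff_derivable _ _ _ _ _ (delta_mx 0 p) (dh e)).
    exact: (is_deriveM D1 D2).
  rewrite (@derive_val _ _ _ _ _ _ _ (is_derive_bigsum _ D)).
  apply: eq_bigr => e _; rewrite addrC mulrC Jpsi; congr (_ + _ * _).
  rewrite (derive_comp_rV _ (dwj e) dt); apply: eq_bigr => c _.
  by rewrite [X in X * _]Jpsi transitionE.
rewrite /curl !Dcomp -sumrB.
have S e : 'D_(delta_mx 0 a) (fun y => 'D_(delta_mx 0 b) (psi e) y) x =
    'D_(delta_mx 0 b) (fun y => 'D_(delta_mx 0 a) (psi e) y) x.
  exact: (Schwarz _ _ oA (Cpsi e) Ax).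
transitivity (\sum_e \sum_c (J b e * (J a c * 'D_(delta_mx 0 c) (component w j e) (cmap (atlas j) q)) -
    J a e * (J b c * 'D_(delta_mx 0 c) (component w j e) (cmap (atlas j) q)))).
  by apply: eq_bigr => e _; rewrite S opprD addrACA subrr add0r !mulr_sumr -sumrB.
under eq_bigr do rewrite sumrB.
rewrite sumrB exchange_big -sumrB; apply: eq_bigr => c _.
by rewrite -sumrB; apply: eq_bigr => e _; ring.
Qed.

End FormsInCharts.

Section DensityContraction.
Context {R : realType} {m : nat}.
Let D := m.*2.+3.
Implicit Types (nu eta : 'I_D -> 'rV[R]_D -> R).

(** Up to a constant factor this is nu /\ u /\ eta /\ (d eta)^m on the standard frame. In this form
    the transformation law of a vector density follows from [alternation_mulmx]. *)
Lemma density_field_contraction nu eta (u : 'I_D -> R) y :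
  \sum_a u a * density_field nu eta y a =
  alternation (tensor (covector (nu^~ y)) (tensor (covector u) (tensor
    (covector (eta^~ y)) (tensor_pow (bilinear_of (fun a b => curl eta a b y)) m)))) 1%:M.
Proof.
rewrite alternation_basis_rows /density_field.
under eq_bigr do rewrite mulr_sumr.
rewrite (exchange_big_dep xpredT)//=; apply: eq_bigr => s _.
rewrite (big_pred1 (perm_nat s 1)); last by move=> a; rewrite /= eq_sym.
rewrite mulrCA; congr (_ * _); rewrite /tensor.
rewrite (usubmx_basis_rows 1 m.*2.+2) (dsubmx_basis_rows 1 m.*2.+2).
rewrite (usubmx_basis_rows 1 m.*2.+1) (dsubmx_basis_rows 1 m.*2.+1).
rewrite (usubmx_basis_rows 1 m.*2) (dsubmx_basis_rows 1 m.*2).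
by rewrite !covector_basis_rows tensor_pow_basis_rows /density_term mulrCA.
Qed.

End DensityContraction.

Section WedgeOfForms.
Context {R : realType} {m : nat} {N : oriented_manifold R m.*2.+1}.
Implicit Types (nu eta : local_form N 1).

Lemma wedge_ext_d_alternation nu eta i q v : is_form nu -> is_form eta ->
  cdom (atlas i) q ->
  wedge nu (wedge_pow (ext_d eta) m) i (cmap (atlas i) q) v =
  (2 ^+ m)^-1 * alternation (tensor (covector (component nu i ^~ (cmap (atlas i) q)))
    (tensor_pow (bilinear_of (fun a b =>
       curl (component eta i) a b (cmap (atlas i) q))) m)) v.
Proof.
move=> fnu feta qi; rewrite wedge_wedge_powE; congr (_ * _).
apply: eq_alternation => u; rewrite /tensor covector_component//; congr (_ * _).
have -> // : ext_d eta i (cmap (atlas i) q) = bilinear_of (fun a b =>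
    curl (component eta i) a b (cmap (atlas i) q)).
by apply/funext => w; exact: ext_d_curl.
Qed.

(** Both the vanishing of the form and its sign on positive frames can thus be tested on the
    standard frame. *)
Lemma wedge_ext_d_det nu eta i q v : is_form nu -> is_form eta ->
  cdom (atlas i) q ->
  wedge nu (wedge_pow (ext_d eta) m) i (cmap (atlas i) q) v =
  \det v * wedge nu (wedge_pow (ext_d eta) m) i (cmap (atlas i) q) 1%:M.
Proof.
move=> fnu feta qi; rewrite !wedge_ext_d_alternation// alternation_det; first by rewrite mulrCA.
apply: (multilinear_tensor (k := 1) (l := m.*2)); first exact: multilinear_covector.
exact/multilinear_tensor_pow/multilinear_bilinear_of.
Qed.

End WedgeOfForms.

Section NonnegativeExact.
Context {R : realType} {m : nat} {N : oriented_manifold R m.+1.*2.+1}.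
Variables (nu eta : local_form N 1).
Hypothesis N_compact : compact [set: N].
Hypothesis nu_form : is_form nu.
Hypothesis eta_form : is_form eta.
Hypothesis nu_closed : closed_form nu.

Let top := wedge nu (wedge_pow (ext_d eta) m.+1).

Let X i (x : 'rV[R]_(m.*2.+3)) a := density_field (component nu i) (component eta i) x a.

Let component_closed i x a b : cimg i x ->
  'D_(delta_mx 0 a) (component nu i b) x = 'D_(delta_mx 0 b) (component nu i a) x.
Proof.
move=> [q qi <-]; apply/eqP; rewrite -subr_eq0; apply/eqP.
have := nu_closed qi (basis_rows 2 (fun k => if k == 0%N then a else b)).
by rewrite ext_d_curl// bilinear_of_basis_rows.
Qed.

(** The factor 1/2 of the divergence formula and the normalisation [(2 ^+ m.+1)^-1] of the wedge
    power leave [2 ^+ m]. *)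
Let divergence_top i q : cdom (atlas i) q ->
  divergence X i (cmap (atlas i) q) = 2 ^+ m * top i (cmap (atlas i) q) 1%:M.
Proof.
move=> qi.
rewrite /divergence (divergence_density_field (@open_cimg _ _ _ i)
  (fun a => Ck_on_component_form 2 i a nu_form)
  (fun a => Ck_on_component_form 2 i a eta_form)
  (component_closed (i := i)) (cimgP qi)).
rewrite /top (wedge_ext_d_alternation (m := m.+1) _ nu_form eta_form qi).
rewrite mulrA exprS invfM mulrCA mulfV ?expf_neq0 ?pnatr_eq0// mulr1.
congr (_ * _); rewrite (alternation_basis_rows (d := m.*2.+2)).
apply: eq_bigr => s _; congr (_ * _); rewrite /tensor.
rewrite (usubmx_basis_rows 1 m.*2.+2) (dsubmx_basis_rows 1 m.*2.+2).
by rewrite covector_basis_rows (tensor_pow_basis_rows _ m.+1).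
Qed.

Lemma nonnegative_wedge_vanishes :
  (forall i q, cdom (atlas i) q -> 0 <= top i (cmap (atlas i) q) 1%:M) ->
  vanishing_form top.
Proof.
move=> top_ge0 i q qi v.
rewrite /top (wedge_ext_d_det (m := m.+1) _ nu_form eta_form qi).
suff : divergence X i (cmap (atlas i) q) = 0.
  rewrite divergence_top// => /eqP; rewrite mulf_eq0 expf_eq0 pnatr_eq0 andbF /=.
  by move=> /eqP E; rewrite -/top E mulr0.
apply: (divergence_eq0 N_compact) => //.
- move=> j a; apply: Ck_on_density_field; first exact: open_cimg.
  + by move=> b; exact: Ck_on_component_form.
  + by move=> b; exact: Ck_on_component_form.
- move=> j k p pj pk u; rewrite !density_field_contraction.
  apply: alternation_mulmx.
    apply: (multilinear_tensor (k := 1) (l := m.*2.+2)); first exact: multilinear_covector.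
    apply: (multilinear_tensor (k := 1) (l := m.*2.+1)); first exact: multilinear_covector.
    apply: (multilinear_tensor (k := 1) (l := m.*2)); first exact: multilinear_covector.
    exact/multilinear_tensor_pow/multilinear_bilinear_of.
  have form1 (w : local_form N 1) : is_form w -> forall v : 'M[R]_(1, m.*2.+3),
      covector (component w j ^~ (cmap (atlas j) p)) v =
      covector (component w k ^~ (cmap (atlas k) p))
        (v *m 'J (transition j k) (cmap (atlas j) p)).
    by move=> fw w'; rewrite -!covector_component// (component_transition _ fw pj pk).
  apply: (tensor_mulmx (k := 1) (l := m.*2.+2)); first exact: form1.
  apply: (tensor_mulmx (k := 1) (l := m.*2.+1)); first by move=> w; rewrite covector_mulmx.
  apply: (tensor_mulmx (k := 1) (l := m.*2)); first exact: form1.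
  apply: tensor_pow_mulmx => w; rewrite bilinear_of_mulmx; congr bilinear_of.
  by apply/funext => a; apply/funext => b; exact: curl_transition.
- move=> j p pj; rewrite divergence_top//; apply: mulr_ge0; last exact: top_ge0.
  by rewrite exprn_ge0.
Qed.

End NonnegativeExact.

(** * The path of confoliation forms *)

Section FormAlgebra.
Context {R : realType} {d : nat} {N : oriented_manifold R d.+1}.

Lemma eq_wedge_pow (w w' : local_form N 2) i x m v :
  (forall u, w i x u = w' i x u) -> wedge_pow w m i x v = wedge_pow w' m i x v.
Proof. by move=> /funext ww; rewrite !wedge_powE ww. Qed.

Lemma wedge_powZ (w w' : local_form N 2) (c : R) i x m v :
  (forall u, w i x u = c * w' i x u) ->
  wedge_pow w m i x v = c ^+ m * wedge_pow w' m i x v.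
Proof.
move=> ww; elim: m v => [|m IH] v; first by rewrite expr0 mul1r.
rewrite /= /wedge mulrCA; apply: (congr1 (fun z => _ * z)).
rewrite mulr_sumr; apply: eq_bigr => s _; rewrite ww IH exprS.
have ring_id (a e p q : R) : a * (c * p * (e * q)) = c * e * (a * (p * q)) by ring.
exact: ring_id.
Qed.

Lemma wedge_pathZ (w0 w1 : local_form N 1) (W W' : local_form N 2) (t c : R) i x m v :
  (forall u, W i x u = c * W' i x u) ->
  wedge (form_path w0 w1 t) (wedge_pow W m) i x v =
  c ^+ m * ((1 - t) * wedge w0 (wedge_pow W' m) i x v +
            t * wedge w1 (wedge_pow W' m) i x v).
Proof.
move=> WW; rewrite /wedge /form_path /form_add /form_scale.
rewrite [(1 - t) * _]mulrCA [t * (_ * _)]mulrCA -mulrDr [RHS]mulrCA.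
apply: (congr1 (fun z => _ * z)).
rewrite !mulr_sumr -big_split mulr_sumr; apply: eq_bigr => s _.
rewrite (wedge_powZ _ WW).
have ring_id (a e p q r : R) : a * (((1 - t) * p + t * q) * (e * r)) =
    e * ((1 - t) * (a * (p * r)) + t * (a * (q * r))) by ring.
exact: ring_id.
Qed.

Lemma ext_d_path (w0 w1 : local_form N 1) (t : R) i q v : is_form w0 -> is_form w1 ->
  cdom (atlas i) q ->
  ext_d (form_path w0 w1 t) i (cmap (atlas i) q) v =
  (1 - t) * ext_d w0 i (cmap (atlas i) q) v + t * ext_d w1 i (cmap (atlas i) q) v.
Proof.
move=> [_ s0 _] [_ s1 _] qi; rewrite /ext_d !mulr_sumr -big_split.
apply: eq_bigr => a _; set x := cmap _ _; set u := row a v; set w := row' a v.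
have xi : cimg i x by exact: cimgP.
have d0 : is_derive x u (fun y => w0 i y w) ('D_u (fun y => w0 i y w) x).
  exact/derivableP/diff_derivable/((s0 i w 1%N).1 x xi).
have d1 : is_derive x u (fun y => w1 i y w) ('D_u (fun y => w1 i y w) x).
  exact/derivableP/diff_derivable/((s1 i w 1%N).1 x xi).
have dD := is_deriveD (is_deriveZ (1 - t) d0) (is_deriveZ t d1).
have -> : 'D_u (fun y => form_path w0 w1 t i y w) x =
    (1 - t) * 'D_u (fun y => w0 i y w) x + t * 'D_u (fun y => w1 i y w) x.
  exact: (@derive_val _ _ _ _ _ _ _ dD).
by rewrite mulrDr mulrCA [_ * (t * _)]mulrCA.
Qed.

(** At a fixed point and frame the expression is a polynomial in [eps]. *)
Lemma continuous_wedge_pencil (w0 : local_form N 1) (W T : local_form N 2) i x m v :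
  continuous (fun eps : R =>
    wedge w0 (wedge_pow (form_add W (form_scale eps T)) m) i x v).
Proof.
suff C k u : Ck_on 0 [set: R] (fun eps =>
    wedge_pow (form_add W (form_scale eps T)) k i x u).
  move=> eps; have : Ck_on 0 [set: R] (fun eps : R =>
      wedge w0 (wedge_pow (form_add W (form_scale eps T)) m) i x v).
    apply: Ck_onM; [exact: openT|exact: Ck_on_cst|].
    apply: Ck_on_sum => [|s _]; first exact: openT.
    apply: Ck_onM; [exact: openT|exact: Ck_on_cst|].
    by apply: Ck_onM; [exact: openT|exact: Ck_on_cst|exact: C].
  by move=> H; exact: (H eps I).
elim: k u => [|k IH] u; first exact: Ck_on_cst.
apply: Ck_onM; [exact: openT|exact: Ck_on_cst|].
apply: Ck_on_sum => [|s _]; first exact: openT.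
apply: Ck_onM; [exact: openT|exact: Ck_on_cst|].
apply: Ck_onM; [exact: openT| |exact: IH].
apply: Ck_onD; [exact: openT|exact: Ck_on_cst|].
by apply: Ck_onM; [exact: openT|move=> y _; exact: cvg_id|exact: Ck_on_cst].
Qed.

End FormAlgebra.

Lemma limit_ge0 (R : realType) (f : R -> R) : continuous f ->
  (forall e, 0 < e <= 1 -> 0 < f e) -> 0 <= f 0.
Proof.
move=> cf f0; rewrite leNgt; apply/negP => fn.
have nf : 0 < - f 0 by rewrite oppr_gt0.
have /cvgrPdist_lt /(_ _ nf) /nbhs_ballP[r /= r0 H] := cf 0.
pose e := Num.min 1 (r / 2).
have e0 : 0 < e by rewrite lt_min ltr01 divr_gt0.
have e1 : e <= 1 by rewrite ge_min lexx.
have er : e < r by rewrite gt_min ltr_pdivrMr// ltr_pMr// ltr1n orbT.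
have fe : 0 < f e by apply: f0; rewrite e0.
have := H e; rewrite -ball_normE /ball_ /= sub0r normrN gtr0_norm// => /(_ er).
by rewrite ltr_norml => /andP[]; lra.
Qed.

Lemma affine_ge0_left (R : realFieldType) (A B : R) :
  (forall t, 0 < t <= 1 -> 0 <= (1 - t) * A + t * B) -> 0 <= A.
Proof.
move=> H; rewrite leNgt; apply/negP => A0.
have B0 : 0 <= B by have := H 1; rewrite ltr01 lexx subrr mul0r add0r mul1r; apply.
(* For this [t] the affine function takes the value [A / 2], which is negative. *)
pose t := - A / (2 * (B - A)).
have BA : 0 < 2 * (B - A) by lra.
have t0 : 0 < t by rewrite divr_gt0// oppr_gt0.
have t1 : t <= 1 by rewrite ler_pdivrMr// mul1r; lra.
have := H t; rewrite t0 t1 => /(_ isT).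
have -> : (1 - t) * A + t * B = A / 2.
  by rewrite /t; field; lra.
by lra.
Qed.

(* For 1 <= n, the dimension n.-1.*2.+1 is 2 n - 1. *)
Theorem proposition1p1 (R : realType) (n : nat) (hn : (1 <= n)%N)
    (N : oriented_manifold R n.-1.*2.+1) (N_closed : compact [set: N])
    (eta nu : local_form N 1) (tau : local_form N 2)
    (eta_contact : contact_form eta)
    (nu_form : is_form nu)
    (nu_nonsingular : nonsingular_form nu)
    (nu_closed : closed_form nu)
    (tau_form : is_form tau)
    (conf : forall t : R, 0 <= t <= 1 ->
       confoliation_form (form_path nu eta t) tau) :
  ((1 < n)%N ->
     vanishing_form (wedge nu (wedge_pow (ext_d eta) n.-1)) /\
     positive_form (wedge nu (wedge_pow tau n.-1))) /\
  (forall t : R, 0 < t <= 1 -> contact_form (form_path nu eta t)).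
Proof.
have [eta_form eta_pos] := eta_contact.
have one1 : 0 < (1 : R) <= 1 by rewrite ltr01 lexx.
have path_form t : 0 < t <= 1 -> is_form (form_path nu eta t).
  move=> /andP[t0 t1]; have t01 : 0 <= t <= 1 by rewrite (ltW t0) t1.
  by have [] := conf t t01 1 one1.
have dpath t i q u : cdom (atlas i) q ->
    ext_d (form_path nu eta t) i (cmap (atlas i) q) u =
    t * ext_d eta i (cmap (atlas i) q) u.
  move=> qi; rewrite (ext_d_path _ _ nu_form eta_form qi) nu_closed//.
  by rewrite mulr0 add0r.
case: n hn N N_closed eta nu tau eta_contact nu_form nu_nonsingular nu_closed
  tau_form conf eta_form eta_pos path_form dpath => [//|[|m]] _ N N_closed eta nu tau
  eta_contact nu_form _ nu_closed tau_form conf eta_form eta_pos path_form dpath.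
  (* For [n = 1] the wedge powers have exponent 0 and are the constant 1, so the confoliation
     inequality at epsilon 1 already is the contact condition. *)
  split => // t t01; split; first exact: path_form.
  move: t01 => /andP[t0 t1]; have t01 : 0 <= t <= 1 by rewrite (ltW t0) t1.
  by have [_ _] := conf t t01 1 one1.
have contact_path t i q v : cdom (atlas i) q ->
    wedge (form_path nu eta t) (wedge_pow (ext_d (form_path nu eta t)) m.+1) i
      (cmap (atlas i) q) v =
    t ^+ m.+1 * ((1 - t) * wedge nu (wedge_pow (ext_d eta) m.+1) i (cmap (atlas i) q) v +
      t * wedge eta (wedge_pow (ext_d eta) m.+1) i (cmap (atlas i) q) v).
  by move=> qi; apply: wedge_pathZ => u; exact: dpath.
have path_ge0 t i q v : 0 < t <= 1 -> cdom (atlas i) q -> 0 < \det v ->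
    0 <= wedge (form_path nu eta t) (wedge_pow (ext_d (form_path nu eta t)) m.+1) i
      (cmap (atlas i) q) v.
  move=> /andP[t0 t1] qi v0; have t01 : 0 <= t <= 1 by rewrite (ltW t0) t1.
  pose f eps := wedge (form_path nu eta t) (wedge_pow (form_add
    (ext_d (form_path nu eta t)) (form_scale eps tau)) m.+1) i (cmap (atlas i) q) v.
  have f0 : 0 <= f 0.
    apply: limit_ge0; first exact: continuous_wedge_pencil.
    by move=> e e01; have [_ _ H] := conf t t01 e e01; exact: H.
  suff -> : wedge (form_path nu eta t) (wedge_pow (ext_d (form_path nu eta t)) m.+1) i
      (cmap (atlas i) q) v = f 0 by [].
  rewrite /f /wedge; congr (_ * _); apply: eq_bigr => s _; congr (_ * (_ * _)).
  by apply: eq_wedge_pow => u; rewrite /form_add /form_scale mul0r addr0.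
have nu_ge0 i q v : cdom (atlas i) q -> 0 < \det v ->
    0 <= wedge nu (wedge_pow (ext_d eta) m.+1) i (cmap (atlas i) q) v.
  (* Divided by [t ^+ m.+1], the inequality [path_ge0] is affine in [t], with the value sought at
     [t = 0]. *)
  move=> qi v0; apply: (@affine_ge0_left _ _
    (wedge eta (wedge_pow (ext_d eta) m.+1) i (cmap (atlas i) q) v)) => t t01.
  have := path_ge0 t i q v t01 qi v0; rewrite contact_path//.
  by move: t01 => /andP[t0 _]; rewrite pmulr_rge0// exprn_gt0.
have nu0 : vanishing_form (wedge nu (wedge_pow (ext_d eta) m.+1)).
  apply: (nonnegative_wedge_vanishes N_closed nu_form eta_form nu_closed) => i q qi.
  by apply: nu_ge0 => //; rewrite det1.
split => [_|t t01].
  split=> // i q qi v v0.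
  have z01 : 0 <= (0 : R) <= 1 by rewrite lexx ler01.
  (* At [t = 0] the exterior derivative of the path vanishes, and epsilon = 1 leaves the power of
     [tau] itself. *)
  have [_ _ /(_ i q qi v v0)] := conf 0 z01 1 one1.
  rewrite (@wedge_pathZ _ _ _ nu eta _ tau 0 1); last first.
    by move=> u; rewrite /form_add /form_scale dpath// mul0r add0r.
  by rewrite expr1n mul1r subr0 mul1r mul0r addr0.
split; first exact: path_form.
move=> i q qi v v0; rewrite contact_path// nu0// mulr0 add0r.
have t0 : 0 < t by case/andP: t01.
by rewrite mulr_gt0 ?exprn_gt0// mulr_gt0// eta_pos.
Qed.
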